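(* Let $R$ be an order in $K$, $\mathfrak p$ a maximal ideal of $R$, $k=R/\mathfrak p$, $T=(\mathfrak p:\mathfrak p)$ and $A=T/\mathfrak p$. Let $J_1,\ldots,J_n$ be fractional $T$-ideals with multiplicator ring $T$ representing the distinct classes of $\bar W(T)$, let $\mathcal J_i=J_i/\mathfrak pJ_i$, and let $\Psi_i$ be the bijection $I\mapsto I/\mathfrak pJ_i$ from the set of fractional $R$-ideals $I$ with $\mathfrak pJ_i\subseteq I\subseteq J_i$ to the set of sub-$k$-spaces of $\mathcal J_i$. Let $\mathcal V_i$ be the set of sub-$k$-spaces $\mathcal I\subseteq\mathcal J_i$ with $\{a\in A: a\mathcal I\subseteq\mathcal I\}=k$ and $\mathcal IA=\mathcal J_i$. Let $U=\prod_{\mathfrak q}T_{\mathfrak q}^\times/R_{\mathfrak q}^\times$ ($\mathfrak q$ over all maximal ideals of $R$), identified with the group of invertible fractional $R$-ideals $L$ with $LT=T$ via $L\mapsto(x_{\mathfrak q}R_{\mathfrak q}^\times)_{\mathfrak q}$ where $L_{\mathfrak q}=x_{\mathfrak q}R_{\mathfrak q}$; let $U$ act on $\mathcal V_i$ by $L\cdot\Psi_i(I)=\Psi_i(LI)$. Then $U$ acts freely on each $\mathcal V_i$, and the maps $\Psi_i$ induce a bijection \[\Psi:\bar W(R)\longrightarrow\bigsqcup_{i=1}^n\mathcal V_i/U,\] sending the class of a fractional $R$-ideal $I_0$ with $(I_0:I_0)=R$ to the $U$-orbit of $\Psi_i(I)$, where $I$ is weakly equivalent to $I_0$ with $\mathfrak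 pJ_i\subseteq I\subseteq J_i$ and $IT=J_i$.
   Context: Let $Z$ be a Dedekind domain (in particular not a field) with fraction field $Q$, and let $K$ be an étale $Q$-algebra. A $Z$-lattice in $K$ is a finitely generated $Z$-submodule of $K$ containing a $Q$-basis of $K$. An order is a subring of $K$ that is a $Z$-lattice. A fractional $S$-ideal (for an order $S$) is an $S$-submodule of $K$ that is a $Z$-lattice; it is invertible if $I(S:I)=S$, where $(I:J)=\{a\in K: aJ\subseteq I\}$; the multiplicator ring of $I$ is $(I:I)$. For a maximal ideal $\mathfrak q$ of $S$, $S_{\mathfrak q}$ is the completion, and $I_{\mathfrak q}=I\otimes_S S_{\mathfrak q}$ (for an overorder $T$ of $R$, $T_{\mathfrak q}=T\otimes_R R_{\mathfrak q}$). Fractional $S$-ideals $I,J$ are weakly equivalent if $I_{\mathfrak q}\simeq J_{\mathfrak q}$ as $S_{\mathfrak q}$-modules for all maximal ideals $\mathfrak q$ of $S$. $\bar W(S)$ is the set of weak equivalence classes of fractional $S$-ideals $I$ with $(I:I)=S$. *)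

(* Defs.v *)
From HB Require Import structures.
From mathcomp Require Import all_boot all_order all_algebra all_field.
From mathcomp Require Import generic_quotient.
From mathcomp Require Import mathcomp_extra boolp classical_sets functions.

Set Implicit Arguments.
Unset Strict Implicit.
Unset Printing Implicit Defensive.
Import GRing.Theory.
Local Open Scope classical_set_scope.
Local Open Scope ring_scope.
Local Open Scope quotient_scope.

(* The list [:: (m1, n1); ...] stands for the formal sum m1 (x) n1 + ...;     *)
(* opposites need no separate generators: - (m (x) n) = (- m) (x) n.          *)
Section Tensor.
Variables (S : comNzRingType) (M N : lmodType S).

Inductive tens_eq : seq (M * N) -> seq (M * N) -> Prop :=
| tens_refl u : tens_eq u u
| tens_sym u v : tens_eq u v -> tens_eq v u
| tens_trans u v w : tens_eq u v -> tens_eq v w -> tens_eq u w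
| tens_cat u u' v v' :
    tens_eq u u' -> tens_eq v v' -> tens_eq (u ++ v) (u' ++ v')
| tens_comm u v : tens_eq (u ++ v) (v ++ u)
| tens_zero n : tens_eq [:: (0, n)] [::]
| tens_addl m m' n : tens_eq [:: (m + m', n)] [:: (m, n); (m', n)]
| tens_addr m n n' : tens_eq [:: (m, n + n')] [:: (m, n); (m, n')]
| tens_scale (s : S) m n : tens_eq [:: (s *: m, n)] [:: (m, s *: n)].

Lemma tens_equiv : equiv_class_of (fun u v => `[< tens_eq u v >]).
Proof.
split=> [u|u v|v u w].
- exact/asboolP/tens_refl.
- by apply/asboolP/asboolP; apply: tens_sym.
- by move=> /asboolP uv /asboolP vw; apply/asboolP/(tens_trans uv vw).
Qed.
Canonical tens_equiv_rel := EquivRelPack tens_equiv.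

Definition tensor : Type := {eq_quot tens_equiv_rel}.
HB.instance Definition _ := Choice.on tensor.

Definition tsum (u : seq (M * N)) : tensor := \pi_({eq_quot tens_equiv_rel}) u.
Definition trepr (x : tensor) : seq (M * N) :=
  repr (x : {eq_quot tens_equiv_rel}).
Definition tens (m : M) (n : N) : tensor := tsum [:: (m, n)].

Lemma treprK x : tsum (trepr x) = x.
Proof. exact: reprK. Qed.

Lemma tsumP u v : reflect (tens_eq u v) (tsum u == tsum v).
Proof. by rewrite -[_ == _]/(\pi u == \pi v :> {eq_quot _}) eqmodE; apply: asboolP. Qed.

Lemma tens_repr u : tens_eq (trepr (tsum u)) u.
Proof. by apply/tsumP; rewrite treprK. Qed.

Definition tadd (x y : tensor) := tsum (trepr x ++ trepr y).
Definition topp (x : tensor) := tsum [seq (- p.1, p.2) | p <- trepr x].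

Lemma taddE u v : tadd (tsum u) (tsum v) = tsum (u ++ v).
Proof. by apply/eqP/tsumP/tens_cat; apply: tens_repr. Qed.

Lemma taddA : associative tadd.
Proof.
by move=> x y z; rewrite -[x]treprK -[y]treprK -[z]treprK !taddE catA.
Qed.

Lemma taddC : commutative tadd.
Proof.
move=> x y; rewrite -[x]treprK -[y]treprK !taddE.
exact/eqP/tsumP/tens_comm.
Qed.

Lemma tadd0 : left_id (tsum [::]) tadd.
Proof. by move=> x; rewrite -[x]treprK taddE. Qed.

Lemma tens_opp u : tens_eq ([seq (- p.1, p.2) | p <- u] ++ u) [::].
Proof.
elim: u => [|[m n] u IH] /=; first exact: tens_refl.
apply: (tens_trans (v := [:: (- m, n); (m, n)] ++ (u ++ [seq (- p.1, p.2) | p <- u]))).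
  apply: (tens_cat (u := [:: _]) (u' := [:: _])); first exact: tens_refl.
  exact: (tens_comm _ (_ :: _)).
rewrite -[[::]]/([::] ++ [::] : seq (M * N)).
apply: tens_cat; last exact: tens_trans (tens_comm _ _) IH.
apply: tens_trans (tens_sym (tens_addl _ _ _)) _; rewrite addNr.
exact: tens_zero.
Qed.

Lemma taddN : left_inverse (tsum [::]) topp tadd.
Proof.
move=> x; rewrite -{2}[x]treprK taddE; apply/eqP/tsumP; exact: tens_opp.
Qed.

HB.instance Definition _ :=
  GRing.isZmodule.Build tensor taddA taddC tadd0 taddN.

Lemma tsum_cat u v : tsum (u ++ v) = tsum u + tsum v.
Proof. by rewrite -taddE. Qed.

Lemma tsumE u : tsum u = \sum_(p <- u) tens p.1 p.2.
Proof.
elim: u => [|[m n] u IH]; first by rewrite big_nil.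
by rewrite big_cons -IH -tsum_cat.
Qed.

Lemma tensDl m m' n : tens (m + m') n = tens m n + tens m' n.
Proof. by rewrite -tsum_cat; apply/eqP/tsumP/tens_addl. Qed.

Lemma tensDr m n n' : tens m (n + n') = tens m n + tens m n'.
Proof. by rewrite -tsum_cat; apply/eqP/tsumP/tens_addr. Qed.

Lemma tensZ s m n : tens (s *: m) n = tens m (s *: n).
Proof. exact/eqP/tsumP/tens_scale. Qed.

Lemma tens0l n : tens 0 n = 0.
Proof. exact/eqP/tsumP/tens_zero. Qed.

Lemma tensorP (x : tensor) : exists u, x = \sum_(p <- u) tens p.1 p.2.
Proof. by exists (trepr x); rewrite -tsumE treprK. Qed.

Lemma tensor_ind (P : tensor -> Prop) :
  P 0 -> (forall x y, P x -> P y -> P (x + y)) ->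
  (forall m n, P (tens m n)) -> forall x, P x.
Proof.
move=> P0 PD Pt x; have [u ->] := tensorP x.
elim: u => [|p u IH]; rewrite ?big_nil ?big_cons //.
by apply: PD => //; apply: Pt.
Qed.

Section Lift.
Variables (G : zmodType) (f : M -> N -> G).
Hypothesis fDl : forall m m' n, f (m + m') n = f m n + f m' n.
Hypothesis fDr : forall m n n', f m (n + n') = f m n + f m n'.
Hypothesis fZ : forall s m n, f (s *: m) n = f m (s *: n).

Definition tens_lift (x : tensor) : G := \sum_(p <- trepr x) f p.1 p.2.

Lemma tens_eq_sum u v :
  tens_eq u v -> \sum_(p <- u) f p.1 p.2 = \sum_(p <- v) f p.1 p.2.
Proof.
elim=> {u v} [//|u v _ -> //|u v w _ -> _ -> //|u u' v v' _ e1 _ e2|u v|n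
  |m m' n|m n n'|s m n]; rewrite ?big_cat ?big_cons ?big_nil /= ?addr0 //.
- by rewrite e1 e2.
- by rewrite addrC.
- by apply: (addIr (f 0 n)); rewrite -fDl !add0r.
Qed.

Lemma tens_lift_sum u : tens_lift (tsum u) = \sum_(p <- u) f p.1 p.2.
Proof. exact/tens_eq_sum/tens_repr. Qed.

Lemma tens_liftE m n : tens_lift (tens m n) = f m n.
Proof. by rewrite tens_lift_sum big_seq1. Qed.

Lemma tens_liftD : {morph tens_lift : x y / x + y}.
Proof.
move=> x y; rewrite -[x]treprK -[y]treprK -tsum_cat !tens_lift_sum.
by rewrite big_cat.
Qed.

End Lift.
End Tensor.

Arguments tens {S M N}.
Arguments tensorP {S M N}.

(* A copy of tensor M B which carries the B-module structure.                 *)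
Definition scalar_ext (S : comNzRingType) (M : lmodType S) (B : comAlgType S)
  : Type := tensor M B.

Section ScalarExtension.
Variables (S : comNzRingType) (M : lmodType S) (B : comAlgType S).
HB.instance Definition _ := GRing.Zmodule.on (scalar_ext M B).
Implicit Types (b : B) (x : scalar_ext M B).

Definition ext_scale b : scalar_ext M B -> scalar_ext M B :=
  tens_lift (fun m c => tens m (b * c) : scalar_ext M B).

Lemma ext_scaleE b m c : ext_scale b (tens m c) = tens m (b * c).
Proof.
apply: tens_liftE => [m1 m2 n|m1 n1 n2|s m1 n].
- exact: tensDl.
- by rewrite mulrDr tensDr.
- by rewrite tensZ scalerAr.
Qed.

Lemma ext_scaleD b : {morph ext_scale b : x y / x + y}.
Proof.
apply: tens_liftD => [m1 m2 n|m1 n1 n2|s m1 n].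
- exact: tensDl.
- by rewrite mulrDr tensDr.
- by rewrite tensZ scalerAr.
Qed.

Lemma ext_scale0 b : ext_scale b 0 = 0.
Proof. by apply: (addrI (ext_scale b 0)); rewrite -ext_scaleD !addr0. Qed.

Lemma ext_scale_sum b u :
  ext_scale b (\sum_(p <- u) tens p.1 p.2) = \sum_(p <- u) tens p.1 (b * p.2).
Proof.
rewrite (big_morph _ (@ext_scaleD b) (ext_scale0 b)).
by apply: eq_bigr => p _; rewrite ext_scaleE.
Qed.

Lemma ext_scaleA a b x : ext_scale a (ext_scale b x) = ext_scale (a * b) x.
Proof.
have [u ->] := tensorP x; rewrite !(ext_scale_sum b) ext_scale_sum.
rewrite (big_morph _ (@ext_scaleD a) (ext_scale0 a)).
by apply: eq_bigr => p _; rewrite ext_scaleE mulrA.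
Qed.

Lemma ext_scale1 : left_id 1 ext_scale.
Proof.
move=> x; have [u ->] := tensorP x; rewrite ext_scale_sum.
by apply: eq_bigr => p _; rewrite mul1r.
Qed.

Lemma ext_scaleDl x : {morph ext_scale^~ x : a b / a + b}.
Proof.
move=> a b; have [u ->] := tensorP x; rewrite !ext_scale_sum -big_split.
by apply: eq_bigr => p _; rewrite mulrDl tensDr.
Qed.

HB.instance Definition _ := GRing.Zmodule_isLmodule.Build B (scalar_ext M B)
  ext_scaleA ext_scale1 ext_scaleD ext_scaleDl.

End ScalarExtension.

(* A copy of tensor A B which carries the ring structure; see tensM.          *)
Definition tensor_alg (S : comNzRingType) (A B : comAlgType S) : Type :=
  tensor A B.

Section TensorAlgebra.
Variables (S : comNzRingType) (A B : comAlgType S).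
HB.instance Definition _ := GRing.Zmodule.on (tensor_alg A B).
Implicit Types x y z : tensor_alg A B.

Definition talg_act (a : A) (b : B) : tensor_alg A B -> tensor_alg A B :=
  tens_lift (fun a' b' => tens (a * a') (b * b') : tensor_alg A B).

Definition talg_mul x y : tensor_alg A B :=
  tens_lift (fun a b => talg_act a b y) x.

Lemma talg_act_bal a b :
  [/\ forall m m' n, tens (a * (m + m')) (b * n) =
                     tens (a * m) (b * n) + tens (a * m') (b * n)
                     :> tensor_alg A B,
      forall m n n', tens (a * m) (b * (n + n')) =
                     tens (a * m) (b * n) + tens (a * m) (b * n')
                     :> tensor_alg A B
    & forall s m n, tens (a * (s *: m)) (b * n) = tens (a * m) (b * (s *: n))
                     :> tensor_alg A B].
Proof.
split=> [m m' n|m n n'|s m n]; rewrite ?mulrDr ?tensDl ?tensDr //.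
by rewrite -!scalerAr tensZ.
Qed.

Lemma talg_actD a b : {morph talg_act a b : x y / x + y}.
Proof. by have [? ? ?] := talg_act_bal a b; apply: tens_liftD. Qed.

Lemma talg_actE a b a' b' : talg_act a b (tens a' b') = tens (a * a') (b * b').
Proof. by have [? ? ?] := talg_act_bal a b; apply: tens_liftE. Qed.

Lemma talg_act_sum a b u :
  talg_act a b (\sum_(p <- u) tens p.1 p.2) =
  \sum_(p <- u) tens (a * p.1) (b * p.2).
Proof.
have a0 : talg_act a b 0 = 0.
  by apply: (addrI (talg_act a b 0)); rewrite -talg_actD !addr0.
rewrite (big_morph _ (@talg_actD a b) a0).
by apply: eq_bigr => p _; rewrite talg_actE.
Qed.

Lemma talg_mul_bal y :
  [/\ forall m m' n, talg_act (m + m') n y = talg_act m n y + talg_act m' n y,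
      forall m n n', talg_act m (n + n') y = talg_act m n y + talg_act m n' y
    & forall s m n, talg_act (s *: m) n y = talg_act m (s *: n) y].
Proof.
have [u ->] := tensorP y.
split=> *; rewrite !talg_act_sum -?big_split; apply: eq_bigr => p _ /=.
- by rewrite mulrDl tensDl.
- by rewrite mulrDl tensDr.
- by rewrite -!scalerAl tensZ.
Qed.

Lemma talg_mulDl : left_distributive talg_mul +%R.
Proof. by move=> x x' y; have [? ? ?] := talg_mul_bal y; apply: tens_liftD. Qed.

Lemma talg_mul_tens a b y : talg_mul (tens a b) y = talg_act a b y.
Proof. by have [? ? ?] := talg_mul_bal y; apply: tens_liftE. Qed.

Lemma talg_mul_sum u y :
  talg_mul (\sum_(p <- u) tens p.1 p.2) y = \sum_(p <- u) talg_act p.1 p.2 y.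
Proof.
have m0 : talg_mul 0 y = 0.
  by apply: (addrI (talg_mul 0 y)); rewrite -talg_mulDl !addr0.
rewrite (big_morph (talg_mul^~ y) (fun x x' => talg_mulDl x x' y) m0).
by apply: eq_bigr => p _; rewrite talg_mul_tens.
Qed.

Lemma talg_mulC : commutative talg_mul.
Proof.
move=> x y; have [u ->] := tensorP x; have [v ->] := tensorP y.
rewrite !talg_mul_sum; under eq_bigr do rewrite talg_act_sum.
rewrite exchange_big; apply: eq_bigr => q _; rewrite talg_act_sum.
by apply: eq_bigr => p _; rewrite mulrC [p.2 * _]mulrC.
Qed.

Lemma talg_act0 a b : talg_act a b 0 = 0.
Proof. by apply: (addrI (talg_act a b 0)); rewrite -talg_actD !addr0. Qed.

Lemma talg_mul0 y : talg_mul 0 y = 0.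
Proof. by apply: (addrI (talg_mul 0 y)); rewrite -talg_mulDl !addr0. Qed.

Lemma talg_mulA : associative talg_mul.
Proof.
move=> x y z; elim/tensor_ind: x => [|x x' IH IH'|a b].
- by rewrite !talg_mul0.
- by rewrite !talg_mulDl IH IH'.
rewrite !talg_mul_tens; elim/tensor_ind: y => [|y y' IH IH'|a' b'].
- by rewrite talg_mul0 talg_act0 talg_mul0.
- by rewrite !(talg_actD, talg_mulDl) IH IH'.
rewrite talg_actE !talg_mul_tens; elim/tensor_ind: z => [|z z' IH IH'|c d].
- by rewrite !talg_act0.
- by rewrite !talg_actD IH IH'.
by rewrite !talg_actE !mulrA.
Qed.

Lemma talg_mul1 : left_id (tens 1 1) talg_mul.
Proof.
move=> x; rewrite talg_mul_tens; have [u ->] := tensorP x.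
by rewrite talg_act_sum; apply: eq_bigr => p _; rewrite !mul1r.
Qed.

HB.instance Definition _ := GRing.Zmodule_isComPzRing.Build (tensor_alg A B)
  talg_mulA talg_mulC talg_mul1 talg_mulDl.

Lemma tensM (a a' : A) (b b' : B) :
  (tens a b : tensor_alg A B) * tens a' b' = tens (a * a') (b * b').
Proof. by rewrite -talg_actE -talg_mul_tens. Qed.

End TensorAlgebra.

Section Cosets.
Variable K : comNzRingType.
Implicit Types A B N : set K.

(* Quotients A / N of additive subgroups N <= A of K are sets of cosets, so   *)
(* that R / p is literally a subset of T / p.                                 *)
Definition coset N (x : K) : set K := [set x + y | y in N].
Definition quot A N : set (set K) := [set coset N x | x in A].

Definition coset_add (c d : set K) : set K := [set x + y | x in c & y in d].
(* (a + P)(x + N) = ax + N, whenever this is well defined: see coset_mulE.     *)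
Definition coset_mul N (c d : set K) : set K :=
  [set z | exists a x, [/\ c a, d x & coset N (a * x) z]].

Definition prod_set A B : set K :=
  [set x | exists2 u : seq (K * K),
     (forall y, y \in u -> A y.1 /\ B y.2) & x = \sum_(y <- u) y.1 * y.2].

Definition colon A B : set K := [set a | forall x, B x -> A (a * x)].

Definition zmod_set A := A 0 /\ forall x y, A x -> A y -> A (x - y).

Lemma zmod_setN A x : zmod_set A -> A x -> A (- x).
Proof. by move=> [A0 AB] Ax; rewrite -[- x]add0r; apply: AB. Qed.

Lemma zmod_setD A x y : zmod_set A -> A x -> A y -> A (x + y).
Proof. by move=> zA Ax Ay; rewrite -[y]opprK; apply: zA.2 => //; apply: zmod_setN. Qed.

Lemma coset_refl N x : N 0 -> coset N x x.
Proof. by move=> N0; exists 0; rewrite ?addr0. Qed.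

Lemma cosetE N x z : coset N x z <-> N (z - x).
Proof.
split=> [[y Ny <-]|Nz]; first by rewrite addrC addKr.
by exists (z - x); rewrite // addrC subrK.
Qed.

Lemma eq_coset N x y : zmod_set N -> N (x - y) -> coset N x = coset N y.
Proof.
move=> zN Nxy; apply/seteqP; split=> z /cosetE Nz; apply/cosetE.
  by rewrite -(subrKA x); apply: zmod_setD.
by rewrite -(subrKA y) -[y - x]opprB; apply: zN.2.
Qed.

Lemma coset_eq N x y : N 0 -> coset N x = coset N y -> N (x - y).
Proof. by move=> N0 exy; apply/cosetE; rewrite -exy; apply: coset_refl. Qed.

Lemma coset_addE N x y : zmod_set N ->
  coset_add (coset N x) (coset N y) = coset N (x + y).
Proof.
move=> zN; apply/seteqP; split=> z.
  move=> [_ [u Nu <-]] [_ [v Nv <-] <-]; exists (u + v); last by rewrite addrACA.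
  exact: zmod_setD.
move=> [u Nu <-]; exists (x + u); first by exists u.
exists y; last by rewrite addrAC.
by apply: coset_refl; case: zN.
Qed.

Lemma coset_mulE N P a x : zmod_set N -> P 0 ->
  (forall y, N y -> N (a * y)) -> (forall u, P u -> N (u * x)) ->
  (forall u y, P u -> N y -> N (u * y)) ->
  coset_mul N (coset P a) (coset N x) = coset N (a * x).
Proof.
move=> zN P0 aN Px PN; apply/seteqP; split=> z.
  move=> [_ [_ [[u Pu <-] [y Ny <-] [w Nw <-]]]].
  exists (a * y + u * x + u * y + w); last first.
    by rewrite mulrDl !mulrDr !addrA.
  by do !(apply: zmod_setD => //); [apply: aN|apply: Px|apply: PN].
move=> axz; exists a, x; split=> //; apply: coset_refl => //.
by case: zN.
Qed.

Lemma prod_set_zmod A B : zmod_set A -> zmod_set (prod_set A B).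
Proof.
move=> zA; split; first by exists [::]; rewrite ?big_nil.
move=> _ _ [u uAB ->] [v vAB ->].
exists (u ++ [seq (- y.1, y.2) | y <- v]).
  move=> y; rewrite mem_cat => /orP[/uAB//|/mapP[z /vAB[Az Bz] ->]].
  by split=> //=; apply: zmod_setN.
rewrite big_cat big_map -sumrN; congr (_ + _).
by apply: eq_bigr => y _; rewrite mulNr.
Qed.

Lemma prod_set_ideal A B a : (forall x, A x -> A (a * x)) ->
  forall x, prod_set A B x -> prod_set A B (a * x).
Proof.
move=> aA _ [u uAB ->]; exists [seq (a * y.1, y.2) | y <- u].
  by move=> y /mapP[z /uAB[Az Bz] ->]; split=> //; apply: aA.
by rewrite big_map mulr_sumr; apply: eq_bigr => y _; rewrite mulrA.
Qed.

End Cosets.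

Record subring (K : comNzRingType) := Subring {
  subring_set :> set K;
  subring1 : subring_set 1;
  subringB : forall x y, subring_set x -> subring_set y -> subring_set (x - y);
  subringM : forall x y, subring_set x -> subring_set y -> subring_set (x * y)
}.

Lemma subring_zmod (K : comNzRingType) (S : subring K) : zmod_set S.
Proof.
by split; [rewrite -(subrr 1); apply: subringB|]; rewrite ?subring1 //;
   [apply: subring1..|apply: subringB].
Qed.

Definition subring_type K (S : subring K) : Type := set_type S.
Definition ring_val K (S : subring K) : subring_type S -> K := \val.

Section SubringType.
Variables (K : comNzRingType) (S : subring K).
HB.instance Definition _ := SubChoice.on (subring_type S).

Lemma subring_closedP : GRing.subring_closed (fun x => x \in (S : set K)).
Proof.
split=> [|x y|x y]; rewrite -!topredE /= ?inE.
- exact: subring1.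
- exact: subringB.
- exact: subringM.
Qed.

HB.instance Definition _ :=
  GRing.SubChoice_isSubComNzRing.Build K _ (subring_type S) subring_closedP.
End SubringType.

Record submod (K : comNzRingType) (S : subring K) := Submod {
  submod_set :> set K;
  submod_zmod : zmod_set submod_set;
  submodM : forall a x, subring_set S a -> submod_set x -> submod_set (a * x)
}.

Lemma submod_inj K (S : subring K) (I J : submod S) :
  I = J :> set K -> I = J.
Proof.
case: I J => [I zI sI] [J zJ sJ] /= eIJ; subst J.
by rewrite (Prop_irrelevance zI zJ) (Prop_irrelevance sI sJ).
Qed.

Definition submod_type K (S : subring K) (I : submod S) : Type := set_type I.

Section SubmodType.
Variables (K : comNzRingType) (S : subring K) (I : submod S).
HB.instance Definition _ := SubChoice.on (submod_type I).

Lemma submod_closedP : zmod_closed (fun x => x \in (I : set K)).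
Proof.
have [I0 IB] := submod_zmod I.
by split=> [|x y]; rewrite -!topredE /= ?inE //; apply: IB.
Qed.

HB.instance Definition _ :=
  GRing.SubChoice_isSubZmodule.Build K _ (submod_type I) submod_closedP.

Lemma submod_scaleP (a : subring_type S) (x : submod_type I) :
  \val a * \val x \in (I : set K).
Proof.
by apply/mem_set/submodM; apply/set_mem; [exact: (valP a)|exact: (valP x)].
Qed.

Definition submod_scale a x : submod_type I :=
  exist (fun y => y \in (I : set K)) _ (submod_scaleP a x).

Lemma submod_scaleE a x : \val (submod_scale a x) = \val a * \val x.
Proof. by []. Qed.

Lemma submod_scaleA a b x :
  submod_scale a (submod_scale b x) = submod_scale (a * b) x.
Proof. by apply: val_inj; rewrite !submod_scaleE rmorphM mulrA. Qed.

Lemma submod_scale1 : left_id 1 submod_scale.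
Proof. by move=> x; apply: val_inj; rewrite submod_scaleE rmorph1 mul1r. Qed.

Lemma submod_scaleDr : right_distributive submod_scale +%R.
Proof. by move=> a x y; apply: val_inj; exact: mulrDr. Qed.

Lemma submod_scaleDl x : {morph submod_scale^~ x : a b / a + b}.
Proof. by move=> a b; apply: val_inj; exact: mulrDl. Qed.

HB.instance Definition _ := GRing.Zmodule_isLmodule.Build
  (subring_type S) (submod_type I)
  submod_scaleA submod_scale1 submod_scaleDr submod_scaleDl.

End SubmodType.

Section SubmodOps.
Variables (K : comNzRingType) (S : subring K).
Implicit Types I J : submod S.

Definition ring_mod : submod S := Submod (subring_zmod S) (@subringM K S).

Definition prod_mod I J : submod S :=
  Submod (prod_set_zmod J (submod_zmod I))
         (fun a x Sa => prod_set_ideal (fun y => submodM Sa) (x := x)).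

Lemma colon_zmod I J : zmod_set (colon I J).
Proof.
have [I0 IB] := submod_zmod I; split=> [x _|a b aJ bJ x Jx].
  by rewrite mul0r.
by rewrite mulrBl; apply: IB; [apply: aJ|apply: bJ].
Qed.

Lemma colonM I J a x : subring_set S a -> colon I J x -> colon I J (a * x).
Proof. by move=> Sa xJ y Jy; rewrite -mulrA; apply/submodM/xJ. Qed.

Definition colon_mod I J : submod S := Submod (colon_zmod I J) (@colonM I J).

Definition pow_mod I (n : nat) : submod S := iter n (prod_mod I) ring_mod.

End SubmodOps.

Record overring (K : comNzRingType) (S : subring K) := Overring {
  overring_ring :> subring K;
  overringS : subring_set S `<=` overring_ring
}.

Section MultiplicatorRing.
Variables (K : comNzRingType) (S : subring K) (I : submod S).

Lemma mult_ring1 : colon I I 1.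
Proof. by move=> x; rewrite mul1r. Qed.

Lemma mult_ringM a b : colon I I a -> colon I I b -> colon I I (a * b).
Proof. by move=> aI bI x Ix; rewrite -mulrA; apply/aI/bI. Qed.

Definition mult_subring : subring K :=
  Subring mult_ring1 (colon_zmod I I).2 mult_ringM.

Lemma mult_ringS : subring_set S `<=` mult_subring.
Proof. by move=> a Sa x; apply: submodM. Qed.

Definition mult_ring : overring S := Overring mult_ringS.

End MultiplicatorRing.

Definition overring_type K (S : subring K) (T : overring S) : Type :=
  subring_type T.

Section OverringType.
Variables (K : comNzRingType) (S : subring K) (T : overring S).
HB.instance Definition _ := GRing.ComNzRing.on (overring_type T).

Lemma overring_inclP (a : subring_type S) : \val a \in (T : set K).
Proof. by apply/mem_set/overringS/set_mem; exact: (valP a). Qed.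

Definition overring_incl a : overring_type T :=
  exist (fun y => y \in (T : set K)) _ (overring_inclP a).

Lemma overring_inclE a : \val (overring_incl a : subring_type T) = \val a.
Proof. by []. Qed.

Definition overring_scale a (x : overring_type T) : overring_type T :=
  overring_incl a * x.

Lemma overring_inclD : {morph overring_incl : a b / a + b}.
Proof.
by move=> a b; apply: val_inj; rewrite rmorphD !overring_inclE rmorphD.
Qed.

Lemma overring_inclM : {morph overring_incl : a b / a * b}.
Proof.
by move=> a b; apply: val_inj; rewrite rmorphM !overring_inclE rmorphM.
Qed.

Lemma overring_incl1 : overring_incl 1 = 1.
Proof. by apply: val_inj; rewrite overring_inclE !rmorph1. Qed.

Lemma overring_scaleA a b x :
  overring_scale a (overring_scale b x) = overring_scale (a * b) x.
Proof. by rewrite /overring_scale overring_inclM mulrA. Qed.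

Lemma overring_scale1 : left_id 1 overring_scale.
Proof. by move=> x; rewrite /overring_scale overring_incl1 mul1r. Qed.

Lemma overring_scaleDr : right_distributive overring_scale +%R.
Proof. by move=> a x y; apply: mulrDr. Qed.

Lemma overring_scaleDl x : {morph overring_scale^~ x : a b / a + b}.
Proof. by move=> a b; rewrite /overring_scale overring_inclD mulrDl. Qed.

HB.instance Definition _ := GRing.Zmodule_isLmodule.Build
  (subring_type S) (overring_type T)
  overring_scaleA overring_scale1 overring_scaleDr overring_scaleDl.

Lemma overring_scaleAl (a : subring_type S) (x y : overring_type T) :
  a *: (x * y) = (a *: x) * y.
Proof. exact: mulrA. Qed.

HB.instance Definition _ := GRing.Lmodule_isLalgebra.Build
  (subring_type S) (overring_type T) overring_scaleAl.
HB.instance Definition _ := GRing.Lalgebra_isComAlgebra.Build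
  (subring_type S) (overring_type T).

End OverringType.

Record maxideal (K : comNzRingType) (S : subring K) := Maxideal {
  maxideal_mod :> submod S;
  maxidealS : submod_set maxideal_mod `<=` S;
  maxideal_proper : ~ submod_set maxideal_mod 1;
  maxideal_max : forall I : submod S, maxideal_mod `<=` I -> I `<=` S ->
    ~ submod_set I 1 -> I `<=` maxideal_mod
}.

Section Completion.
Variables (K : comNzRingType) (S : subring K) (q : maxideal S).

Let qn n : submod S := pow_mod q n.

Lemma maxideal_zmod : zmod_set q.
Proof. exact: submod_zmod. Qed.

Lemma pow_modS n : qn n `<=` S.
Proof.
elim: n => [//|n IH] _ [u uq ->].
suff : forall v, (forall y, y \in v -> submod_set q y.1 /\ submod_set (qn n) y.2) ->
    subring_set S (\sum_(y <- v) y.1 * y.2) by move=> sumP; apply: sumP uq.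
elim=> [|y v IHv] vq; first by rewrite big_nil; have [] := subring_zmod S.
rewrite big_cons; apply: (zmod_setD (subring_zmod S)); last first.
  by apply: IHv => z zv; apply: vq; rewrite inE zv orbT.
have [qy qy'] := vq y (mem_head _ _).
by apply: subringM; [exact: (@maxidealS _ _ q) qy | exact: IH _ qy'].
Qed.

Lemma pow_mod_sub n : qn n.+1 `<=` qn n.
Proof.
move=> _ [u uq ->].
elim: u uq => [|y u IH] uq; first by rewrite big_nil; have [] := submod_zmod (qn n).
rewrite big_cons; apply: (zmod_setD (submod_zmod _)); last first.
  by apply: IH => z zu; apply: uq; rewrite inE zu orbT.
have [qy qy'] := uq y (mem_head _ _).
by apply: submodM => //; apply: (@maxidealS _ _ q).
Qed.

Let qnP n : zmod_set (qn n) := submod_zmod (qn n).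
Let qn0 n : submod_set (qn n) 0 := (qnP n).1.

Lemma pow_mod_mulE n x y : subring_set S x -> subring_set S y ->
  coset_mul (qn n) (coset (qn n) x) (coset (qn n) y) = coset (qn n) (x * y).
Proof.
move=> Sx Sy; apply: coset_mulE => // [z qz|z qz|z t qz qt].
- exact: submodM.
- by rewrite mulrC; apply: submodM.
- by apply: submodM => //; apply: pow_modS qz.
Qed.

(* The inverse limit of the rings S / q^n: the projection to S / q^n of a     *)
(* coset of q^(n+1) is the coset of q^n which contains it.                    *)
Definition completion_set : set (nat -> set K) :=
  [set c | forall n, quot S (qn n) (c n) /\ c n.+1 `<=` c n].

Definition completion : Type := set_type completion_set.
HB.instance Definition _ := Choice.on completion.

Definition cpl_val (c : completion) : nat -> set K := \val c.

Lemma cpl_ext (c d : completion) :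
  (forall n, cpl_val c n = cpl_val d n) -> c = d.
Proof. by move=> ecd; apply/val_inj/funext. Qed.

Lemma cpl_rep (c : completion) :
  exists x : nat -> K, [/\ forall n, subring_set S (x n),
    forall n, submod_set (qn n) (x n.+1 - x n) & forall n, cpl_val c n = coset (qn n) (x n)].
Proof.
have cP n : exists y, subring_set S y /\ coset (qn n) y = cpl_val c n.
  by have [[y Sy ey] _] := set_mem (valP c) n; exists y.
have [x xP] := choice cP; exists x; split=> n; have [Sx ex] := xP n => //.
have [Sx' ex'] := xP n.+1; have [_ sub] := set_mem (valP c) n.
apply/cosetE; rewrite ex; apply: sub.
by rewrite -[X in X _]ex'; apply: coset_refl.
Qed.

Lemma cpl_setP (x : nat -> K) : (forall n, subring_set S (x n)) ->
  (forall n, submod_set (qn n) (x n.+1 - x n)) ->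
  completion_set (fun n => coset (qn n) (x n)).
Proof.
move=> Sx qx n; split; first by exists (x n).
move=> z /cosetE qz; apply/cosetE; rewrite -(subrKA (x n.+1)).
by apply: zmod_setD => //; apply: pow_mod_sub.
Qed.

Definition cpl_of (x : nat -> K) (Sx : forall n, subring_set S (x n))
  (qx : forall n, submod_set (qn n) (x n.+1 - x n)) : completion :=
  exist (fun c => c \in completion_set) _ (mem_set (cpl_setP Sx qx)).

Lemma cpl_addP (c d : completion) :
  completion_set (fun n => coset_add (cpl_val c n) (cpl_val d n)).
Proof.
have [x [Sx qx ex]] := cpl_rep c; have [y [Sy qy ey]] := cpl_rep d.
rewrite (_ : (fun n => _) = fun n => coset (qn n) (x n + y n)); last first.
  by apply/funext => n; rewrite ex ey coset_addE.
apply: cpl_setP => n; first exact: (zmod_setD (subring_zmod S)).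
by rewrite opprD addrACA; apply: zmod_setD.
Qed.

Lemma cpl_oppP (c : completion) :
  completion_set (fun n => [set - x | x in cpl_val c n]).
Proof.
have [x [Sx qx ex]] := cpl_rep c.
rewrite (_ : (fun n => _) = fun n => coset (qn n) (- x n)); last first.
  apply/funext => n; rewrite ex; apply/seteqP; split=> z.
    move=> [_ [y qy <-] <-]; exists (- y); last by rewrite opprD.
    exact: zmod_setN.
  move=> /cosetE qz; exists (- z); last by rewrite opprK.
  by apply/cosetE; rewrite -opprD -[x n]opprK; apply: zmod_setN.
apply: cpl_setP => n; first exact: (zmod_setN (subring_zmod S)).
by rewrite -opprD; apply: zmod_setN.
Qed.

Lemma cpl_mulP (c d : completion) :
  completion_set (fun n => coset_mul (qn n) (cpl_val c n) (cpl_val d n)).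
Proof.
have [x [Sx qx ex]] := cpl_rep c; have [y [Sy qy ey]] := cpl_rep d.
rewrite (_ : (fun n => _) = fun n => coset (qn n) (x n * y n)); last first.
  by apply/funext => n; rewrite ex ey pow_mod_mulE.
apply: cpl_setP => n; first exact: subringM.
rewrite -(subrKA (x n * y n.+1)) -mulrBl -mulrBr.
by apply: zmod_setD => //; [rewrite mulrC|]; apply: submodM.
Qed.

Lemma cpl_constP (a : K) : subring_set S a ->
  completion_set (fun n => coset (qn n) a).
Proof. by move=> Sa; apply: cpl_setP => n //; rewrite subrr. Qed.

Definition cpl_add c d : completion :=
  exist (fun e => e \in completion_set) _ (mem_set (cpl_addP c d)).
Definition cpl_opp c : completion :=
  exist (fun e => e \in completion_set) _ (mem_set (cpl_oppP c)).
Definition cpl_mul c d : completion :=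
  exist (fun e => e \in completion_set) _ (mem_set (cpl_mulP c d)).

Definition cpl_const (a : subring_type S) : completion :=
  exist (fun e => e \in completion_set) _
    (mem_set (cpl_constP (set_mem (valP a)))).

Definition cpl_scale (a : subring_type S) (c : completion) : completion :=
  cpl_mul (cpl_const a) c.

Lemma cpl_constE a n : cpl_val (cpl_const a) n = coset (qn n) (\val a).
Proof. by []. Qed.

Lemma cpl_addE c d n :
  cpl_val (cpl_add c d) n = coset_add (cpl_val c n) (cpl_val d n).
Proof. by []. Qed.

Lemma cpl_mulE c d n :
  cpl_val (cpl_mul c d) n = coset_mul (qn n) (cpl_val c n) (cpl_val d n).
Proof. by []. Qed.

Lemma cpl_addA : associative cpl_add.
Proof.
move=> c d e; have [x [Sx qx ex]] := cpl_rep c; have [y [Sy qy ey]] := cpl_rep d.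
have [z [Sz qz ez]] := cpl_rep e; apply: cpl_ext => n.
by rewrite !cpl_addE ex ey ez !coset_addE // addrA.
Qed.

Lemma cpl_addC : commutative cpl_add.
Proof.
move=> c d; have [x [Sx qx ex]] := cpl_rep c; have [y [Sy qy ey]] := cpl_rep d.
by apply: cpl_ext => n; rewrite !cpl_addE ex ey !coset_addE // addrC.
Qed.

Lemma cpl_add0 : left_id (cpl_const 0) cpl_add.
Proof.
move=> c; have [x [Sx qx ex]] := cpl_rep c; apply: cpl_ext => n.
by rewrite cpl_addE cpl_constE ex coset_addE // raddf0 add0r.
Qed.

Lemma cpl_addN : left_inverse (cpl_const 0) cpl_opp cpl_add.
Proof.
move=> c; have [x [Sx qx ex]] := cpl_rep c; apply: cpl_ext => n.
rewrite cpl_addE cpl_constE raddf0.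
have -> : cpl_val (cpl_opp c) n = coset (qn n) (- x n).
  rewrite -[LHS]/[set - y | y in cpl_val c n] ex; apply/seteqP; split=> z.
    move=> [_ [y qy <-] <-]; exists (- y); last by rewrite opprD.
    exact: zmod_setN.
  move=> /cosetE qz; exists (- z); last by rewrite opprK.
  by apply/cosetE; rewrite -opprD -[x n]opprK; apply: zmod_setN.
by rewrite ex coset_addE // addNr.
Qed.

HB.instance Definition _ :=
  GRing.isZmodule.Build completion cpl_addA cpl_addC cpl_add0 cpl_addN.

Lemma cpl_mulA : associative cpl_mul.
Proof.
move=> c d e; have [x [Sx qx ex]] := cpl_rep c; have [y [Sy qy ey]] := cpl_rep d.
have [z [Sz qz ez]] := cpl_rep e; apply: cpl_ext => n.
rewrite !cpl_mulE ex ey ez !pow_mod_mulE ?mulrA //; exact: subringM.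
Qed.

Lemma cpl_mulC : commutative cpl_mul.
Proof.
move=> c d; have [x [Sx qx ex]] := cpl_rep c; have [y [Sy qy ey]] := cpl_rep d.
by apply: cpl_ext => n; rewrite !cpl_mulE ex ey !pow_mod_mulE // mulrC.
Qed.

Lemma cpl_mul1 : left_id (cpl_const 1) cpl_mul.
Proof.
move=> c; have [x [Sx qx ex]] := cpl_rep c; apply: cpl_ext => n.
rewrite cpl_mulE cpl_constE ex pow_mod_mulE ?rmorph1 ?mul1r //.
exact: subring1.
Qed.

Lemma cpl_mulDl : left_distributive cpl_mul +%R.
Proof.
move=> c d e; have [x [Sx qx ex]] := cpl_rep c; have [y [Sy qy ey]] := cpl_rep d.
have [z [Sz qz ez]] := cpl_rep e; apply: cpl_ext => n.
rewrite cpl_addE !cpl_mulE cpl_addE ex ey ez !coset_addE // !pow_mod_mulE //.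
  by rewrite coset_addE // mulrDl.
exact: (zmod_setD (subring_zmod S)).
Qed.

Lemma cpl_oner_neq0 : cpl_const 1 != 0.
Proof.
apply/eqP => /(congr1 (fun c => cpl_val c 1%N)).
rewrite !cpl_constE rmorph1 raddf0 => /(coset_eq (qn0 1)); rewrite subr0.
move=> [u uq u1]; apply: (@maxideal_proper _ _ q); rewrite u1.
suff : forall v, (forall y, y \in v -> submod_set q y.1 /\ subring_set S y.2) ->
    submod_set q (\sum_(y <- v) y.1 * y.2) by move=> sumP; apply: sumP uq.
elim=> [|y v IH] vq; first by rewrite big_nil; have [] := maxideal_zmod.
rewrite big_cons; apply: (zmod_setD maxideal_zmod); last first.
  by apply: IH => z zv; apply: vq; rewrite inE zv orbT.
have [qy Sy] := vq y (mem_head _ _).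
by rewrite mulrC; apply: submodM.
Qed.

HB.instance Definition _ := GRing.Zmodule_isComNzRing.Build completion
  cpl_mulA cpl_mulC cpl_mul1 cpl_mulDl cpl_oner_neq0.

Lemma cpl_constM : {morph cpl_const : a b / a * b}.
Proof.
move=> a b; apply: cpl_ext => n; rewrite cpl_mulE !cpl_constE pow_mod_mulE //.
- exact: set_mem (valP a).
- exact: set_mem (valP b).
Qed.

Lemma cpl_constD : {morph cpl_const : a b / a + b}.
Proof.
by move=> a b; apply: cpl_ext => n; rewrite cpl_addE !cpl_constE coset_addE.
Qed.

Lemma cpl_scaleA a b c : cpl_scale a (cpl_scale b c) = cpl_scale (a * b) c.
Proof. by rewrite /cpl_scale cpl_constM; exact: cpl_mulA. Qed.

Lemma cpl_scale1 : left_id 1 cpl_scale.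
Proof. exact: mul1r. Qed.

Lemma cpl_scaleDr : right_distributive cpl_scale +%R.
Proof. by move=> a x y; apply: mulrDr. Qed.

Lemma cpl_scaleDl c : {morph cpl_scale^~ c : a b / a + b}.
Proof. by move=> a b; rewrite /cpl_scale cpl_constD; apply: mulrDl. Qed.

HB.instance Definition _ := GRing.Zmodule_isLmodule.Build
  (subring_type S) completion cpl_scaleA cpl_scale1 cpl_scaleDr cpl_scaleDl.

Lemma cpl_scaleAl (a : subring_type S) (c d : completion) :
  a *: (c * d) = (a *: c) * d.
Proof. exact: mulrA. Qed.

HB.instance Definition _ :=
  GRing.Lmodule_isLalgebra.Build (subring_type S) completion cpl_scaleAl.
HB.instance Definition _ :=
  GRing.Lalgebra_isComAlgebra.Build (subring_type S) completion.

End Completion.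

Section Dedekind.
Variable Z : idomainType.
Implicit Types I J : set Z.

Definition is_ideal I := zmod_set I /\ forall a x, I x -> I (a * x).

Definition fg_ideal I :=
  exists s : seq Z, I = [set x | exists c : 'I_(size s) -> Z,
                                   x = \sum_(i < size s) c i * s`_i].

Definition prime_ideal I :=
  [/\ is_ideal I, ~ I 1 & forall a b, I (a * b) -> I a \/ I b].

Definition max_ideal I :=
  [/\ is_ideal I, ~ I 1
    & forall J, is_ideal J -> I `<=` J -> ~ J 1 -> J = I].

Definition dedekind_domain :=
  [/\ exists2 z : Z, z != 0 & z \isn't a GRing.unit,
      forall I, is_ideal I -> fg_ideal I,
      forall x : {fraction Z}, integralOver (@tofrac Z) x ->
        exists z : Z, x = tofrac z
    & forall I, prime_ideal I -> I <> [set 0] -> max_ideal I].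

End Dedekind.

(* The maps phi i are the components of an isomorphism from K to the product  *)
(* of the fields L i.                                                         *)
Definition etale_algebra (Q : fieldType) (K : comAlgType Q) :=
  exists (m : nat) (L : 'I_m -> fieldExtType Q)
         (phi : forall i, {lrmorphism K -> L i}),
    (forall i, separable 1%VS {: L i}) /\
    (forall y : forall i, L i, exists! x : K, forall i, phi i x = y i).

Section Lattices.
Variables (Z : idomainType) (K : comAlgType {fraction Z}).
Implicit Types A : set K.

Definition fg_Zmodule A :=
  exists s : seq K, A = [set x | exists c : 'I_(size s) -> Z,
                                   x = \sum_(i < size s) tofrac (c i) *: s`_i].

Definition is_basis m (b : 'I_m -> K) :=
  forall x : K, exists! c : 'rV[{fraction Z}]_m, x = \sum_i c 0 i *: b i.

Definition lattice A :=
  fg_Zmodule A /\ exists m (b : 'I_m -> K), is_basis b /\ forall i, A (b i).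

Section Ideals.
Variable S : subring K.
Implicit Types I J : submod S.

(* An order is a subring of K which is a lattice; a fractional S-ideal is an  *)
(* S-submodule of K which is a lattice.                                       *)
Definition invertible I := prod_mod I (colon_mod (ring_mod S) I) = ring_mod S.

Definition local_mod I (q : maxideal S) := scalar_ext (submod_type I) (completion q).

Definition weakly_equivalent I J :=
  forall q : maxideal S, exists f : {linear local_mod I q -> local_mod J q},
    bijective f.

Definition weak_class I : set (submod S) :=
  [set J : submod S | lattice J /\ weakly_equivalent I J].

Definition Wbar : set (set (submod S)) :=
  [set weak_class I | I in [set I : submod S |
                            lattice I /\ colon I I = S :> set K]].

End Ideals.

Section LocalUnits.
Variables (R : subring K) (T : overring R) (q : maxideal R).

Definition local_ring := tensor_alg (overring_type T) (completion q).

Definition is_unit (x : local_ring) := exists y, x * y = 1.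

(* The image of R_q^* under r |-> 1 (x) r. *)
Definition base_units : set local_ring :=
  [set tens 1 u | u in [set u : completion q | exists v, u * v = 1]].

Definition unit_coset (x : local_ring) : set local_ring :=
  [set x * u | u in base_units].

Definition unit_cosets : set (set local_ring) :=
  [set unit_coset x | x in is_unit].

(* L_q, embedded in T_q, for an R-submodule L of T. *)
Definition local_sub (L : set K) : set local_ring :=
  [set x | exists2 u : seq (overring_type T * completion q),
     (forall y, y \in u -> L (\val (y.1 : subring_type T)))
     & x = \sum_(y <- u) tens y.1 y.2].

Definition local_principal (x : local_ring) : set local_ring :=
  [set x * tens 1 r | r in [set: completion q]].

End LocalUnits.

Section UnitGroup.
Variables (R : subring K) (p : maxideal R).

Definition Tp : overring R := mult_ring p.

Definition prod_unit_cosets : set (forall q : maxideal R, set (local_ring Tp q)) :=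
  [set c | forall q, unit_cosets (c q)].

Definition Ugroup : set (submod R) :=
  [set L : submod R | [/\ lattice L, invertible L & prod_set L Tp = Tp :> set K]].

(* L |-> (x_q R_q^* )_q, where L_q = x_q R_q; the class x_q R_q^* does not     *)
(* depend on the choice of the generator x_q.                                 *)
Definition Uident (L : submod R) (q : maxideal R) : set (local_ring Tp q) :=
  [set y | exists x, [/\ is_unit x, local_sub L = local_principal x
                       & unit_coset x y]].

Definition kfield : set (set K) := quot R p.
Definition Aring : set (set K) := quot Tp p.

Variable J : submod Tp.

Let pJ : set K := prod_set p J.

Definition between : set (submod R) :=
  [set I : submod R | [/\ lattice I, pJ `<=` I & I `<=` J]].

Definition Jquot : set (set K) := quot J pJ.

Definition subspaces : set (set (set K)) :=
  [set V | [/\ V `<=` Jquot, V (coset pJ 0),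
     forall c d, V c -> V d -> V (coset_add c d)
   & forall a c, kfield a -> V c -> V (coset_mul pJ a c)]].

Definition Psi (I : set K) : set (set K) := quot I pJ.
Definition Psi_inv (V : set (set K)) : set K := [set x | submod_set J x /\ V (coset pJ x)].

Definition spanA (V : set (set K)) : set (set K) :=
  [set c | exists2 u : seq (set K * set K),
     (forall y, y \in u -> V y.1 /\ Aring y.2)
     & c = \big[@coset_add K/coset pJ 0]_(y <- u) coset_mul pJ y.2 y.1].

Definition Vset : set (set (set K)) :=
  [set V | [/\ subspaces V,
     [set a | Aring a /\ forall c, V c -> V (coset_mul pJ a c)] = kfield
   & spanA V = Jquot]].

Definition Uact (L : submod R) (V : set (set K)) : set (set K) :=
  Psi (prod_set L (Psi_inv V)).

Definition Uorbit (V : set (set K)) : set (set (set K)) :=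
  [set Uact L V | L in Ugroup].

End UnitGroup.

(* The disjoint union of the sets V_i / U, as a set of pairs (i, orbit).      *)
Definition Vorbits (R : subring K) (p : maxideal R) n (J : 'I_n -> submod (Tp p))
  : set ('I_n * set (set (set K))) :=
  [set o | exists2 V, Vset (J o.1) V & o.2 = Uorbit (J o.1) V].
End Lattices.

Arguments Wbar {Z K} S.
Arguments Tp {Z K R} p.
Arguments Ugroup {Z K R} p.
Arguments prod_unit_cosets {Z K R} p.
Arguments Uident {Z K R} p L q.

(* Main.v *)
(* The ideal p of R is also an ideal of T, and L |-> L T maps the invertible  *)
(* R-ideals onto the invertible T-ideals M: as T / p is semilocal, M is       *)
(* x T + p M for some x, and L = x R + p M is a preimage. The kernel U        *)
(* consists of the L = x R + p with x a unit modulo p, so that                *)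
(* U = (T / p)^* / (R / p)^*, which is also the product of the local unit     *)
(* quotients: it is trivial away from p.                                      *)
(*   If (I : I) = S, then J is weakly equivalent to I exactly when J = L I    *)
(* for an invertible L. Indeed an isomorphism of the completions at q can be  *)
(* approximated by multiplication with an element of (J : I), and so          *)
(* (I : J)(J : I) lies in no maximal ideal of S. Finally (I : I) = R implies  *)
(* (I T : I T) = T, hence I T = M^-1 J_i for a single i and an invertible     *)
(* T-ideal M; multiplying I by an R-ideal L with L T = M makes I T equal to   *)
(* J_i, and then I contains p I = p J_i. The choice of L is unique up to U.   *)
Require Import Defs.
From HB Require Import structures.
From mathcomp Require Import all_boot all_order all_algebra all_field.
From mathcomp Require Import mathcomp_extra boolp classical_sets functions.
From mathcomp Require Import generic_quotient ring.
Set Implicit Arguments.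
Unset Strict Implicit.
Unset Printing Implicit Defensive.
Import GRing.Theory.
Local Open Scope classical_set_scope.
Local Open Scope ring_scope.
Local Open Scope quotient_scope.

(** Put T = (p : p), so that p is an ideal of both R and T. Weak equivalence is first made global:
    if (I : I) = S, then J is weakly equivalent to I exactly when J = L I for an invertible L. Such
    an L is locally generated by one element, which gives one direction ([weakly_equivalent_mul]).
    For the other, local isomorphisms are approximated by multiplications by elements of (J : I) and
    (I : J), and Nakayama's lemma forces (I : J)(J : I) = S ([weak_approximation],
    [weakly_equivalent_invertible]).

    The classes of R are thus the orbits of the ideals I with (I : I) = R under the invertible
    R-ideals. For such I the extension I T has multiplicator ring T ([colon_ext]), and every
    invertible T-ideal has the form L T ([invertible_lift]). Hence each orbit contains some I with I
    T = J_i, for exactly one i ([adapted_exists], [adapted_equivalent]), and two such I differ by an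
    L with L T = T, an element of U ([adapted_orbit]). These I lie between p J_i and J_i, and
    [Vset_Psi] identifies their images under Psi_i with V_i. The action is free because L I = I puts
    L and its inverse inside (I : I) = R ([Ugroup_free]).

    The members of U are the x R + p with x a unit modulo p ([Ugroup_gen]). At q other than p, T_q
    comes from R_q and the local component is trivial; at p it is the class of x. All classes at p
    occur, since a unit of T_p is an element of T times a unit of R_p ([local_unit_gen]).

    The arithmetic input is that orders are noetherian ([order_max]) and their primes containing a
    nonzero integer are maximal ([prime_inv]), so that an ideal containing a nonzero integer
    contains a product of maximal ideals ([contains_maxideal_prod]). *)

Local Notation "A ** B" := (prod_set A B) (at level 40, left associativity).

(** * Products of submodules *)

Section ProdSet.
Variable K : comNzRingType.
Implicit Types A B C N W : set K.

Lemma mem_prod_set A B a b : A a -> B b -> (A ** B) (a * b).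
Proof.
by move=> Aa Bb; exists [:: (a, b)]; rewrite ?big_seq1 // => y /[!inE] /eqP ->.
Qed.

Lemma prod_set0 A B : (A ** B) 0.
Proof. by exists [::]; rewrite ?big_nil. Qed.

Lemma prod_setD A B x y : (A ** B) x -> (A ** B) y -> (A ** B) (x + y).
Proof.
move=> [u uAB ->] [v vAB ->]; exists (u ++ v); last by rewrite big_cat.
by move=> z; rewrite mem_cat => /orP[/uAB|/vAB].
Qed.

Lemma prod_set_sub A B W : W 0 -> (forall x y, W x -> W y -> W (x + y)) ->
  (forall a b, A a -> B b -> W (a * b)) -> A ** B `<=` W.
Proof.
move=> W0 WD WM _ [u uAB ->].
elim: u uAB => [|y u IH] uAB; first by rewrite big_nil.
rewrite big_cons; apply: WD; last by apply: IH => z zu; apply: uAB; rewrite inE zu orbT.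
by have [? ?] := uAB y (mem_head _ _); apply: WM.
Qed.

Lemma prod_set_subZ A B W : zmod_set W ->
  (forall a b, A a -> B b -> W (a * b)) -> A ** B `<=` W.
Proof. by move=> zW; apply: prod_set_sub => [|x y]; [case: zW|apply: zmod_setD]. Qed.

Lemma prod_setS A A' B B' : A `<=` A' -> B `<=` B' -> A ** B `<=` A' ** B'.
Proof.
move=> sA sB; apply: prod_set_sub => [|x y|a b Aa Bb]; first exact: prod_set0.
  exact: prod_setD.
by apply: mem_prod_set; [apply: sA|apply: sB].
Qed.

Lemma prod_setC A B : A ** B = B ** A.
Proof.
suff s A' B' : A' ** B' `<=` B' ** A' by apply/seteqP; split; apply: s.
apply: prod_set_sub => [|x y|a b Aa Bb]; first exact: prod_set0.
  exact: prod_setD.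
by rewrite mulrC; apply: mem_prod_set.
Qed.

Lemma prod_setA A B C : A ** (B ** C) = (A ** B) ** C.
Proof.
apply/seteqP; split.
  apply: prod_set_sub => [|x y|a b Aa]; [exact: prod_set0|exact: prod_setD|].
  apply: (prod_set_sub (W := fun z => (A ** B ** C) (a * z))).
  - by rewrite mulr0; apply: prod_set0.
  - by move=> x y; rewrite mulrDr; apply: prod_setD.
  - by move=> x y Bx Cy; rewrite mulrA; do !apply: mem_prod_set.
apply: prod_set_sub => [|x y|a b + Cb]; [exact: prod_set0|exact: prod_setD|].
move: a; apply: (prod_set_sub (W := fun z => (A ** (B ** C)) (z * b))).
- by rewrite mul0r; apply: prod_set0.
- by move=> x y; rewrite mulrDl; apply: prod_setD.
- by move=> x y Ax By; rewrite -mulrA; do !apply: mem_prod_set.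
Qed.

Lemma prod_setAC A B C : (A ** B) ** C = (A ** C) ** B.
Proof. by rewrite -!prod_setA [B ** C]prod_setC. Qed.

(** Unbundled, so that one subset of K can serve as a module over Z, R and T alike; a [submod] is
    tied to a single ring. *)
Definition module_over B N := zmod_set N /\ forall b x, B b -> N x -> N (b * x).

Lemma prod_set_idl B N : B 1 -> module_over B N -> B ** N = N.
Proof.
move=> B1 [zN BN]; apply/seteqP; split; first exact: prod_set_subZ.
by move=> x Nx; rewrite -[x]mul1r; apply: mem_prod_set.
Qed.

Lemma submod_module (S : subring K) (I : submod S) : module_over S I.
Proof. by split; [apply: submod_zmod|move=> b x; apply: submodM]. Qed.

Lemma prod_ring_submod (S : subring K) (I : submod S) : S ** I = I.
Proof. by apply: prod_set_idl; [apply: subring1|apply: submod_module]. Qed.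

Lemma prod_submod_ring (S : subring K) (I : submod S) : I ** S = I.
Proof. by rewrite prod_setC prod_ring_submod. Qed.

Lemma prod_ringxx (S : subring K) : S ** S = S.
Proof. exact: (prod_ring_submod (ring_mod S)). Qed.

Lemma colonP A B C : zmod_set A -> B `<=` colon A C <-> B ** C `<=` A.
Proof.
move=> zA; split=> [BA|BCA b Bb c Cc].
  by apply: prod_set_subZ => // a b /BA aA /aA.
exact/BCA/mem_prod_set.
Qed.

Lemma prod_colon_sub A B : zmod_set A -> colon A B ** B `<=` A.
Proof. by move=> zA; apply/colonP. Qed.

Lemma invertible_of_prod (S : subring K) (L L' : submod S) :
  L ** L' = S -> prod_mod L (colon_mod (ring_mod S) L) = ring_mod S.
Proof.
move=> LL'; apply: submod_inj => /=; apply/seteqP; split.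
  by rewrite prod_setC; apply: prod_colon_sub; apply: subring_zmod.
rewrite -{1}LL'; apply: prod_setS => // x L'x y Ly.
by rewrite -[X in X _]LL' mulrC; apply: mem_prod_set.
Qed.

(** Multiplying a module can only enlarge its multiplicator ring; the reverse inclusion is the same
    fact for [L'] acting on [L ** I]. *)
Lemma colon_mul_invertible (S : subring K) (L L' I : submod S) :
  L ** L' = S -> colon (L ** I) (L ** I) = colon I I.
Proof.
suff s (M M' N : submod S) : M ** M' = S ->
    colon N N `<=` colon (M ** N) (M ** N).
  move=> LL'; apply/seteqP; split; last exact: s LL'.
  have L'L : L' ** L = S by rewrite prod_setC.
  have := s _ _ (prod_mod L I) L'L.
  by rewrite /= prod_setA L'L prod_ring_submod.
move=> MM' a aN; apply: (prod_set_sub (W := fun x => (M ** N) (a * x))).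
- by rewrite mulr0; apply: prod_set0.
- by move=> x y; rewrite mulrDr; apply: prod_setD.
- by move=> x y Mx Ny; rewrite mulrCA; apply: mem_prod_set => //; apply: aN.
Qed.

Lemma prod_mod1 (S : subring K) (I : submod S) : prod_mod (ring_mod S) I = I.
Proof. exact/submod_inj/prod_ring_submod. Qed.

End ProdSet.

(** * Finitely generated modules and Nakayama's lemma *)

Section Span.
Variables (K : comNzRingType) (B : subring K).
Implicit Types (l : seq K) (N W q : set K).

(** The recursion peels off one generator with its coefficient, the shape needed by the inductions
    on generators in [nakayama] and [span_noetherian]. *)
Fixpoint span l : set K :=
  if l is a :: l' then [set x | exists2 b, subring_set B b & span l' (x - b * a)]
  else [set 0].

Let B0 : subring_set B 0 := (subring_zmod B).1.

Lemma span_module l : module_over B (span l).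
Proof.
elim: l => [|a l [[IH0 IHB] IHM]] /=.
  by split=> [|b x _ ->]; [split=> // x y -> ->; rewrite /= subr0|rewrite /= mulr0].
split; first split.
- by exists 0; rewrite // mul0r subr0.
- move=> x y [b Bb xb] [c Bc yc]; exists (b - c); first exact: subringB.
  have -> : x - y - (b - c) * a = (x - b * a) - (y - c * a) by ring.
  exact: IHB.
- move=> c x Bc [b Bb xb]; exists (c * b); first exact: subringM.
  by rewrite -mulrA -mulrBr; apply: IHM.
Qed.

Lemma span_zmod l : zmod_set (span l).
Proof. by case: (span_module l). Qed.

Lemma span_cons_sub a l : span l `<=` span (a :: l).
Proof. by move=> x lx; exists 0; rewrite // mul0r subr0. Qed.

Lemma mem_span l a : a \in l -> span l a.
Proof.
elim: l => // b l IH /[!inE] /orP[/eqP ->|/IH]; last exact: span_cons_sub.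
exists 1; first exact: subring1.
by rewrite mul1r subrr; case: (span_zmod l).
Qed.

Lemma span_sub l W : module_over B W -> (forall a, a \in l -> W a) ->
  span l `<=` W.
Proof.
move=> [zW WM]; elim: l => [|a l IH] lW x /=; first by move=> ->; case: zW.
move=> [b Bb xb]; rewrite -(subrK (b * a) x); apply: zmod_setD => //.
  by apply: IH xb => c cl; apply: lW; rewrite inE cl orbT.
by apply: WM => //; apply: lW; rewrite mem_head.
Qed.

(* Relative form of Nakayama's lemma, by induction on the generators of N     *)
(* modulo W: adjoin the first generator to W, then remove it again.           *)
Lemma nakayama q N : q `<=` B -> module_over B q -> module_over B N ->
  forall l W, module_over B W -> (forall a, a \in l -> N a) ->
  (forall x, N x -> exists2 y, span l y & W (x - y)) ->
  (forall x, N x -> exists2 y, (q ** N) y & W (x - y)) ->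
  exists2 s, q s & forall x, N x -> W ((1 - s) * x).
Proof.
move=> qB [zq qM] [zN NM]; elim=> [|g l IH] W [zW WM] lN NW NqW.
  exists 0; first by case: zq.
  by move=> x /NW[_ ->]; rewrite !subr0 mul1r.
have Ng : N g by apply: lN; rewrite mem_head.
pose W' : set K := [set x | exists2 b, subring_set B b & W (x - b * g)].
have mW' : module_over B W'.
  split; first split.
  - by exists 0; rewrite // mul0r subr0; case: zW.
  - move=> x y [b Bb xb] [c Bc yc]; exists (b - c); first exact: subringB.
    have -> : x - y - (b - c) * g = (x - b * g) - (y - c * g) by ring.
    exact: zW.2.
  - move=> c x Bc [b Bb xb]; exists (c * b); first exact: subringM.
    by rewrite -mulrA -mulrBr; apply: WM.
have WW' : W `<=` W' by move=> x Wx; exists 0; rewrite // mul0r subr0.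
have [||||s qs sN] := IH W' => //.
- by move=> a al; apply: lN; rewrite inE al orbT.
- move=> x /NW[y [b Bb lyb] Wxy]; exists (y - b * g) => //; exists b => //.
  by rewrite opprB addrA addrAC addrK.
- by move=> x /NqW[y qy Wy]; exists y => //; apply: WW'.
have [y qy Wy] := NqW g Ng.
(* Since (1 - s) N lies in W + B g and y lies in q N, the product (1 - s) y is congruent to an
   element of q g modulo W. *)
have [t qt Wt] : exists2 t, q t & W ((1 - s) * y - t * g).
  move: y qy {Wy}; apply: prod_set_sub.
  - by exists 0; [case: zq|rewrite mulr0 mul0r subr0; case: zW].
  - move=> x y [t qt Wt] [t' qt' Wt']; exists (t + t'); first exact: zmod_setD.
    have -> : (1 - s) * (x + y) - (t + t') * g =
      ((1 - s) * x - t * g) + ((1 - s) * y - t' * g) by ring.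
    exact: zmod_setD.
  - move=> a x qa Nx; have [b Bb Wb] := sN x Nx; exists (b * a); first exact: qM.
    have -> : (1 - s) * (a * x) - b * a * g = a * ((1 - s) * x - b * g) by ring.
    by apply: WM => //; apply: qB.
have B1s : subring_set B (1 - s) by apply: subringB; [apply: subring1|apply: qB].
have Wg : W ((1 - s - t) * g).
  have -> : (1 - s - t) * g = (1 - s) * (g - y) + ((1 - s) * y - t * g) by ring.
  by apply: zmod_setD => //; apply: WM.
(* Chosen so that 1 minus it is (1 - s - t)(1 - s): the factor 1 - s sends N into W + B g, and 1 - s
   - t sends g into W. *)
exists (s + s + t - s * s - t * s) => [|x /sN[b Bb Wb]].
  have qq a b : q a -> q b -> q (a * b) by move=> /qB Ba; apply: qM.
  by do !(apply: zq.2 || apply: zmod_setD => //) => //; apply: qq.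
have -> : (1 - (s + s + t - s * s - t * s)) * x =
  (1 - s - t) * ((1 - s) * x - b * g) + b * ((1 - s - t) * g) by ring.
apply: zmod_setD => //; apply: WM => //.
by apply: subringB => //; apply: qB.
Qed.

End Span.

(** * Maximal ideals of a subring *)

Section MaximalIdeals.
Variables (K : comNzRingType) (S : subring K).
Implicit Types (q m : maxideal S).

(** The sum of I and S a. By [Ugroup_gen] every member of U has this form with I = p. *)
Definition gen_add (I : submod S) (a : K) : set K :=
  [set x | exists2 s, subring_set S s & submod_set I (x - s * a)].

Lemma gen_add_zmod I a : zmod_set (gen_add I a).
Proof.
have [I0 IB] := submod_zmod I; have [S0 _] := subring_zmod S; split.
  by exists 0; rewrite // mul0r subr0.
move=> x y [b Bb xb] [c Bc yc]; exists (b - c); first exact: subringB.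
have -> : x - y - (b - c) * a = (x - b * a) - (y - c * a) by ring.
exact: IB.
Qed.

Lemma gen_addM I a s x : subring_set S s -> gen_add I a x -> gen_add I a (s * x).
Proof.
move=> Ss [b Bb xb]; exists (s * b); first exact: subringM.
by rewrite -mulrA -mulrBr; apply: submodM.
Qed.

Definition add_mod I a : submod S := Submod (gen_add_zmod I a) (@gen_addM I a).

Lemma add_mod_sub (I : submod S) a : I `<=` add_mod I a.
Proof.
by move=> x Ix; exists 0; rewrite ?mul0r ?subr0 //; case: (subring_zmod S).
Qed.

Lemma add_mod_gen (I : submod S) a : submod_set (add_mod I a) a.
Proof.
by exists 1; rewrite ?mul1r ?subrr; [apply: subring1|case: (submod_zmod I)].
Qed.

Lemma add_mod_subset (I : submod S) a (W : submod S) :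
  I `<=` W -> submod_set W a -> add_mod I a `<=` W.
Proof.
move=> IW Wa x [s Ss /IW Wx]; rewrite -(subrK (s * a) x).
by apply: (zmod_setD (submod_zmod W)) => //; apply: submodM.
Qed.

Lemma maxideal_inv q s : subring_set S s -> ~ submod_set q s ->
  exists2 t, subring_set S t & submod_set q (1 - s * t).
Proof.
move=> Ss nqs; have [[t St qt]|nI] := pselect (submod_set (add_mod q s) 1).
  by exists t; rewrite // mulrC.
case: nqs; apply: (maxideal_max _ _ nI); last exact: add_mod_gen.
  exact: add_mod_sub.
by apply: (@add_mod_subset q s (ring_mod S)) => //; apply: maxidealS.
Qed.

Lemma maxideal_prime q s t : subring_set S s -> subring_set S t ->
  submod_set q (s * t) -> submod_set q s \/ submod_set q t.
Proof.
move=> Ss St qst; have [|nqs] := pselect (submod_set q s); first by left.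
have [s' Ss' qs'] := maxideal_inv Ss nqs; right.
have -> : t = t * (1 - s * s') + s' * (s * t) by ring.
by apply: (zmod_setD (submod_zmod q)); apply: submodM.
Qed.

Lemma maxideal_prodn q s t : subring_set S s -> subring_set S t ->
  ~ submod_set q s -> ~ submod_set q t -> ~ submod_set q (s * t).
Proof. by move=> Ss St nqs nqt /maxideal_prime[]. Qed.

Lemma maxideal_eq m q : submod_set m `<=` q -> submod_set q `<=` m.
Proof. by move=> mq; apply: maxideal_max => //; [apply: maxidealS|apply: maxideal_proper]. Qed.

End MaximalIdeals.

(** * Lattices over a noetherian domain *)

Section Lattices.
Variables (Z : idomainType) (K : comAlgType {fraction Z}).
Implicit Types (A N : set K) (c d : Z).

Definition zin c : K := tofrac c *: 1.

Lemma zinE c x : tofrac c *: x = zin c * x.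
Proof. by rewrite -scalerAl mul1r. Qed.

Lemma zin0 : zin 0 = 0. Proof. by rewrite /zin rmorph0 scale0r. Qed.
Lemma zin1 : zin 1 = 1. Proof. by rewrite /zin rmorph1 scale1r. Qed.
Lemma zinB c d : zin (c - d) = zin c - zin d.
Proof. by rewrite /zin rmorphB scalerBl. Qed.
Lemma zinD : {morph zin : c d / c + d}.
Proof. by move=> c d; rewrite /zin rmorphD scalerDl. Qed.
Lemma zinM c d : zin (c * d) = zin c * zin d.
Proof. by rewrite -zinE /zin rmorphM scalerA. Qed.

Lemma zin_inv c : c != 0 -> exists w, w * zin c = 1.
Proof.
move=> c0; exists ((tofrac c)^-1 *: 1).
by rewrite -scalerAl mul1r scalerA mulVf ?scale1r // tofrac_eq0.
Qed.

Lemma zin_reg c x y : c != 0 -> zin c * x = zin c * y -> x = y.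
Proof.
by move=> /zin_inv[w wc] e; rewrite -[x]mul1r -[y]mul1r -wc -!mulrA e.
Qed.

Definition zrange : set K := [set zin c | c in [set: Z]].

Lemma zrange1 : zrange 1. Proof. by exists 1; rewrite // zin1. Qed.
Lemma zrangeB x y : zrange x -> zrange y -> zrange (x - y).
Proof. by move=> [c _ <-] [d _ <-]; exists (c - d); rewrite // zinB. Qed.
Lemma zrangeM x y : zrange x -> zrange y -> zrange (x * y).
Proof. by move=> [c _ <-] [d _ <-]; exists (c * d); rewrite // zinM. Qed.

Definition Zring : subring K := Subring zrange1 zrangeB zrangeM.

Lemma mem_zin c : subring_set Zring (zin c). Proof. by exists c. Qed.

Lemma spanZE l x : span Zring l x <->
  exists c : 'I_(size l) -> Z, x = \sum_(i < size l) tofrac (c i) *: l`_i.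
Proof.
elim: l x => [|a l IH] x /=.
  by split=> [->|[c ->]]; [exists (fun=> 0)|]; rewrite big_ord0.
split=> [[_ [b _ <-] /IH[c xc]]|[c ->]].
  exists (fun i => if unlift ord0 i is Some j then c j else b).
  rewrite big_ord_recl unlift_none /= zinE -[LHS](subrK (zin b * a)) xc addrC.
  by congr (_ + _); apply: eq_bigr => i _; rewrite liftK.
exists (zin (c ord0)); first exact: mem_zin.
apply/IH; exists (fun i => c (lift ord0 i)).
by rewrite big_ord_recl /= -zinE addrC addKr.
Qed.

Lemma fg_ZmoduleE A : fg_Zmodule A <-> exists l, A = span Zring l.
Proof.
split=> -[l ->]; exists l; apply/seteqP; split=> x /= /spanZE //.
Qed.

Definition noetherian_domain := forall I : set Z, is_ideal I -> fg_ideal I.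

(** The coefficients at [a] of the elements of N form an ideal of Z, which is finitely generated.
    Lifts of its generators, together with generators of the part of N inside [span l], generate
    N. *)
Lemma span_noetherian l N : noetherian_domain -> module_over Zring N ->
  N `<=` span Zring l -> exists l', N = span Zring l'.
Proof.
move=> noeZ; elim: l N => [|a l IH] N [zN NM] Nl.
  exists [::]; apply/seteqP; split=> // x ->; by case: zN.
have [zl lM] := span_module Zring l.
pose I : set Z := [set c | exists2 x, N x & span Zring l (x - zin c * a)].
have [|s Is] := noeZ I.
  split; first split.
  - by exists 0; rewrite ?zin0 ?mul0r ?subr0; [case: zN|case: zl].
  - move=> c d [x Nx lx] [y Ny ly]; exists (x - y); first exact: zN.2.
    rewrite zinB (_ : x - y - _ = (x - zin c * a) - (y - zin d * a)); last by ring.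
    exact: zl.2.
  - move=> b c [x Nx lx]; exists (zin b * x); first exact/NM/Nx/mem_zin.
    by rewrite zinM -mulrA -mulrBr; apply/lM/lx/mem_zin.
have /choice[f fP] : forall c, exists x,
    I c -> N x /\ span Zring l (x - zin c * a).
  move=> c; have [[x Nx lx]|nI] := pselect (I c); first by exists x.
  by exists 0.
have [||l' Nl'] := IH (N `&` span Zring l); last 1 first.
- have sI c : c \in s -> I c.
    move=> cs; rewrite Is; have cs' := cs; rewrite -index_mem in cs'.
    exists (fun i => (i == Ordinal cs')%:R).
    rewrite (bigD1 (Ordinal cs')) //= eqxx mul1r nth_index // big1 ?addr0 //.
    by move=> i /negbTE ->; rewrite mul0r.
  exists (map f s ++ l'); apply/seteqP; split=> [x Nx|]; last first.
    apply: span_sub => // b; rewrite mem_cat => /orP[/mapP[c /sI/fP[Nfc _] ->] //|bl'].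
    have: span Zring l' b by apply: mem_span.
    by rewrite -Nl' => -[].
  have [_ [c _ <-] lx] := Nl x Nx.
  have : I c by exists x.
  rewrite {1}Is => -[k ck].
  (* Like x, this combination of lifts has coefficient c at [a], so x - y falls into [span l]. *)
  pose y := \sum_(i < size s) zin (k i) * f s`_i.
  have [zs sM] := span_module Zring (map f s ++ l').
  have span_y : span Zring (map f s ++ l') y.
    rewrite /y; elim/big_ind: _ => [|u v su sv|i _]; first by case: zs.
      exact: zmod_setD.
    apply: sM; first exact: mem_zin.
    by apply: mem_span; rewrite mem_cat map_f ?mem_nth.
  have Ny : N y.
    rewrite /y; elim/big_ind: _ => [|u v su sv|i _]; first by case: zN.
      exact: zmod_setD.
    by apply: NM; [apply: mem_zin|case: (fP _ (sI _ (mem_nth 0 (ltn_ord i))))].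
  have ly : span Zring l (y - zin c * a).
    have -> : y - zin c * a = \sum_(i < size s) zin (k i) * (f s`_i - zin s`_i * a).
      rewrite ck (big_morph zin zinD zin0) mulr_suml -sumrB.
      by apply: eq_bigr => i _; rewrite zinM -mulrA -mulrBr.
    elim/big_ind: _ => [|u v su sv|i _]; first by case: zl.
      exact: zmod_setD.
    by apply: lM; [apply: mem_zin|case: (fP _ (sI _ (mem_nth 0 (ltn_ord i))))].
  rewrite -(subrK y x); apply: zmod_setD => //.
  have : (N `&` span Zring l) (x - y).
    split; first exact: zN.2.
    rewrite (_ : x - y = (x - zin c * a) - (y - zin c * a)); last by ring.
    exact: zl.2.
  rewrite Nl'; apply: span_sub; first exact: span_module.
  by move=> b bl'; apply: mem_span; rewrite mem_cat bl' orbT.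
- split; first split.
  + by split; [case: zN|case: zl].
  + by move=> x y [Nx lx] [Ny ly]; split; [apply: zN.2|apply: zl.2].
  + by move=> b x Bb [Nx lx]; split; [apply: NM|apply: lM].
- by move=> x [].
Qed.

Lemma tofrac_denom (q : {fraction Z}) :
  exists2 d, d != 0 & exists c, tofrac d * q = tofrac c.
Proof.
elim/quotW: q => r; exists \d_r; first exact: denom_ratioP.
exists \n_r; rewrite -[LHS]/(FracField.mul _ _) !piE.
apply/eqmodP; rewrite /= FracField.equivfE /FracField.mulf.
by rewrite !numden_Ratio ?oner_eq0 ?mul1r ?mulr1 ?denom_ratioP // mulrC.
Qed.

Lemma lattice_module A : lattice A -> module_over Zring A.
Proof. by move=> [/fg_ZmoduleE[l ->] _]; apply: span_module. Qed.

Lemma lattice_bound A x : lattice A -> exists2 d, d != 0 & A (zin d * x).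
Proof.
move=> lA; have [zA AM] := lattice_module lA; have [_ [m [b [bas bA]]]] := lA.
have [c [-> _]] := bas x; elim/big_ind: _ => [|u v [d d0 Ad] [e e0 Ae]|i _].
- by exists 1; rewrite ?oner_eq0 // mulr0; case: zA.
- exists (d * e); first exact: mulf_neq0.
  have -> : zin (d * e) * (u + v) = zin e * (zin d * u) + zin d * (zin e * v).
    by rewrite zinM; ring.
  by apply: zmod_setD => //; apply: AM => //; apply: mem_zin.
- have [d d0 [e de]] := tofrac_denom (c 0 i); exists d => //.
  by rewrite -zinE scalerA de zinE; apply: AM => //; apply: mem_zin.
Qed.

Lemma lattice_bound_all A N : lattice A -> lattice N ->
  exists2 d, d != 0 & forall x, N x -> A (zin d * x).
Proof.
move=> lA [/fg_ZmoduleE[l ->] _]; have [zA AM] := lattice_module lA.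
elim: l => [|a l [d d0 IH]] /=.
  by exists 1; rewrite ?oner_eq0 // => x ->; rewrite mulr0; case: zA.
have [e e0 Ae] := lattice_bound a lA; exists (d * e); first exact: mulf_neq0.
move=> x [_ [c _ <-] /IH Ax].
have -> : zin (d * e) * x =
    zin e * (zin d * (x - zin c * a)) + zin (d * c) * (zin e * a).
  by rewrite !zinM; ring.
by apply: zmod_setD => //; apply: AM => //; apply: mem_zin.
Qed.

(** d N lies inside A, so it is finitely generated over the noetherian Z, and dividing by d gives
    generators of N. For the basis, c times that of A is used. *)
Lemma lattice_sandwich A N : noetherian_domain -> lattice A ->
  module_over Zring N ->
  (exists2 c, c != 0 & forall x, A x -> N (zin c * x)) ->
  (exists2 d, d != 0 & forall x, N x -> A (zin d * x)) -> lattice N.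
Proof.
move=> noeZ [/fg_ZmoduleE[l Al] [m [b [bas bA]]]] [zN NM] [c c0 AN] [d d0 NA].
have [w wd] := zin_inv d0; split; last first.
  exists m, (fun i => zin c * b i); split=> [x|i]; last exact: AN.
  have [k [xk ku]] := bas x; have tc : tofrac c != 0 by rewrite tofrac_eq0.
  exists (\row_i ((tofrac c)^-1 * k 0 i)); split.
    rewrite xk; apply: eq_bigr => i _.
    by rewrite mxE -zinE scalerA mulrAC mulVf // mul1r.
  move=> k' xk'; apply/rowP => i; rewrite mxE.
  rewrite (ku (\row_j (tofrac c * k' 0 j))) ?mxE ?mulKf //.
  rewrite xk'; apply: eq_bigr => j _.
  by rewrite mxE -zinE scalerA mulrC.
apply/fg_ZmoduleE.
have [||l' Nl'] := @span_noetherian l [set zin d * x | x in N] noeZ.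
- split; first split.
  + by exists 0; [case: zN|rewrite mulr0].
  + by move=> _ _ [x Nx <-] [y Ny <-]; exists (x - y); [apply: zN.2|rewrite mulrBr].
  + by move=> e _ Ze [x Nx <-]; exists (e * x); [apply: NM|rewrite mulrCA].
- by move=> _ [x Nx <-]; rewrite -Al; apply: NA.
exists (map ( *%R w) l'); apply/seteqP; split=> [x Nx|].
  have : span Zring l' (zin d * x) by rewrite -Nl'; exists x.
  rewrite -{2}[x]mul1r -wd -mulrA; move: (zin d * x).
  have [zs sM] := span_module Zring (map ( *%R w) l').
  apply: (@span_sub _ _ _ [set y | span Zring (map ( *%R w) l') (w * y)]).
    split; first split=> /=.
    + by rewrite mulr0; case: zs.
    + by move=> y z /= sy sz; rewrite mulrBr; apply: zs.2.
    + by move=> e y Ze sy /=; rewrite mulrCA; apply: sM.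
  by move=> y yl'; apply/mem_span/map_f.
apply: span_sub => // _ /mapP[y yl' ->].
have : span Zring l' y by apply: mem_span.
by rewrite -Nl' => -[x Nx <-]; rewrite mulrA wd mul1r.
Qed.

Lemma lattice_fg A : lattice A -> exists l, A = span Zring l.
Proof. by case=> /fg_ZmoduleE. Qed.

(** The union of the chain is finitely generated, and its generators all occur at some finite
    stage. *)
Lemma span_acc l (C : nat -> set K) : noetherian_domain ->
  (forall n, module_over Zring (C n)) -> (forall n, C n `<=` C n.+1) ->
  (forall n, C n `<=` span Zring l) -> exists n, forall m, C m `<=` C n.
Proof.
move=> noeZ CM CS Cl.
have CS' n m : (n <= m)%N -> C n `<=` C m.
  by move/subnK => <-; elim: (m - n)%N => // k IH; apply: subset_trans (CS _).
have [||l' Ul'] := @span_noetherian l (\bigcup_n C n) noeZ.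
- split; first split.
  + by exists 0%N => //; case: (CM 0%N) => [[]].
  + move=> x y [n _ Cx] [m _ Cy]; exists (maxn n m) => //.
    case: (CM (maxn n m)) => [[_ CB] _].
    by apply: CB; [apply: CS' Cx|apply: CS' Cy]; rewrite ?leq_maxl ?leq_maxr.
  + by move=> e x Ze [n _ Cx]; exists n => //; case: (CM n) => _; apply.
- by move=> x [n _ /Cl].
have [n Cn] : exists n, forall a, a \in l' -> C n a.
  have {Ul'} : forall a, a \in l' -> (\bigcup_n C n) a.
    by move=> a al'; rewrite Ul'; apply: mem_span.
  elim: l' => [|a l' IH] l'U; first by exists 0%N.
  have [|n Cn] := IH; first by move=> b bl'; apply: l'U; rewrite inE bl' orbT.
  have [m _ Cm] := l'U a (mem_head _ _); exists (maxn n m) => b.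
  rewrite inE => /orP[/eqP -> |/Cn Cb]; [apply: CS' Cm|apply: CS' Cb];
    by rewrite ?leq_maxl ?leq_maxr.
exists n => m x Cx; have : span Zring l' x by rewrite -Ul'; exists m.
exact: span_sub (CM n) Cn _.
Qed.

End Lattices.
Arguments zin {Z K} c.
Arguments Zring {Z} K.

(** * Noetherian properties of orders *)

Section Orders.
Variables (Z : idomainType) (K : comAlgType {fraction Z}).
Variable S : subring K.
Hypotheses (noeZ : noetherian_domain Z) (lS : lattice S).
Implicit Types (I : submod S) (c d : Z).

Lemma order_zin c : subring_set S (zin c).
Proof.
have [_ SM] := lattice_module lS; rewrite -[zin c]mulr1.
by apply: SM; [apply: mem_zin|apply: subring1].
Qed.

Lemma order_zring : Zring K `<=` S.
Proof. by move=> _ [c _ <-]; apply: order_zin. Qed.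

Lemma submod_Zmodule I : module_over (Zring K) I.
Proof.
split; first exact: submod_zmod.
by move=> b x Zb Ix; apply: submodM => //; apply: order_zring.
Qed.

(** Choosing strictly larger members forever would contradict [span_acc]. This provides both the
    existence of maximal ideals and noetherian induction. *)
Lemma order_max (P : set (submod S)) : (exists I, P I) ->
  (forall I, P I -> I `<=` S) ->
  exists2 I, P I & forall J, P J -> I `<=` J -> J `<=` I.
Proof.
move=> [I0 PI0] PS; apply: contrapT => nmax.
have /choice[f fP] : forall I : submod S, exists J : submod S,
    P I -> [/\ P J, I `<=` J & ~ J `<=` I].
  move=> I; have [PI|nPI] := pselect (P I); last by exists I.
  apply: contrapT => nJ; apply: nmax; exists I => // J PJ IJ.
  by apply: contrapT => nJI; apply: nJ; exists J.
pose C n := iter n f I0.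
have PC n : P (C n) by elim: n => // n /fP[].
have [l Sl] := lattice_fg lS.
have [|||n Cn] := @span_acc _ K l (fun n => C n) noeZ.
- by move=> n; apply: submod_Zmodule.
- by move=> n; have [] := fP _ (PC n).
- by move=> n; rewrite -Sl; apply: PS.
by have [_ _] := fP _ (PC n); apply; apply: (Cn n.+1).
Qed.

Lemma submod_lattice I :
  (exists2 c, c != 0 & submod_set I (zin c)) ->
  (exists2 d, d != 0 & forall x, submod_set I x -> subring_set S (zin d * x)) ->
  lattice I.
Proof.
move=> [c c0 Ic] bd; apply: (lattice_sandwich noeZ lS) => //.
  exact: submod_Zmodule.
by exists c => // x Sx; rewrite mulrC; apply: submodM.
Qed.

Lemma lattice_zin I : lattice I -> exists2 c, c != 0 & submod_set I (zin c).
Proof.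
by move=> lI; have [c c0] := lattice_bound 1 lI; rewrite mulr1; exists c.
Qed.

Lemma exists_maxideal I : I `<=` S -> ~ submod_set I 1 ->
  exists m : maxideal S, I `<=` m.
Proof.
move=> IS I1.
have [||M [IM MS M1] Mmax] := @order_max
  [set J : submod S | [/\ I `<=` J, J `<=` S & ~ submod_set J 1]].
- by exists I; split.
- by move=> J [].
have maxM (J : submod S) : M `<=` J -> J `<=` S -> ~ submod_set J 1 -> J `<=` M.
  by move=> MJ JS J1; apply: Mmax => //; split=> //; apply: subset_trans MJ.
by exists (Maxideal MS M1 maxM).
Qed.
End Orders.

(** * Orders over a Dedekind domain *)

Section DimensionOne.
Variables (Z : idomainType) (K : comAlgType {fraction Z}).
Hypothesis hZ : dedekind_domain Z.
Variable S : subring K.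
Hypothesis lS : lattice S.
Implicit Types (I : submod S) (c d : Z) (q m : maxideal S).

Lemma dedekind_noetherian : noetherian_domain Z.
Proof. by case: hZ. Qed.
Let noeZ := dedekind_noetherian.
Let Szin := order_zin lS.

(** Let z be a nonzero nonunit of Z. If z is outside q, it is invertible modulo q, so z (S / q) = S
    / q; Nakayama's lemma over Z with the ideal z Z gives 1 - z c in q, and this is nonzero because
    z is not a unit. *)
Lemma maxideal_zin q : exists2 c, c != 0 & submod_set q (zin c).
Proof.
have [[z z0 zu] _ _ _] := hZ.
have [qz|nqz] := pselect (submod_set q (zin z)); first by exists z.
have [t St qt] := maxideal_inv (Szin z) nqz; have [l Sl] := lattice_fg lS.
have mB I := submod_Zmodule lS I.
pose zZ : set K := [set zin (z * c) | c in [set: Z]].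
have [|||||_ [c _ <-] /(_ 1 (subring1 S))] :=
  @nakayama K (Zring K) zZ S _ _ (mB (ring_mod S)) l q (mB q).
- by move=> _ [c _ <-]; apply: mem_zin.
- split; first split; first by exists 0; rewrite // mulr0 zin0.
    by move=> _ _ [c _ <-] [d _ <-]; exists (c - d); rewrite // mulrBr zinB.
  by move=> _ _ [d _ <-] [c _ <-]; exists (d * c); rewrite // mulrCA !zinM.
- by move=> a al; rewrite Sl; apply: mem_span.
- move=> x Sx; exists x; first by rewrite -Sl.
  by rewrite subrr; case: (submod_zmod q).
- move=> x Sx; exists (zin z * (t * x)).
    apply: mem_prod_set; last exact: subringM.
    by exists 1; rewrite // mulr1.
  have -> : x - zin z * (t * x) = x * (1 - zin z * t) by ring.
  exact: submodM.
rewrite mulr1 -(zin1 K) -zinB => qc; exists (1 - z * c) => //.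
apply: contra zu; rewrite subr_eq0 => /eqP e; apply/unitrP; exists c.
by rewrite -e mulrC -e.
Qed.

(** * Primes containing a nonzero integer are maximal *)

Section Prime.
Variable P : submod S.
Hypotheses (PS : P `<=` S) (P1 : ~ submod_set P 1).
Hypothesis Pprime : forall s t, subring_set S s -> subring_set S t ->
  submod_set P (s * t) -> submod_set P s \/ submod_set P t.
Variable c0 : Z.
Hypotheses (c00 : c0 != 0) (Pc0 : submod_set P (zin c0)).

Let zP := submod_zmod P.

(** P contracts to a nonzero prime ideal of Z, which is maximal because Z is Dedekind. *)
Lemma prime_contract c : ~ submod_set P (zin c) ->
  exists b, submod_set P (1 - zin b * zin c).
Proof.
have [_ _ _ primeZ] := hZ; pose I : set Z := [set c | submod_set P (zin c)].
have iI : is_ideal I.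
  split; first split; rewrite /I /=; first by rewrite zin0; case: zP.
    by move=> a b Pa Pb /=; rewrite zinB; apply: zP.2.
  by move=> a b Pb /=; rewrite zinM; apply: submodM.
have [||_ _ Imax] := primeZ I.
- split=> //; rewrite /I /=; first by rewrite zin1.
  by move=> a b /=; rewrite zinM; apply: Pprime.
- by move=> I0; have : I c0 by []; rewrite I0 => /eqP; apply/negP.
move=> nPc; pose J : set Z := [set x | exists b, I (x - b * c)].
have [[b]|nJ] := pselect (J 1).
  by rewrite /I /= zinB zin1 zinM; exists b.
case: nPc; suff JI : J = I.
  have : J c by exists 1; rewrite /I /= mul1r subrr zin0; case: zP.
  by rewrite JI.
apply: Imax => //; last first.
  by move=> x Ix; exists 0; rewrite mul0r subr0.
have [[I0 IB] IM] := iI; split; first split.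
- by exists 0; rewrite mul0r subr0.
- move=> x y [b Ib] [b' Ib']; exists (b - b').
  have -> : x - y - (b - b') * c = (x - b * c) - (y - b' * c) by ring.
  exact: IB.
- by move=> a x [b Ib]; exists (a * b); rewrite -mulrA -mulrBr; apply: IM.
Qed.

(* Z + Z s + ... + Z s^(n-1) + P *)
Fixpoint powers_mod (s : K) (n : nat) : set K :=
  if n is n'.+1 then
    [set x | exists c, exists2 g, powers_mod s n' g & submod_set P (x - (zin c + s * g))]
  else P.

Lemma powers_modS s n : powers_mod s n `<=` powers_mod s n.+1.
Proof.
elim: n => [|n IH] x /=.
  move=> Px; exists 0, 0; first by case: zP.
  by rewrite zin0 mulr0 addr0 subr0.
by move=> [c [g sg Pg]]; exists c, g => //; apply: IH.
Qed.

Lemma powers_mod_sub s n : subring_set S s -> powers_mod s n `<=` S.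
Proof.
move=> Ss; elim: n => [|n IH] x; first exact: PS.
move=> [c [g /IH Sg /PS Sx]]; rewrite -(subrK (zin c + s * g) x).
apply: (zmod_setD (subring_zmod S)) => //.
by apply: (zmod_setD (subring_zmod S)) => //; apply: subringM.
Qed.

Lemma powers_mod_module s n : subring_set S s ->
  module_over (Zring K) (powers_mod s n).
Proof.
move=> Ss; elim: n => [|n [[IH0 IHB] IHM]]; first exact: submod_Zmodule.
split; first split.
- apply: powers_modS; exact: IH0.
- move=> x y [c [g sg Pg]] [d [h sh Ph]]; exists (c - d), (g - h); first exact: IHB.
  rewrite zinB (_ : _ - _ = (x - (zin c + s * g)) - (y - (zin d + s * h))).
    exact: zP.2.
  by ring.
- move=> _ x [e _ <-] [c [g sg Pg]]; exists (e * c), (zin e * g).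
    by apply: IHM => //; apply: mem_zin.
  rewrite zinM (_ : _ - _ = zin e * (x - (zin c + s * g))); last by ring.
  exact: submodM.
Qed.

(* s satisfies a monic equation modulo P; in one of least degree the constant *)
(* coefficient is not in P, hence is invertible modulo P.                     *)
Lemma prime_inv s : subring_set S s -> ~ submod_set P s ->
  exists2 t, subring_set S t & submod_set P (1 - s * t).
Proof.
move=> Ss nPs; have [l Sl] := lattice_fg lS.
have Ssn n : subring_set S (s ^+ n).
  by elim: n => [|n IH]; rewrite ?expr0 ?exprS; [apply: subring1|apply: subringM].
have mE n := @powers_mod_module s n Ss.
have [|N EN] := span_acc (l := l) noeZ mE (@powers_modS s).
  by move=> n; rewrite -Sl; apply: powers_mod_sub.
(* Stability of the chain is a monic equation: s^N is a combination of lower powers modulo P. *)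
have : powers_mod s N (s ^+ N).
  apply: (EN N.+1); elim: N {EN} => [|n IH].
    exists 1, 0; first by case: zP.
    by rewrite zin1 mulr0 addr0 subrr; case: zP.
  by exists 0, (s ^+ n) => //; rewrite zin0 add0r exprS subrr; case: zP.
(* Descent on the degree: as long as the constant coefficient lies in P, primality cancels one
   factor s. Degree 0 would mean that 1 lies in P. *)
elim: N {EN} => [|n IH] //= [c [g sg Pg]].
have Sg := powers_mod_sub Ss sg.
have Ssg : subring_set S (s ^+ n - g) by apply: subringB.
have Psg : submod_set P (s * (s ^+ n - g) - zin c).
  by rewrite mulrBr -exprS -addrA -opprD [s * g + _]addrC.
have [Pc|nPc] := pselect (submod_set P (zin c)).
  have : submod_set P (s * (s ^+ n - g)).
    by rewrite -(subrK (zin c) (s * _)); apply: zmod_setD.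
  move=> /(Pprime Ss Ssg)[//|Pn]; apply: IH; rewrite -(subrK g (s ^+ n)).
  apply: zmod_setD (mE n).1 _ sg.
  have : forall k, P `<=` powers_mod s k.
    by elim=> // k IHk; apply: subset_trans (@powers_modS s k).
  exact.
have [b Pb] := prime_contract nPc; exists (zin b * (s ^+ n - g)).
  exact: subringM.
have -> : 1 - s * (zin b * (s ^+ n - g)) =
  (1 - zin b * zin c) - zin b * (s * (s ^+ n - g) - zin c) by ring.
by apply: zP.2 => //; apply: submodM.
Qed.

End Prime.

(** * Products of maximal ideals *)

Definition maxideal_prod (ms : seq (maxideal S)) : set K :=
  foldr (fun m A => submod_set m ** A) S ms.

Lemma maxideal_prod_cat ms ms' :
  maxideal_prod (ms ++ ms') = maxideal_prod ms ** maxideal_prod ms'.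
Proof.
rewrite /maxideal_prod foldr_cat; elim: ms => [|m ms IH] /=; last by rewrite IH prod_setA.
have : module_over S (maxideal_prod ms').
  elim: ms' => [|m ms' IH] /=; first exact: (submod_module (ring_mod S)).
  split; first by apply: prod_set_zmod; apply: submod_zmod.
  by move=> b x Sb; apply: prod_set_ideal => y; apply: submodM.
by move=> mm; rewrite prod_set_idl //; apply: subring1.
Qed.

(** Noetherian induction. A maximal counterexample P is prime: if s t lies in P, then P + S s and P
    + S t contain products of maximal ideals, and the product of these two modules lies in P. But
    then P is maximal by [prime_inv], hence itself such a product. *)
Lemma contains_maxideal_prod I c : c != 0 -> submod_set I (zin c) -> I `<=` S ->
  exists ms, maxideal_prod ms `<=` I.
Proof.
move=> c0 Ic IS; apply: contrapT => bad.
have [||P [Pc PS Pbad] Pmax] := @order_max _ _ S noeZ lS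
  [set J : submod S | [/\ submod_set J (zin c), J `<=` S &
                         ~ exists ms, maxideal_prod ms `<=` J]].
- by exists I; split.
- by move=> J [].
have P1 : ~ submod_set P 1.
  move=> P1; apply: Pbad; exists [::] => x /= Sx.
  by rewrite -[x]mulr1; apply: submodM.
have zP := submod_zmod P.
have good a : subring_set S a -> ~ submod_set P a ->
    exists ms, maxideal_prod ms `<=` add_mod P a.
  move=> Sa nPa; apply: contrapT => bad'; apply: nPa.
  apply: (Pmax (add_mod P a)); [split=> //|exact: add_mod_sub|exact: add_mod_gen].
    exact: add_mod_sub.
  exact: (add_mod_subset (W := ring_mod S)).
have Pprime s t : subring_set S s -> subring_set S t ->
    submod_set P (s * t) -> submod_set P s \/ submod_set P t.
  move=> Ss St Pst; apply: contrapT => /not_orP[nPs nPt]; apply: Pbad.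
  have [ms msP] := good s Ss nPs; have [ms' msP'] := good t St nPt.
  exists (ms ++ ms'); rewrite maxideal_prod_cat.
  apply: subset_trans (prod_setS msP msP') _.
  apply: prod_set_subZ => // a b [x Sx Px] [y Sy Py].
  have -> : a * b = (a - x * s) * b + x * s * (b - y * t) + x * y * (s * t) by ring.
  have Sb : subring_set S b.
    rewrite -(subrK (y * t) b); apply: (zmod_setD (subring_zmod S)); last exact: subringM.
    exact: PS.
  apply: zmod_setD => //; first apply: zmod_setD => //.
  - by rewrite mulrC; apply: submodM.
  - by apply: submodM => //; apply: subringM.
  - by apply: submodM => //; apply: subringM.
have Pmaximal (J : submod S) : P `<=` J -> J `<=` S -> ~ submod_set J 1 -> J `<=` P.
  move=> PJ JS J1 s Js; apply: contrapT => nPs; apply: J1.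
  have [t St /PJ Jt] := prime_inv PS P1 Pprime c0 Pc (JS _ Js) nPs.
  rewrite -(subrK (s * t) 1); apply: (zmod_setD (submod_zmod J)) => //.
  by rewrite mulrC; apply: submodM.
apply: Pbad; exists [:: Maxideal PS P1 Pmaximal] => /=.
by rewrite (prod_submod_ring P).
Qed.

(** A factor equal to q costs one power of q; every other factor has an element outside q, and [e]
    is the product of these elements. *)
Lemma pow_maxideal_prod q ms : exists e N, [/\ subring_set S e,
  ~ submod_set q e & forall x, submod_set (pow_mod q N) x -> maxideal_prod ms (e * x)].
Proof.
elim: ms => [|m ms [e [N [Se nqe eN]]]] /=.
  exists 1, 0%N; split; [exact: subring1|exact: maxideal_proper|].
  by move=> x; rewrite mul1r.
have [mq|] := pselect (m `<=` q).
  exists e, N.+1; split=> // x /=.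
  apply: (prod_set_sub (W := fun x => _ (e * x))).
  - by rewrite mulr0; apply: prod_set0.
  - by move=> y z; rewrite mulrDr; apply: prod_setD.
  - move=> a b qa qb; rewrite mulrCA; apply: mem_prod_set; last exact: eN.
    exact: maxideal_eq qa.
move=> /existsNP[s /not_implyP[ms' nqs]]; exists (s * e), N.
have Ss : subring_set S s by apply: maxidealS ms'.
split; [exact: subringM|exact: maxideal_prodn|].
by move=> x /eN ex; rewrite -mulrA; apply: mem_prod_set.
Qed.

Definition zscale c : set K := [set zin c * x | x in subring_set S].

Lemma zscale_zmod c : zmod_set (zscale c).
Proof.
have [S0 SB] := subring_zmod S; split; first by exists 0; rewrite ?mulr0.
by move=> _ _ [x Sx <-] [y Sy <-]; exists (x - y); rewrite ?mulrBr //; apply: SB.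
Qed.

Lemma zscaleM c a x : subring_set S a -> zscale c x -> zscale c (a * x).
Proof.
by move=> Sa [y Sy <-]; exists (a * y); [apply: subringM|rewrite mulrCA].
Qed.

Definition zscale_mod c : submod S := Submod (zscale_zmod c) (@zscaleM c).

Lemma zscale_prod c : c != 0 -> exists ms, maxideal_prod ms `<=` zscale c.
Proof.
move=> c0; apply: (@contains_maxideal_prod (zscale_mod c) c) => //.
  by exists 1; rewrite ?mulr1 //; apply: subring1.
by move=> _ [x Sx <-]; apply: subringM.
Qed.

(* S / c S is artinian, hence killed by a power of q after inverting some e   *)
(* outside q.                                                                 *)
Lemma pow_maxideal_zscale q c : c != 0 -> exists e N, [/\ subring_set S e,
  ~ submod_set q e &
  forall n x, submod_set (pow_mod q (N + n)) x ->
    exists2 y, submod_set (pow_mod q n) y & e * x = zin c * y].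
Proof.
move=> /zscale_prod[ms msc]; have [e [N [Se nqe eN]]] := pow_maxideal_prod q ms.
exists e, N; split=> //; elim=> [|n IH] x.
  by rewrite addn0 => /eN/msc[y Sy <-]; exists y.
rewrite addnS /=; move: x; apply: (prod_set_sub
  (W := fun x => exists2 y, (submod_set q ** pow_mod q n) y & e * x = zin c * y)).
- by exists 0; [apply: prod_set0|rewrite !mulr0].
- move=> u v [y qy ey] [z qz ez]; exists (y + z); first exact: prod_setD.
  by rewrite !mulrDr ey ez.
- move=> a b qa /IH[y qy ey]; exists (a * y); first exact: mem_prod_set.
  by rewrite mulrCA ey mulrCA.
Qed.

(** * Invertible ideals modulo a nonzero ideal *)

Section Semilocal.
Variables (M M' : submod S).
Hypothesis MM' : M ** M' = S.

Lemma prod_witness q : exists x y, [/\ submod_set M x, submod_set M' y &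
  ~ submod_set q (x * y)].
Proof.
apply: contrapT => nxy; apply: (@maxideal_proper _ _ q).
have : (M ** M') 1 by rewrite MM'; apply: subring1.
apply: prod_set_subZ; first exact: submod_zmod.
move=> x y Mx My; apply: contrapT => nq.
by apply: nxy; exists x, y; split.
Qed.

Let MM'S x y : submod_set M x -> submod_set M' y -> subring_set S (x * y).
Proof. by move=> Mx My; rewrite -MM'; apply: mem_prod_set. Qed.

Lemma maxideal_prod_sub ms : maxideal_prod ms `<=` S.
Proof.
elim: ms => [|m ms IH] //=; apply: prod_set_subZ; first exact: subring_zmod.
by move=> a b /maxidealS Sa /IH; apply: subringM.
Qed.

(** Prime avoidance, one maximal ideal at a time. If x M' falls into the new ideal m, then x is
    corrected by e x0, where e lies in the product of the earlier ideals but not in m, and x0 M' is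
    not contained in m. *)
Lemma semilocal_avoid ms : exists2 x, submod_set M x &
  forall q, maxideal_prod ms `<=` q ->
  exists2 y, submod_set M' y & ~ submod_set q (x * y).
Proof.
elim: ms => [|m ms [x Mx xP]].
  exists 0; first by case: (submod_zmod M).
  by move=> q Sq; case: (@maxideal_proper _ _ q); apply/Sq/subring1.
have prodP q : maxideal_prod (m :: ms) `<=` q -> m `<=` q \/ maxideal_prod ms `<=` q.
  move=> pq; have [|/existsNP[s /not_implyP[ms' nqs]]] := pselect (m `<=` q).
    by left.
  right=> z pz; have : submod_set q (s * z) by apply/pq/mem_prod_set.
  move/maxideal_prime => [||//|//]; last exact: maxideal_prod_sub pz.
  exact: maxidealS ms'.
have [[y M'y nmy]|nmx] := pselect (exists2 y, submod_set M' y & ~ submod_set m (x * y)).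
  exists x => // q /prodP[mq|]; last exact: xP.
  by exists y => // qxy; apply/nmy/maxideal_eq/qxy.
(* If the earlier product were inside m, the induction hypothesis would apply to m and contradict
   [nmx]. *)
have [e ee nme] : exists2 e, maxideal_prod ms e & ~ submod_set m e.
  apply: contrapT => ne; apply: nmx; apply: xP => z pz.
  by apply: contrapT => nz; apply: ne; exists z.
have Se := maxideal_prod_sub ee.
have [x0 [y0 [Mx0 My0 nxy0]]] := prod_witness m.
exists (x + e * x0).
  by apply: (zmod_setD (submod_zmod M)) => //; apply: submodM.
have addn (q : maxideal S) u v : submod_set q u -> ~ submod_set q v -> ~ submod_set q (u + v).
  move=> qu nqv quv; apply: nqv; rewrite -(addKr u v) addrC.
  exact: (submod_zmod q).2.
move=> q /prodP[mq|pq].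
  exists y0 => // /(maxideal_eq mq); rewrite mulrDl; apply: addn.
    by apply: contrapT => nm; apply: nmx; exists y0.
  by rewrite -mulrA; apply: maxideal_prodn => //; apply: MM'S.
have [y My nxy] := xP q pq; exists y => //.
rewrite mulrDl addrC; apply: addn => //.
by rewrite -mulrA mulrC; apply: submodM; [apply: MM'S|apply: pq].
Qed.

(* S / I is semilocal.                                                        *)
Lemma semilocal_principal I c : c != 0 -> submod_set I (zin c) -> I `<=` S ->
  exists x y, [/\ submod_set M x, submod_set M' y & submod_set I (1 - x * y)].
Proof.
move=> c0 Ic IS; have [ms msI] := contains_maxideal_prod c0 Ic IS.
have [x Mx xP] := semilocal_avoid ms.
(* The ideal x M' + I of S. A maximal ideal containing it would contain I, hence the product [ms],
   and also x M', against the choice of x. *)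
pose N : set K := [set s | subring_set S s /\ exists2 y, submod_set M' y &
                     submod_set I (s - x * y)].
have zN : zmod_set N.
  split.
    split; first by case: (subring_zmod S).
    exists 0; first by case: (submod_zmod M').
    by rewrite mulr0 subrr; case: (submod_zmod I).
  move=> s t [Ss [y My Iy]] [St [z Mz Iz]]; split; first exact: subringB.
  exists (y - z); first exact: (submod_zmod M').2.
  rewrite (_ : _ - _ = (s - x * y) - (t - x * z)); last by ring.
  exact: (submod_zmod I).2.
have NM a s : subring_set S a -> N s -> N (a * s).
  move=> Sa [Ss [y My Iy]]; split; first exact: subringM.
  exists (a * y); first exact: submodM.
  by rewrite mulrCA -mulrBr; apply: submodM.
have [[_ [y My Iy]]|N1] := pselect (N 1); first by exists x, y.
have [|q Nq] := exists_maxideal noeZ lS (I := Submod zN NM) _ N1.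
  by move=> s [].
have IN : I `<=` N.
  move=> s Is; split; first exact: IS.
  exists 0; first by case: (submod_zmod M').
  by rewrite mulr0 subr0.
have [|y My []] := xP q.
  by apply: subset_trans msI _ => s /IN/Nq.
apply: Nq; split; first exact: MM'S.
by exists y; rewrite // subrr; case: (submod_zmod I).
Qed.

End Semilocal.
End DimensionOne.

(** * Completions *)

Section CompletionUnits.
Variables (K : comNzRingType) (S : subring K) (q : maxideal S).
Implicit Types (c d : completion q) (n : nat).

(** Representatives fixed once and for all; at level n they respect sums and products only modulo
    q^n. *)
Definition approx c : nat -> K := projT1 (cid (cpl_rep c)).

Lemma approxS c n : subring_set S (approx c n).
Proof. by rewrite /approx; case: cid => x []. Qed.

Lemma approx_coherent c n : submod_set (pow_mod q n) (approx c n.+1 - approx c n).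
Proof. by rewrite /approx; case: cid => x []. Qed.

Lemma cpl_val_approx c n : cpl_val c n = coset (pow_mod q n) (approx c n).
Proof. by rewrite /approx; case: cid => x []. Qed.

Let pow_zmod n : zmod_set (pow_mod q n) := submod_zmod _.

Lemma approx_eq c n x : cpl_val c n = coset (pow_mod q n) x ->
  submod_set (pow_mod q n) (approx c n - x).
Proof. by rewrite cpl_val_approx; apply: coset_eq; case: (pow_zmod n). Qed.

Lemma approx_const (a : subring_type S) n :
  submod_set (pow_mod q n) (approx (cpl_const q a) n - \val a).
Proof. exact/approx_eq. Qed.

Lemma approx1 n : submod_set (pow_mod q n) (approx 1 n - 1).
Proof. exact: approx_const. Qed.

Lemma approxD c d n :
  submod_set (pow_mod q n) (approx (c + d) n - (approx c n + approx d n)).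
Proof. by apply: approx_eq; rewrite cpl_addE !cpl_val_approx coset_addE. Qed.

Lemma approxM c d n :
  submod_set (pow_mod q n) (approx (c * d) n - approx c n * approx d n).
Proof.
by apply: approx_eq; rewrite cpl_mulE !cpl_val_approx pow_mod_mulE //; apply: approxS.
Qed.

Lemma pow_mod1 : submod_set (pow_mod q 1) = q.
Proof. exact: prod_submod_ring. Qed.

Lemma pow_mod_le m n : (m <= n)%N -> submod_set (pow_mod q n) `<=` pow_mod q m.
Proof.
move/subnK => <-; elim: (n - m)%N => // k IH.
by apply: subset_trans IH; apply: pow_mod_sub.
Qed.

Lemma approx_diff c m n : (m <= n)%N ->
  submod_set (pow_mod q m) (approx c n - approx c m).
Proof.
move=> /subnK <-; elim: (n - m)%N => [|k IH].
  by rewrite add0n subrr; case: (pow_zmod m).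
rewrite -(subrKA (approx c (k + m))); apply: zmod_setD => //.
by apply: (pow_mod_le (leq_addl k m)); apply: approx_coherent.
Qed.

Lemma pow_mod_prod m x : submod_set (pow_mod q m) x ->
  forall y, submod_set q y -> submod_set (pow_mod q m.+1) (x * y).
Proof. by move=> qx y qy; rewrite mulrC; apply: mem_prod_set. Qed.

Lemma cpl_unit c : ~ submod_set q (approx c 1) -> exists d, c * d = 1.
Proof.
move=> nq; have inv n : exists2 y, subring_set S y &
    submod_set (pow_mod q n) (1 - approx c n * y).
  have [t St qt] := maxideal_inv (approxS c 1) nq.
  case: n => [|n]; first by exists t; last exact: subringB (subring1 S) (subringM (approxS _ _) St).
  have qn : submod_set q (1 - approx c n.+1 * t).
    have -> : 1 - approx c n.+1 * t =
      (1 - approx c 1 * t) - t * (approx c n.+1 - approx c 1) by ring.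
    apply: (submod_zmod q).2 => //; apply: submodM => //.
    by rewrite -pow_mod1; apply: approx_diff.
  move: (approx c n.+1) (approxS c n.+1) qn => a Sa qa.
  suff H k : exists2 y, subring_set S y & submod_set (pow_mod q k) (1 - a * y) by apply: H.
  elim: k => [|k [y Sy qy]].
    by exists 0; [case: (subring_zmod S)|rewrite mulr0 subr0; apply: subring1].
  (* Each iteration gains the factor 1 - a t, which lies in q: the new error is (1 - a y)(1 - a
     t). *)
  exists (y + t * (1 - a * y)).
    apply: (zmod_setD (subring_zmod S)) => //; apply: subringM => //.
    by apply: subringB; [apply: subring1|apply: subringM].
  have -> : 1 - a * (y + t * (1 - a * y)) = (1 - a * y) * (1 - a * t) by ring.
  exact: pow_mod_prod.
have /choice[y yP] : forall n, exists y, subring_set S y /\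
    submod_set (pow_mod q n) (1 - approx c n * y).
  by move=> n; have [y] := inv n; exists y.
have Sy n : subring_set S (y n) by case: (yP n).
(* Inverses modulo q^n are unique, so independently chosen ones are coherent. *)
have qy n : submod_set (pow_mod q n) (y n.+1 - y n).
  have -> : y n.+1 - y n = y n.+1 * (1 - approx c n * y n)
     - y n * (1 - approx c n.+1 * y n.+1) - y n * y n.+1 * (approx c n.+1 - approx c n).
    by ring.
  have [_ q1] := yP n; have [_ /pow_mod_sub q2] := yP n.+1.
  apply: (pow_zmod n).2; last by apply: submodM; [apply: subringM|apply: approx_coherent].
  by apply: (pow_zmod n).2; apply: submodM.
exists (cpl_of Sy qy); apply: cpl_ext => n.
rewrite cpl_mulE cpl_val_approx pow_mod_mulE //; last exact: approxS.
rewrite [RHS](_ : _ = coset (pow_mod q n) 1) //; apply/esym/eq_coset => //.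
by case: (yP n).
Qed.

Lemma cpl_const_unit (a : subring_type S) : ~ submod_set q (\val a) ->
  exists d, cpl_const q a * d = 1.
Proof.
move=> nqa; apply: cpl_unit => qa; apply: nqa.
have := approx_const a 1; rewrite pow_mod1 => q1.
rewrite -(subKr (approx (cpl_const q a) 1) (\val a)).
exact: (submod_zmod q).2.
Qed.

(** The completion is a local ring: at level 1, c and 1 - c d cannot both lie in q. *)
Lemma cpl_local c d : (exists u, c * u = 1) \/ exists u, (1 - c * d) * u = 1.
Proof.
have [qc|nqc] := pselect (submod_set q (approx c 1)); last by left; apply: cpl_unit.
right; apply: cpl_unit => q1; apply: (@maxideal_proper _ _ q).
have := approxD (1 - c * d) (c * d) 1; rewrite subrK pow_mod1 => qD.
have := approxM c d 1; rewrite pow_mod1 => qM.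
have := approx1 1; rewrite pow_mod1 => q0.
have zq := submod_zmod q.
have qcd : submod_set q (approx (c * d) 1).
  rewrite -(subrK (approx c 1 * approx d 1) (approx (c * d) 1)).
  by apply: zmod_setD => //; rewrite mulrC; apply: submodM => //; apply: approxS.
have qq : submod_set q (approx 1 1).
  rewrite -(subrK (approx (1 - c * d) 1 + approx (c * d) 1) (approx 1 1)).
  by do !apply: zmod_setD => //.
by rewrite -(subKr (approx 1 1) 1); apply: zq.2.
Qed.

End CompletionUnits.

(* The reduction M (x) S_q -> h(M) / W, when W contains q^n h(M); its values  *)
(* are arbitrary representatives, so it is additive only modulo W.            *)
Section Residue.
Variables (K : comNzRingType) (S : subring K) (q : maxideal S) (n : nat).
Variables (M : lmodType (subring_type S)) (h : M -> K).
Hypothesis hD : forall x y, h (x + y) = h x + h y.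
Hypothesis hZ : forall a x, h (a *: x) = \val a * h x.
Variable W : submod S.
Hypothesis qW : forall a x, submod_set (pow_mod q n) a -> submod_set W (a * h x).

Definition res_seq (u : seq (M * completion q)) : K :=
  \sum_(p <- u) approx p.2 n * h p.1.

Definition residue (x : tensor M (completion q)) : K := res_seq (trepr x).

Let zW := submod_zmod W.
Let W0 := zW.1.
Let WD := fun x y => @zmod_setD _ _ x y zW.
Let WN := fun x => @zmod_setN _ _ x zW.

Lemma res_seq_eq u v : tens_eq u v -> submod_set W (res_seq u - res_seq v).
Proof.
have h0 : h 0 = 0 by apply: (addrI (h 0)); rewrite -hD !addr0.
rewrite /res_seq; elim=> {u v} [u|u v _|u v w _ + _|u u' v v' _ + _|u v|x|x x' c|x c c'|a x c];
    rewrite ?big_cat ?big_cons ?big_nil /= ?addr0 ?subr0.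
- by rewrite subrr.
- by move/WN; rewrite opprB.
- by move=> w1 w2; rewrite -(subrKA (\sum_(p <- v) approx p.2 n * h p.1)); apply: WD.
- by move=> w1 w2; rewrite opprD addrACA; apply: WD.
- by rewrite addrC subrr.
- by rewrite h0 mulr0.
- by rewrite hD mulrDr subrr.
- by rewrite -mulrDl -mulrBl; apply/qW/approxD.
- rewrite hZ mulrA -mulrBl; apply: qW.
  have -> : approx c n * \val a - approx (a *: c) n =
    - (approx (a *: c) n - approx (cpl_const q a) n * approx c n)
    - approx c n * (approx (cpl_const q a) n - \val a) by ring.
  have zq := submod_zmod (pow_mod q n).
  apply: zq.2; first by apply: zmod_setN => //; apply: approxM.
  by apply: submodM; [apply: approxS|apply: approx_const].
Qed.

Lemma residue_tsum u : submod_set W (residue (tsum u) - res_seq u).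
Proof. exact/res_seq_eq/tens_repr. Qed.

Lemma residueD x y : submod_set W (residue (x + y) - (residue x + residue y)).
Proof.
rewrite -{1}[x]treprK -{1}[y]treprK -tsum_cat -[_ + residue y]big_cat.
exact: residue_tsum.
Qed.

Lemma residue0 : submod_set W (residue 0).
Proof. by rewrite -[residue 0]subr0; have := residue_tsum [::]; rewrite /res_seq big_nil. Qed.

Lemma residue_tens x c : submod_set W (residue (tens x c) - approx c n * h x).
Proof. by have := residue_tsum [:: (x, c)]; rewrite /res_seq big_seq1. Qed.

Lemma residue_tens1 x : submod_set W (residue (tens x 1) - h x).
Proof.
rewrite -(subrKA (approx (1 : completion q) n * h x)); apply: WD.
  exact: residue_tens.
by rewrite -[X in _ - X]mul1r -mulrBl; apply/qW/approx1.
Qed.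

Lemma residueZ (c : completion q) (x : scalar_ext M (completion q)) :
  submod_set W (residue (c *: x) - approx c n * residue x).
Proof.
have Wa y : submod_set W y -> submod_set W (approx c n * y).
  by apply: submodM; apply: approxS.
elim/tensor_ind: x => [|x y IHx IHy|x d].
- rewrite scaler0; apply: zW.2; first exact: residue0.
  exact/Wa/residue0.
- rewrite (scalerDr c (x : scalar_ext M (completion q)) y).
  move: (c *: (x : scalar_ext M (completion q))) IHx => cx IHx.
  move: (c *: (y : scalar_ext M (completion q))) IHy => cy IHy.
  have -> : residue (cx + cy) - approx c n * residue (x + y) =
    (residue (cx + cy) - (residue cx + residue cy))
    + (residue cx - approx c n * residue x)
    + (residue cy - approx c n * residue y)
    - approx c n * (residue (x + y) - (residue x + residue y)) by ring.
  apply: zW.2; last exact/Wa/residueD.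
  by apply: (WD _ IHy); apply: (WD _ IHx); apply: residueD.
- have -> : c *: (tens x d : scalar_ext M (completion q)) = tens x (c * d) by exact: ext_scaleE.
  have -> : residue (tens x (c * d)) - approx c n * residue (tens x d) =
    (residue (tens x (c * d)) - approx (c * d) n * h x)
    + (approx (c * d) n - approx c n * approx d n) * h x
    - approx c n * (residue (tens x d) - approx d n * h x) by ring.
  apply: zW.2; last exact/Wa/residue_tens.
  by apply: WD; [apply: residue_tens|apply/qW/approxM].
Qed.

Lemma residue_in (I : submod S) x : (forall m, submod_set I (h m)) ->
  submod_set I (residue x).
Proof.
move=> hI; rewrite /residue /res_seq; elim/big_ind: _ => [|u v|p _].
- by case: (submod_zmod I).
- exact: (zmod_setD (submod_zmod I)).
- by apply: submodM => //; apply: approxS.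
Qed.

End Residue.

(** * Weak equivalence and invertible ideals *)

Section ExtMap.
Variables (S : comNzRingType) (M N : lmodType S) (B : comAlgType S).
Variable h : M -> N.
Hypothesis hD : forall x y, h (x + y) = h x + h y.
Hypothesis hZ : forall a x, h (a *: x) = a *: h x.

Lemma ext_map_exists : exists f : {linear scalar_ext M B -> scalar_ext N B},
  forall m b, f (tens m b) = tens (h m) b.
Proof.
pose f : scalar_ext M B -> scalar_ext N B :=
  tens_lift (fun m b => tens (h m) b : scalar_ext N B).
have hDl m m' b : tens (h (m + m')) b = tens (h m) b + tens (h m') b :> scalar_ext N B.
  by rewrite hD; apply: tensDl.
have hDr m b b' : tens (h m) (b + b') = tens (h m) b + tens (h m) b' :> scalar_ext N B.
  exact: tensDr.
have hZZ s m b : tens (h (s *: m)) b = tens (h m) (s *: b) :> scalar_ext N B.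
  by rewrite hZ; apply: tensZ.
have fE m b : f (tens m b) = tens (h m) b by apply: tens_liftE.
have fD (x y : scalar_ext M B) : f (x + y) = f x + f y by apply: tens_liftD.
have lf : linear f.
  move=> b x y; rewrite fD; congr (_ + _).
  have f0 : f 0 = 0 by apply: (addrI (f 0)); rewrite -fD !addr0.
  elim/tensor_ind: x => [|x x' IH IH'|m c].
  - by rewrite scaler0 f0 scaler0.
  - by rewrite (scalerDr b (x : scalar_ext M B) x') !fD scalerDr IH IH'.
  - rewrite [b *: _](ext_scaleE b m c : b *: (tens m c : scalar_ext M B) = _) !fE.
    by apply/esym; apply: ext_scaleE.
pose F : {linear scalar_ext M B -> scalar_ext N B} :=
  HB.pack f (GRing.isLinear.Build _ _ _ _ f lf).
by exists F.
Qed.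
End ExtMap.

Section WeakEquivalence.
Variables (Z : idomainType) (K : comAlgType {fraction Z}).
Variable S : subring K.
Implicit Types (I J L : submod S) (q : maxideal S).

Lemma weakly_equivalent_sym I J : weakly_equivalent I J -> weakly_equivalent J I.
Proof.
move=> IJ q; have [f [g fK gK]] := IJ q.
have lg : linear g by move=> a x y; apply: (can_inj fK); rewrite linearP !gK.
pose G : {linear local_mod J q -> local_mod I q} :=
  HB.pack g (GRing.isLinear.Build _ _ _ _ g lg).
by exists G; exists f.
Qed.

Lemma weakly_equivalent_trans I J L :
  weakly_equivalent I J -> weakly_equivalent J L -> weakly_equivalent I L.
Proof.
move=> IJ JL q; have [f fb] := IJ q; have [g gb] := JL q.
by exists (g \o f : {linear _ -> _}); apply: bij_comp.
Qed.

Lemma weakly_equivalent_refl I : weakly_equivalent I I.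
Proof. by move=> q; exists (idfun : {linear _ -> _}); exists idfun. Qed.

Section Mul.
Variables (I J : submod S) (a : K).
Hypothesis aIJ : forall x, submod_set I x -> submod_set J (a * x).

Definition submod_mul (x : submod_type I) : submod_type J :=
  exist (fun y => y \in (J : set K)) _ (mem_set (aIJ (set_mem (valP x)))).

Lemma submod_mul_ext (B : comAlgType (subring_type S)) : exists
  f : {linear scalar_ext (submod_type I) B -> scalar_ext (submod_type J) B},
  forall m b, f (tens m b) = tens (submod_mul m) b.
Proof.
apply: ext_map_exists => [x y|s x]; apply: val_inj; first exact: mulrDr.
exact: mulrCA.
Qed.
End Mul.

(** At q choose a in L and b in L' with a b outside q. Multiplications by a and by b map I to J and
    J to I, and both composites are multiplication by a b, a unit of the completion. *)
Lemma weakly_equivalent_mul I J L L' :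
  L ** L' = S -> L ** I = J -> weakly_equivalent I J.
Proof.
move=> LL' LIJ q; have [a [b [La Lb nqab]]] := prod_witness LL' q.
have aIJ x : submod_set I x -> submod_set J (a * x).
  by rewrite -LIJ; apply: mem_prod_set.
have bJI x : submod_set J x -> submod_set I (b * x).
  have <- : L' ** J = I by rewrite -LIJ prod_setA [L' ** L]prod_setC LL' prod_ring_submod.
  exact: mem_prod_set.
have Sab : subring_set S (a * b) by rewrite -LL'; apply: mem_prod_set.
pose s : subring_type S := exist (fun y => y \in (S : set K)) _ (mem_set Sab).
have [u su] : exists u, cpl_const q s * u = 1 by apply: cpl_const_unit.
have [f fE] := submod_mul_ext aIJ (completion q).
have [g gE] := submod_mul_ext bJI (completion q).
have gf x : g (f x) = cpl_const q s *: x.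
  elim/tensor_ind: x => [|x y IHx IHy|m c]; first by rewrite !linear0.
    rewrite (linearD f x y) (linearD g) IHx IHy.
    by apply/esym; apply: (scalerDr (cpl_const q s) (x : local_mod I q) y).
  rewrite fE gE; transitivity (tens m (cpl_const q s * c) : local_mod I q); last first.
    by apply/esym; apply: ext_scaleE.
  rewrite -[cpl_const q s * c]/(s *: c) -tensZ; congr tens; apply: val_inj => /=.
  by rewrite mulrA [b * a]mulrC.
have fg x : f (g x) = cpl_const q s *: x.
  elim/tensor_ind: x => [|x y IHx IHy|m c]; first by rewrite !linear0.
    rewrite (linearD g x y) (linearD f) IHx IHy.
    by apply/esym; apply: (scalerDr (cpl_const q s) (x : local_mod J q) y).
  rewrite gE fE; transitivity (tens m (cpl_const q s * c) : local_mod J q); last first.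
    by apply/esym; apply: ext_scaleE.
  rewrite -[cpl_const q s * c]/(s *: c) -tensZ; congr tens; apply: val_inj => /=.
  by rewrite mulrA.
exists f; exists (fun x => u *: g x) => x.
  by rewrite gf scalerA mulrC su scale1r.
by rewrite linearZ /= fg scalerA mulrC su scale1r.
Qed.

End WeakEquivalence.

(** * Weakly equivalent ideals differ by an invertible ideal *)

Section WeakEquivalenceConverse.
Variables (Z : idomainType) (K : comAlgType {fraction Z}).
Variable S : subring K.
Implicit Types (I J L : submod S) (q : maxideal S).
Hypotheses (hZ : dedekind_domain Z) (lS : lattice S).
Let noeZ := dedekind_noetherian hZ.

(* Up to a unit at q, the isomorphism is multiplication by f(d) / d for any   *)
(* d in I; approximating f(d) by an element of J modulo a high power of q     *)
(* gives a global multiplication from I to J which is onto modulo q J.        *)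
Lemma weak_approximation I J q : lattice I -> lattice J ->
  (exists f : {linear local_mod I q -> local_mod J q}, bijective f) ->
  exists a, (forall x, submod_set I x -> submod_set J (a * x)) /\
    forall z, submod_set J z -> exists2 x, submod_set I x & (q ** J) (z - a * x).
Proof.
move=> lI lJ [f [g _ gK]].
(* d lies in I and clears the denominators of I, so that d x is a scalar of S for every x in I. *)
have [d [d0 Id dI]] : exists d, [/\ d != 0, submod_set I (zin d) &
    forall x, submod_set I x -> subring_set S (zin d * x)].
  have [d1 d10 I1] := lattice_zin lI; have [d2 d20 I2] := lattice_bound_all lS lI.
  exists (d1 * d2); rewrite mulf_neq0 // zinM; split=> //.
    by rewrite mulrC; apply: submodM => //; apply: order_zin.
  by move=> x /I2 Sx; rewrite -mulrA; apply: subringM => //; apply: order_zin.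
have [e [N [Se nqe eN]]] := pow_maxideal_zscale hZ lS q (mulf_neq0 d0 d0).
(* w is 1 / d^2. Dividing by d^2 is paid for by e and the N extra powers: (e / d^2) q^(N+1) J lies
   in q J. *)
have [w wd] := zin_inv K (mulf_neq0 d0 d0).
pose W := prod_mod (pow_mod q (N + 1)) J.
pose hJ (x : submod_type J) : K := \val x.
have hD x y : hJ (x + y) = hJ x + hJ y by [].
have hS s x : hJ (s *: x) = \val s * hJ x by [].
have qW a x : submod_set (pow_mod q (N + 1)) a -> submod_set W (a * hJ x).
  by move=> qa; apply: mem_prod_set => //; apply: set_mem (valP x).
have weW x : submod_set W x -> (q ** J) (w * e * x).
  move: x; apply: (prod_set_sub (W := fun x => (q ** J) (w * e * x))).
  - by rewrite mulr0; apply: prod_set0.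
  - by move=> x y; rewrite mulrDr; apply: prod_setD.
  - move=> x y /eN[z qz ez] Jy.
    rewrite mulrA -[w * e * x]mulrA ez mulrA wd mul1r.
    by apply: mem_prod_set => //; rewrite -pow_mod1.
pose res := residue (N + 1) hJ : local_mod J q -> K.
have Jres x : submod_set J (res x).
  by apply: residue_in => m; apply: set_mem (valP m).
pose iI x (Ix : submod_set I x) : submod_type I :=
  exist (fun y => y \in (I : set K)) x (mem_set Ix).
pose iS x (Sx : subring_set S x) : subring_type S :=
  exist (fun y => y \in (S : set K)) x (mem_set Sx).
pose t (x : submod_type I) : local_mod I q := tens x 1.
have tZ (s : subring_type S) x : t (s *: x) = cpl_const q s *: t x.
  rewrite [RHS](ext_scaleE (cpl_const q s) x 1 : _ = _) /t tensZ.
  by congr tens.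
(* This stands for e f(d) / d. *)
pose a := w * e * zin d * res (f (t (iI _ Id))).
have zqJ : zmod_set (q ** J) by apply: prod_set_zmod; apply: submod_zmod.
have qJM s x : subring_set S s -> (q ** J) x -> (q ** J) (s * x).
  by move=> Ss; apply: (submodM (s := prod_mod q J)).
have qJJ : q ** J `<=` J.
  apply: prod_set_subZ; first exact: submod_zmod.
  by move=> x y /maxidealS; apply: submodM.
have Wq : W `<=` q ** J.
  apply: prod_setS => // y; rewrite -[X in _ -> X y]pow_mod1; apply: pow_mod_le.
  by rewrite addn1.
have aE (x : submod_type I) : (q ** J) (e * res (f (t x)) - a * \val x).
  have Ix := set_mem (valP x).
  (* d^2 x = (d x) d, read with d^2 and then with d x as the scalar; applying f compares f(x) with
     f(d). *)
  have ee : cpl_const q (iS _ (order_zin lS (d * d))) *: t x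
          = cpl_const q (iS _ (dI _ Ix)) *: t (iI _ Id).
    by rewrite -!tZ; congr t; apply: val_inj; rewrite /= zinM; ring.
  have /(congr1 res) := congr1 f ee; rewrite !linearZ /= => eres.
  have Wc s y : submod_set W (res (cpl_const q s *: y) - \val s * res y).
    rewrite -(subrKA (approx (cpl_const q s) (N + 1) * res y)).
    apply: (zmod_setD (submod_zmod W)); first exact: residueZ.
    by rewrite -mulrBl; apply: mem_prod_set => //; apply: approx_const.
  have := Wc (iS _ (order_zin lS (d * d))) (f (t x)).
  have := Wc (iS _ (dI _ Ix)) (f (t (iI _ Id))).
  rewrite eres /= => W1 W2; have /weW := (submod_zmod W).2 _ _ W1 W2.
  rewrite (_ : w * e * _ = (w * zin (d * d)) * e * res (f (t x)) - a * \val x).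
    by rewrite wd mul1r.
  by rewrite /a -[sval x]/(\val x); ring.
(* Since z = f (g z), surjectivity reduces to the values of f, where [aE] applies to each pure
   tensor. *)
have eJ (z : submod_type J) : exists2 x, submod_set I x & (q ** J) (e * \val z - a * x).
  suff H xi : exists2 x, submod_set I x & (q ** J) (e * res (f xi) - a * x).
    have [x Ix qx] := H (g (tens z 1)); exists x => //.
    move: qx; rewrite gK => qx.
    have -> : e * \val z - a * x =
      (e * res (tens z 1) - a * x) - e * (res (tens z 1) - \val z) by ring.
    apply: zqJ.2 => //; apply: qJM => //.
    by apply: Wq; apply: residue_tens1.
  elim/tensor_ind: xi => [|x y [x' Ix qx] [y' Iy qy]|m c].
  - exists 0; first by case: (submod_zmod I).
    rewrite linear0 mulr0 subr0; apply: qJM => //; apply: Wq; exact: residue0.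
  - exists (x' + y'); first exact: (zmod_setD (submod_zmod I)).
    rewrite (linearD f (x : local_mod I q) y).
    move: (f x) (f y) qx qy => fx fy qx qy.
    have -> : e * res (fx + fy) - a * (x' + y') = (e * res fx - a * x')
      + (e * res fy - a * y') + e * (res (fx + fy) - (res fx + res fy)) by ring.
    apply: zmod_setD => //; first exact: zmod_setD.
    by apply: qJM => //; apply: Wq; apply: residueD.
  - have Sc : subring_set S (approx c (N + 1)) by apply: approxS.
    exists (approx c (N + 1) * \val m).
      by apply: submodM => //; apply: set_mem (valP m).
    have -> : tens m c = c *: t m.
      by rewrite [RHS](ext_scaleE c m 1 : _ = _) mulr1.
    rewrite linearZ /=.
    have -> : e * res (c *: f (t m)) - a * (approx c (N + 1) * \val m) =
      e * (res (c *: f (t m)) - approx c (N + 1) * res (f (t m)))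
      + approx c (N + 1) * (e * res (f (t m)) - a * \val m) by ring.
    apply: zmod_setD => //; last exact: qJM.
    by apply: qJM => //; apply: Wq; apply: residueZ.
have aJ x : submod_set I x -> submod_set J (a * x).
  move=> Ix; rewrite -(subKr (e * res (f (t (iI x Ix)))) (a * x)).
  by apply: (submod_zmod J).2; [apply: submodM|apply/qJJ/aE].
exists a; split=> // z Jz; have [x Ix qx] := eJ (exist _ z (mem_set Jz)).
(* An inverse of e modulo q removes the factor e. *)
have [e' Se' qe'] := maxideal_inv Se nqe; exists (e' * x); first exact: submodM.
have -> : z - a * (e' * x) = (1 - e * e') * z + e' * (e * z - a * x) by ring.
by apply: zmod_setD => //; [apply: mem_prod_set|apply: qJM].
Qed.

(** Otherwise (I : J)(J : I) lies in a maximal ideal q. The two approximations give J = a I + q J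
    and I = b J + q I with b a in q, hence I = q I. By Nakayama's lemma some 1 - s with s in q kills
    I; as I contains a nonzero integer, s = 1, which is absurd. *)
Lemma weakly_equivalent_invertible I J : lattice I -> lattice J ->
  colon I I = S -> weakly_equivalent I J -> colon I J ** colon J I = S.
Proof.
move=> lI lJ II IJ; have JI := weakly_equivalent_sym IJ.
have zS := subring_zmod S.
pose X := prod_mod (colon_mod I J) (colon_mod J I).
have colonS a b : colon I J a -> colon J I b -> subring_set S (a * b).
  by move=> aI bJ; rewrite -II => x Ix; rewrite -mulrA; apply/aI/bJ.
have XS : X `<=` S by apply: prod_set_subZ.
suff X1 : submod_set X 1.
  by apply/seteqP; split=> // x Sx; rewrite -[x]mulr1; apply: (submodM (s := X)).
apply: contrapT => nX1; have [q Xq] := exists_maxideal noeZ lS XS nX1.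
have [a [aIJ aP]] := weak_approximation lI lJ (IJ q).
have [b [bJI bP]] := weak_approximation lJ lI (JI q).
have qba : submod_set q (b * a) by apply/Xq/mem_prod_set.
have zqI : zmod_set (q ** I) by apply: prod_set_zmod; apply: submod_zmod.
have IqI x : submod_set I x -> (q ** I) x.
  move=> Ix; have [y Jy qy] := bP x Ix; have [x' Ix' qx'] := aP y Jy.
  have -> : x = (x - b * y) + b * (y - a * x') + b * a * x' by ring.
  apply: zmod_setD => //; last exact: mem_prod_set.
  apply: zmod_setD => //; move: (y - a * x') qx'.
  apply: (prod_set_sub (W := fun z => (q ** I) (b * z))) => [|u v|u v qu Jv].
  - by rewrite mulr0; apply: prod_set0.
  - by rewrite mulrDr; apply: prod_setD.
  - by rewrite mulrCA; apply: mem_prod_set => //; apply: bJI.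
have [l Il] := lattice_fg lI.
have [|||||s qs sI] := @nakayama K S q I _ (submod_module q) (submod_module I) l [set 0].
- exact: maxidealS.
- split; first by split=> // x y -> ->; rewrite /= subrr.
  by move=> c x _ ->; rewrite /= mulr0.
- by move=> c cl; rewrite Il; apply: mem_span.
- move=> x; rewrite Il => Ix; exists x; last by rewrite /= subrr.
  move: x Ix; apply: span_sub => [|c]; last exact: mem_span.
  have [zl lM] := span_module S l; split=> // c x Zc; apply: lM.
  exact: (order_zring lS).
- by move=> x /IqI qx; exists x; rewrite //= subrr.
have [d d0 Id] := lattice_zin lI; apply: (@maxideal_proper _ _ q).
suff -> : 1 = s by [].
apply/eqP; rewrite -subr_eq0; apply/eqP; apply: (zin_reg d0).
by rewrite mulr0 mulrC; apply: sI.
Qed.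

End WeakEquivalenceConverse.

(** * The order (p : p) *)

Section MultiplicatorOrder.
Variables (Z : idomainType) (K : comAlgType {fraction Z}).
Hypothesis hZ : dedekind_domain Z.
Variables (R : subring K) (p : maxideal R).
Hypothesis lR : lattice R.
Implicit Types (I L : submod R) (M : submod (Tp p)).
Local Notation T := (Tp p).
Let noeZ := dedekind_noetherian hZ.

Lemma Tp_p : T ** p = p.
Proof.
apply: prod_set_idl; first exact: subring1.
by split; [apply: submod_zmod|move=> b x; apply].
Qed.

Lemma p_Tp : p ** T = p. Proof. by rewrite prod_setC Tp_p. Qed.

Lemma prod_ring_Tp : R ** T = T.
Proof.
apply: prod_set_idl; first exact: subring1.
split; first exact: subring_zmod.
by move=> b x Rb; apply: subringM; apply: overringS.
Qed.

Lemma p_sub_Tp : p `<=` T.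
Proof. by move=> x px; apply: overringS; apply: maxidealS px. Qed.

Lemma TpM t x : subring_set T t -> submod_set p x -> submod_set p (t * x).
Proof. exact. Qed.

Definition p_Tmod : submod T := Submod (submod_zmod p) TpM.

Lemma Tp_bound : exists2 d, d != 0 &
  submod_set p (zin d) /\ forall t, subring_set T t -> subring_set R (zin d * t).
Proof.
have [d d0 pd] := maxideal_zin hZ lR p; exists d => //; split=> // t Tt.
by rewrite mulrC; apply: maxidealS; apply: TpM pd.
Qed.

Lemma lattice_Tp : lattice T.
Proof.
apply: (lattice_sandwich noeZ lR).
- split; first exact: subring_zmod.
  move=> b x Zb; apply: subringM; apply: overringS; exact: (order_zring lR).
- by exists 1; rewrite ?oner_eq0 // zin1 => x Rx; rewrite mul1r; apply: overringS.
- by have [d d0 [_ dT]] := Tp_bound; exists d.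
Qed.

Definition ext_mod (A : set K) : submod T :=
  Submod (prod_set_zmod A (submod_zmod (ring_mod T)))
         (fun a x Ta => prod_set_ideal (fun y => @submodM _ _ (ring_mod T) _ y Ta) (x := x)).

Lemma ext_lattice I : lattice I -> lattice (ext_mod I).
Proof.
move=> lI; apply: (submod_lattice noeZ lattice_Tp).
  have [c c0 Ic] := lattice_zin lI; exists c => //.
  by rewrite -[zin c]mul1r; apply: mem_prod_set => //; apply: subring1.
have [d d0 Id] := lattice_bound_all lR lI; exists d => //.
apply: (prod_set_sub (W := fun x => subring_set T (zin d * x))) => [|x y|t x Tt Ix].
- by rewrite mulr0; case: (subring_zmod T).
- by rewrite mulrDr; apply: (zmod_setD (subring_zmod T)).
- by rewrite mulrCA; apply: subringM => //; apply: overringS; apply: Id.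
Qed.

(* If a stabilizes T I then a p stabilizes I, so that a p is contained in R;  *)
(* the ideal (T I : T I) p of R is either p or R.                             *)
Lemma colon_ext I : colon I I = R -> colon (T ** I) (T ** I) = T.
Proof.
move=> II; pose T' := mult_subring (ext_mod I).
have T'R a x : subring_set T' a -> submod_set p x -> subring_set R (a * x).
  move=> Ta px; rewrite -II => y Iy; rewrite mulrAC.
  have aTI : (T ** I) (a * y).
    by apply: Ta; rewrite -[y]mul1r; apply: mem_prod_set => //; apply: subring1.
  have : (p ** (T ** I)) (a * y * x) by rewrite mulrC; apply: mem_prod_set.
  rewrite prod_setA p_Tp; apply: prod_set_subZ; first exact: submod_zmod.
  by move=> u v /maxidealS; apply: submodM.
apply/seteqP; split=> [a aTI|t Tt]; last first.
  by move=> x; apply: (submodM (s := ext_mod I)).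
have [ap|/existsNP[x /not_implyP[px nax]]] :=
  pselect (forall x, submod_set p x -> submod_set p (a * x)); first exact: ap.
have T'1 := subring1 T'.
have XR b x' : subring_set R b -> (T' ** p) x' -> (T' ** p) (b * x').
  move=> Rb; rewrite prod_setC; apply: prod_set_ideal => y; exact: submodM.
pose X : submod R := Submod (prod_set_zmod p (subring_zmod T')) XR.
have XR' : X `<=` R.
  by apply: prod_set_subZ => //; apply: subring_zmod.
have pX : p `<=` X by move=> y py; rewrite -[y]mul1r; apply: mem_prod_set.
have [X1|nX1] := pselect (submod_set X 1); last first.
  by case: nax; apply: (maxideal_max pX XR' nX1); apply: mem_prod_set.
(* Here (T I : T I) p contains 1; being a module over (T I : T I), it contains a as well, and it
   lies in R. *)
apply: overringS; apply: XR'; rewrite -[a]mulr1.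
rewrite -[X in X _]/(T' ** p) -(prod_ringxx T') -prod_setA.
exact: mem_prod_set.
Qed.

(** The lattice condition comes for free: p L = p T L = p T = p, so L contains p, and L lies in
    T. *)
Lemma Ugroup_intro L L' : L ** L' = R -> L ** T = T -> Ugroup p L.
Proof.
move=> LL' LT; split=> //; last exact: invertible_of_prod LL'.
have [d d0 [pd Rd]] := Tp_bound; apply: (submod_lattice noeZ lR).
  exists d => //; have : (p ** L) (zin d).
    by rewrite -p_Tp -prod_setA [T ** L]prod_setC LT p_Tp.
  by apply: prod_set_subZ => [|u v /maxidealS]; [apply: submod_zmod|apply: submodM].
exists d => // z Lz; apply: Rd; rewrite -[X in X z]LT -[z]mulr1.
by apply: mem_prod_set => //; apply: subring1.
Qed.

Lemma ideal_full (N : submod R) : submod_set N 1 -> R `<=` N.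
Proof. by move=> N1 x Rx; rewrite -[x]mulr1; apply: submodM. Qed.

Section UnitGenerator.
Variables x y : K.
Hypotheses (Tx : subring_set T x) (Ty : subring_set T y).
Hypothesis pxy : submod_set p (1 - x * y).

(** x and y are inverse to each other modulo p, and this makes x R + p and y R + p inverse
    ideals. *)
Lemma unit_gen_prod : add_mod p x ** add_mod p y = R.
Proof.
have zR := subring_zmod R; have pR := @maxidealS _ _ p.
have Rxy : subring_set R (x * y).
  by rewrite -(subKr 1 (x * y)); apply: zR.2; [apply: subring1|apply: pR].
apply/seteqP; split.
  apply: prod_set_subZ => // a b [s Rs ps] [s' Rs' ps'].
  have -> : a * b = x * y * (s * s') + s * (x * (b - s' * y))
     + s' * (y * (a - s * x)) + (a - s * x) * (b - s' * y) by ring.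
  do 3?apply: zmod_setD => //; first (by apply: subringM => //; apply: subringM);
    apply: subringM => //; apply: pR => //; exact: TpM.
apply: (@ideal_full (prod_mod (add_mod p x) (add_mod p y))).
rewrite -[X in X 1]/(add_mod p x ** add_mod p y).
rewrite -(subrK (x * y) 1); apply: prod_setD; last first.
  by apply: mem_prod_set; apply: add_mod_gen.
(* All of p lies in the product, because p = x p + p (1 - x y). *)
move: (1 - x * y) pxy => u pu.
have -> : u = x * (y * u) + u * (1 - x * y) by ring.
apply: prod_setD; apply: mem_prod_set; try exact: add_mod_gen; apply: add_mod_sub => //.
exact: TpM.
Qed.

Lemma unit_gen_Tp : add_mod p x ** T = T.
Proof.
apply/seteqP; split.
  apply: prod_set_subZ; first exact: subring_zmod.
  move=> a t [s Rs ps] Tt; apply: subringM => //.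
  rewrite -(subrK (s * x) a); apply: (zmod_setD (subring_zmod T)); first exact: p_sub_Tp.
  by apply: subringM => //; apply: overringS.
move=> t Tt; have -> : t = x * (y * t) + (1 - x * y) * t by ring.
apply: prod_setD; apply: mem_prod_set => //; first exact: add_mod_gen.
  exact: subringM.
exact: add_mod_sub.
Qed.

Lemma unit_gen_Ugroup : Ugroup p (add_mod p x).
Proof. exact: Ugroup_intro unit_gen_prod unit_gen_Tp. Qed.

End UnitGenerator.

Lemma Ugroup_p L : Ugroup p L -> p ** L = p.
Proof. by move=> [_ _ LT]; rewrite -{1}p_Tp -prod_setA [T ** L]prod_setC LT p_Tp. Qed.

(** Take x in L and y in the inverse of L with x y outside p, and invert x y modulo p by t. Then l =
    (l y t) x + (1 - x y t) l for l in L, and the last term lies in p L = p. *)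
Lemma Ugroup_gen L : Ugroup p L -> exists x y, [/\ subring_set T x,
  subring_set T y, submod_set p (1 - x * y) & L = add_mod p x].
Proof.
move=> UL; have pL := Ugroup_p UL; have [_ invL LT] := UL.
pose L' := colon_mod (ring_mod R) L.
have LL' : L ** L' = R by have := congr1 (@submod_set _ _) invL.
have sT A : A ** T = T -> A `<=` T.
  by move=> AT a Aa; rewrite -AT -[a]mulr1; apply: mem_prod_set => //; apply: subring1.
have L'T : L' ** T = T.
  by rewrite -{1}LT prod_setA [L' ** L]prod_setC LL' prod_ring_Tp.
have [x [y [Lx L'y npxy]]] := prod_witness LL' p.
have Rxy : subring_set R (x * y) by rewrite -LL'; apply: mem_prod_set.
have [t Rt pt] := maxideal_inv Rxy npxy.
have L'yt : submod_set L' (y * t) by rewrite mulrC; apply: submodM.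
exists x, (y * t); split.
- exact: (sT _ LT).
- exact: (sT _ L'T).
- by rewrite mulrA.
apply: submod_inj; apply/seteqP; split; last first.
  apply: add_mod_subset => //; rewrite -pL; apply: prod_set_subZ.
    exact: submod_zmod.
  by move=> a b /maxidealS; apply: submodM.
move=> l Ll; exists (l * (y * t)); first by rewrite -LL'; apply: mem_prod_set.
have -> : l - l * (y * t) * x = (1 - x * y * t) * l by ring.
by rewrite -pL; apply: mem_prod_set.
Qed.

Lemma Ugroup_inv L : Ugroup p L -> exists2 L', Ugroup p L' & L ** L' = R.
Proof.
move=> /Ugroup_gen[x [y [Tx Ty pxy ->]]]; exists (add_mod p y).
  by apply: (unit_gen_Ugroup Ty Tx); rewrite mulrC.
exact: unit_gen_prod.
Qed.

Lemma Ugroup1 : Ugroup p (ring_mod R).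
Proof.
apply: (Ugroup_intro (L := ring_mod R) (L' := ring_mod R)); last exact: prod_ring_Tp.
exact: prod_ringxx.
Qed.

Lemma Ugroup_mul L L' : Ugroup p L -> Ugroup p L' -> Ugroup p (prod_mod L L').
Proof.
move=> UL UL'; have [N _ LN] := Ugroup_inv UL; have [N' _ LN'] := Ugroup_inv UL'.
have [[_ _ LT] [_ _ LT']] := (UL, UL').
apply: (Ugroup_intro (L' := prod_mod N N')); rewrite /= -prod_setA; last by rewrite LT'.
by rewrite [N ** N']prod_setC (prod_setA L') LN' prod_ring_submod.
Qed.

(* M = x T + p M for some x, since T / p is semilocal; then L = x R + p M.    *)
Lemma invertible_lift (M M' : submod T) : M ** M' = T ->
  exists L L', L ** L' = R /\ L ** T = M.
Proof.
move=> MM'; have [d d0 pd] := maxideal_zin hZ lR p.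
have [x [y [Mx M'y pxy]]] := semilocal_principal hZ lattice_Tp MM' (I := p_Tmod) d0 pd p_sub_Tp.
pose pm (N : submod T) : submod R := Submod (prod_set_zmod N (submod_zmod p))
  (fun a z Ra => prod_set_ideal (fun w => @submodM _ _ p _ w Ra) (x := z)).
have zR := subring_zmod R; have pR := @maxidealS _ _ p.
have pMM' : p ** M ** M' = p by rewrite -prod_setA MM' p_Tp.
have pM'M : p ** M' ** M = p by rewrite prod_setAC pMM'.
have Rxy : subring_set R (x * y).
  by rewrite -(subKr 1 (x * y)); apply: zR.2; [apply: subring1|apply: pR].
have MT : M ** T = M by apply: prod_submod_ring.
(* The inverse of x R + p M is y R + p M'. *)
exists (add_mod (pm M) x), (add_mod (pm M') y); split; last first.
  apply/seteqP; split.
    rewrite -[X in _ `<=` X]MT; apply: prod_setS => // a [s Rs pa].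
    rewrite -(subrK (s * x) a); apply: (zmod_setD (submod_zmod M)); last first.
      by apply: submodM => //; apply: overringS.
    move: pa; apply: prod_set_subZ; first exact: submod_zmod.
    by move=> u v /p_sub_Tp; apply: submodM.
  move=> m Mm; have -> : m = x * (y * m) + (1 - x * y) * m * 1 by ring.
  apply: prod_setD; apply: mem_prod_set; first exact: add_mod_gen.
  - by rewrite -MM' mulrC; apply: mem_prod_set.
  - by apply: add_mod_sub; apply: mem_prod_set.
  - exact: subring1.
apply/seteqP; split.
  apply: prod_set_subZ => // a b [s Rs ps] [s' Rs' ps'].
  have -> : a * b = x * y * (s * s') + s * ((b - s' * y) * x)
     + s' * ((a - s * x) * y) + (a - s * x) * (b - s' * y) by ring.
  do 3?apply: zmod_setD => //.
  - by apply: subringM => //; apply: subringM.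
  - by apply: subringM => //; apply: pR; rewrite -pM'M; apply: mem_prod_set.
  - by apply: subringM => //; apply: pR; rewrite -pMM'; apply: mem_prod_set.
  - have : (p ** M ** (p ** M')) ((a - s * x) * (b - s' * y)) by apply: mem_prod_set.
    rewrite [p ** M']prod_setC prod_setA pMM'; apply: prod_set_subZ => // u v /pR Ru /pR.
    exact: subringM.
apply: (@ideal_full (prod_mod (add_mod (pm M) x) (add_mod (pm M') y))).
rewrite -[X in X 1]/(add_mod (pm M) x ** add_mod (pm M') y).
rewrite -(subrK (x * y) 1); apply: prod_setD; last first.
  by apply: mem_prod_set; apply: add_mod_gen.
move: (1 - x * y) (pxy) => u pu.
have -> : u = x * (u * y) + u * (1 - x * y) by ring.
apply: prod_setD.
  apply: mem_prod_set; first exact: add_mod_gen.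
  by apply: add_mod_sub; apply: mem_prod_set.
have : (p ** M ** (p ** M')) (u * (1 - x * y)).
  by rewrite [p ** M']prod_setC prod_setA pMM'; apply: mem_prod_set.
by apply: prod_setS; [apply: (@add_mod_sub _ _ (pm M))|apply: (@add_mod_sub _ _ (pm M'))].
Qed.

End MultiplicatorOrder.

(** * Modules between p J and J *)

Section Intermediate.
Variables (Z : idomainType) (K : comAlgType {fraction Z}).
Variables (R : subring K) (p : maxideal R).
Local Notation T := (Tp p).
Variable J : submod T.
Implicit Types (I L : submod R) (V : set (set K)).
Local Notation pJ := (submod_set p ** J).

Let zpJ : zmod_set pJ.
Proof. by apply: prod_set_zmod; apply: submod_zmod. Qed.
Let pJ0 : pJ 0 := zpJ.1.
Let zJ : zmod_set J := submod_zmod J.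
Let TJ t x : subring_set T t -> submod_set J x -> submod_set J (t * x).
Proof. exact: submodM. Qed.

Lemma Tp_pJ t x : subring_set T t -> pJ x -> pJ (t * x).
Proof. by move=> Tt; apply: prod_set_ideal => y; apply: TpM. Qed.

Lemma pJ_sub : pJ `<=` J.
Proof. by apply: prod_set_subZ => // a x /p_sub_Tp; apply: TJ. Qed.

(** [between] without the lattice condition, which follows from the two inclusions when J is a
    lattice: see [between_intermediate]. *)
Definition intermediate (I : set K) := pJ `<=` I /\ I `<=` J.

Lemma coset_pJ (A : set K) x y : intermediate A -> zmod_set A ->
  coset pJ x = coset pJ y -> A x -> A y.
Proof.
move=> [pA _] zA /(coset_eq pJ0) xy Ax; rewrite -(subKr x y).
by apply: zA.2 => //; apply: pA.
Qed.

Lemma Psi_mem I x : intermediate I -> Psi J I (coset pJ x) <-> submod_set I x.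
Proof.
move=> iI; split=> [[y Iy yx]|Ix]; last by exists x.
exact: (coset_pJ iI (submod_zmod I) yx).
Qed.

Lemma Psi_K I : intermediate I -> Psi_inv J (Psi J I) = I.
Proof.
move=> iI; apply/seteqP; split=> x; first by case=> _ /(Psi_mem _ iI).
by move=> Ix; split; [case: iI => _; apply|exists x].
Qed.

Lemma Psi_inj I I' : intermediate I -> intermediate I' -> Psi J I = Psi J I' -> I = I'.
Proof. by move=> iI iI' e; apply: submod_inj; rewrite -(Psi_K iI) e Psi_K. Qed.

Lemma coset_mulJ t x : subring_set T t -> submod_set J x ->
  coset_mul pJ (coset p t) (coset pJ x) = coset pJ (t * x).
Proof.
move=> Tt Jx; apply: coset_mulE => //.
- by case: (submod_zmod p).
- by move=> y; apply: Tp_pJ.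
- by move=> u pu; apply: mem_prod_set.
- by move=> u y pu; apply: Tp_pJ; apply: p_sub_Tp.
Qed.

Lemma Psi_subspaces I : intermediate I -> subspaces J (Psi J I).
Proof.
move=> [pI IJ]; have zI := submod_zmod I; split.
- by move=> _ [x Ix <-]; exists x; first exact: IJ.
- by exists 0 => //; case: zI.
- move=> _ _ [x Ix <-] [y Iy <-]; exists (x + y); first exact: zmod_setD.
  by rewrite coset_addE.
- move=> _ _ [r Rr <-] [x Ix <-]; exists (r * x); first exact: submodM.
  by rewrite coset_mulJ //; [apply: overringS|apply: IJ].
Qed.

Section PsiInv.
Variable V : set (set K).
Hypothesis sV : subspaces J V.

Lemma Psi_inv_zmod : zmod_set (Psi_inv J V).
Proof.
have [_ V0 VD VM] := sV; split=> [|x y [Jx Vx] [Jy Vy]].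
  by split=> //; case: zJ.
split; first exact: zJ.2.
rewrite -coset_addE //; apply: VD => //; rewrite -mulN1r -coset_mulJ //.
  apply: VM => //; exists (- 1) => //; apply: (zmod_setN (subring_zmod R)).
  exact: subring1.
by apply: (zmod_setN (subring_zmod T)); apply: subring1.
Qed.

Lemma Psi_invM r x : subring_set R r -> Psi_inv J V x -> Psi_inv J V (r * x).
Proof.
move=> Rr [Jx Vx]; have Tr := overringS T Rr; split; first exact: TJ.
by rewrite -coset_mulJ //; have [_ _ _ VM] := sV; apply: VM => //; exists r.
Qed.

Definition Psi_inv_mod : submod R := Submod Psi_inv_zmod Psi_invM.

Lemma Psi_inv_intermediate : intermediate Psi_inv_mod.
Proof.
split=> x; last by case.
move=> px; split; first exact: pJ_sub.
rewrite (_ : coset pJ x = coset pJ 0); first by case: sV.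
by apply: eq_coset => //; rewrite subr0.
Qed.

Lemma Psi_invK : Psi J Psi_inv_mod = V.
Proof.
have [VJ _ _ _] := sV; apply/seteqP; split=> [_ [x [_ Vx] <-] //|c Vc].
by have [x Jx xc] := VJ c Vc; exists x => //; split=> //; rewrite xc.
Qed.

End PsiInv.

(** Turns the spanning condition in the definition of V_i into I T = J. *)
Lemma spanA_Psi I : intermediate I -> spanA J (Psi J I) = quot (I ** T) pJ.
Proof.
move=> [_ IJ]; apply/seteqP; split=> c.
  move=> [u uP ->]; elim: u uP => [|[v a] u IH] uP.
    by rewrite big_nil; exists 0; first exact: prod_set0.
  have [] := uP _ (mem_head _ _) => /= -[x Ix <-] [t Tt <-].
  have [z Iz ze] : quot (I ** T) pJ
      (\big[@coset_add K/coset pJ 0]_(y <- u) coset_mul pJ y.2 y.1).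
    by apply: IH => y yu; apply: uP; rewrite inE yu orbT.
  exists (t * x + z).
    by apply: prod_setD => //; rewrite mulrC; apply: mem_prod_set.
  by rewrite big_cons -ze /= coset_mulJ ?coset_addE //; apply: IJ.
move=> [z [u uP ->] <-].
exists [seq (coset pJ y.1, coset p y.2) | y <- u].
  by move=> _ /mapP[y /uP[Iy Ty] ->]; split; [exists y.1|exists y.2].
rewrite big_map; elim: u uP => [|y u IH] uP; first by rewrite !big_nil.
have [Iy Ty] := uP _ (mem_head _ _); rewrite !big_cons -IH /=.
  by rewrite coset_mulJ ?coset_addE 1?[y.2 * _]mulrC //; apply: IJ.
by move=> w wu; apply: uP; rewrite inE wu orbT.
Qed.

Lemma ext_sub I : intermediate I -> I ** T `<=` J.
Proof.
by move=> [_ IJ]; apply: prod_set_subZ => // x t /IJ Jx Tt; rewrite mulrC; apply: TJ.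
Qed.

Lemma sub_ext I : I `<=` I ** T.
Proof. by move=> x Ix; rewrite -[x]mulr1; apply: mem_prod_set => //; apply: subring1. Qed.

Lemma spanA_full I : intermediate I -> spanA J (Psi J I) = Jquot J <-> I ** T = J.
Proof.
move=> iI; rewrite spanA_Psi //; split=> [e|-> //].
apply/seteqP; split; first exact: ext_sub.
move=> x Jx; have [y Iy yx] : quot (I ** T) pJ (coset pJ x) by rewrite e; exists x.
have zI : zmod_set (I ** T) by apply: prod_set_zmod; apply: submod_zmod.
apply: coset_pJ zI yx Iy; split; last exact: ext_sub.
by apply: subset_trans (sub_ext (I := I)); case: iI.
Qed.

Hypothesis JJ : colon J J = T.

(** A multiplier of I also multiplies I T = J. Hence the stabilizer in A = T / p sees the whole of
    (I : I). *)
Lemma colon_sub_Tp I : I ** T = J -> colon I I `<=` T.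
Proof.
move=> IT a aI; rewrite -[X in X a]JJ -IT => x.
by apply: prod_set_ideal => y; apply: aI.
Qed.

Lemma stabilizer_Psi I : intermediate I -> I ** T = J ->
  [set a | Aring p a /\ forall c, Psi J I c -> Psi J I (coset_mul pJ a c)] = kfield p
  <-> colon I I = R.
Proof.
move=> iI IT; have [_ IJ] := iI.
have stab t : subring_set T t -> colon I I t <->
    forall c, Psi J I c -> Psi J I (coset_mul pJ (coset p t) c).
  move=> Tt; split=> [tI _ [x Ix <-]|tI x Ix].
    by rewrite coset_mulJ //; [apply/Psi_mem=> //; apply: tI|apply: IJ].
  by apply/(Psi_mem _ iI); rewrite -coset_mulJ //; [apply: tI; exists x|apply: IJ].
have p0 : submod_set p 0 by case: (submod_zmod p).
split=> e.
  apply/seteqP; split=> [a aI|r Rr x]; last exact: submodM.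
  have Ta := colon_sub_Tp IT aI.
  have [r Rr /(coset_eq p0) ra] : kfield p (coset p a).
    by rewrite -e; split; [exists a|apply/stab].
  rewrite -(subKr r a); apply: (subring_zmod R).2 => //.
  exact: maxidealS ra.
apply/seteqP; split=> [a [[t Tt <-] tI]|_ [r Rr <-]].
  by exists t => //; rewrite -[X in X t]e; apply/stab.
have Tr := overringS T Rr; split; first by exists r.
by apply/stab => //; rewrite e.
Qed.

(** The dictionary for V_i: once I T = J, the stabilizer of I / pJ in A is (I : I) / p, which equals
    k exactly when (I : I) = R. *)
Lemma Vset_Psi I : intermediate I ->
  Vset J (Psi J I) <-> colon I I = R /\ I ** T = J.
Proof.
move=> iI; split=> [[_ st /(spanA_full iI) IT]|[II IT]].
  by split=> //; apply/stabilizer_Psi.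
by split; [apply: Psi_subspaces|apply/stabilizer_Psi|apply/spanA_full].
Qed.

Lemma Vset_ex V : Vset J V -> exists I, [/\ intermediate I, V = Psi J I,
  colon I I = R & I ** T = J].
Proof.
move=> VV; have [sV _ _] := VV; exists (Psi_inv_mod sV).
have iI := Psi_inv_intermediate sV; have [] := iffLR (Vset_Psi iI) _.
  by rewrite Psi_invK.
by split=> //; rewrite Psi_invK.
Qed.

Hypotheses (hZ : dedekind_domain Z) (lR : lattice R) (lJ : lattice J).

Lemma between_intermediate I : between J I <-> intermediate I.
Proof.
split=> [[]//|iI]; have [pI IJ] := iI; split=> //.
apply: (submod_lattice (dedekind_noetherian hZ) lR).
  have [c c0 pc] := maxideal_zin hZ lR p; have [d d0 Jd] := lattice_zin lJ.
  exists (c * d); first exact: mulf_neq0.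
  by apply: pI; rewrite zinM; apply: mem_prod_set.
by have [d d0 JR] := lattice_bound_all lR lJ; exists d => // x /IJ/JR.
Qed.

Lemma Ugroup_intermediate L I : Ugroup p L -> intermediate I ->
  intermediate (prod_mod L I).
Proof.
move=> UL [pI IJ]; have [_ _ LT] := UL; split.
  rewrite -{1}(Ugroup_p UL) [_ ** L]prod_setC -prod_setA.
  exact: prod_setS.
rewrite -[X in _ `<=` X](prod_ring_submod J) -{1}LT.
apply: prod_setS => //; exact: sub_ext.
Qed.

Lemma Uact_Psi L I : intermediate I -> Uact J L (Psi J I) = Psi J (prod_mod L I).
Proof. by move=> iI; rewrite /Uact Psi_K. Qed.

Lemma Ugroup_Vset L I : Ugroup p L -> colon I I = R -> I ** T = J ->
  colon (L ** I) (L ** I) = R /\ (L ** I) ** T = J.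
Proof.
move=> UL II IT; have [L' _ LL'] := Ugroup_inv hZ lR UL; have [_ _ LT] := UL.
split; first by rewrite (colon_mul_invertible I LL').
by rewrite prod_setAC LT prod_setC.
Qed.

(** L and its inverse L' both fix I, so both lie in (I : I) = R; then R = L L' is contained in L. *)
Lemma Ugroup_free L I : Ugroup p L -> colon I I = R -> L ** I = I -> L = ring_mod R.
Proof.
move=> UL II LI; have [L' _ LL'] := Ugroup_inv hZ lR UL.
have sR (N : submod R) : N ** I = I -> N `<=` R.
  by move=> NI a Na; rewrite -[X in X a]II => x Ix; rewrite -[X in X (a * x)]NI; apply: mem_prod_set.
have L'I : L' ** I = I by rewrite -{1}LI prod_setA [L' ** L]prod_setC LL' prod_ring_submod.
apply: submod_inj; apply/seteqP; split; first exact: sR.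
rewrite -[X in X `<=` _]LL' -[X in _ `<=` X](prod_submod_ring L).
by apply: prod_setS => //; apply: sR.
Qed.

End Intermediate.

(** * Local units *)

Lemma maxideal_inj (K : comNzRingType) (S : subring K) (m q : maxideal S) :
  submod_set m `<=` q -> m = q.
Proof.
move=> mq; have e : maxideal_mod m = maxideal_mod q.
  by apply: submod_inj; apply/seteqP; split=> //; apply: maxideal_eq.
case: m q e {mq} => [m m1 m2 m3] [q q1 q2 q3] /= e; subst q.
by rewrite (Prop_irrelevance m1 q1) (Prop_irrelevance m2 q2) (Prop_irrelevance m3 q3).
Qed.

Section LocalRing.
Variables (Z : idomainType) (K : comAlgType {fraction Z}) (R : subring K) (T : overring R) (q : maxideal R).
Local Notation Tq := (local_ring T q).
Local Notation Rq := (completion q).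
Implicit Types (c d : Rq) (x y : Tq) (t : overring_type T).

Definition sub_elt (S : subring K) a (Sa : subring_set S a) : subring_type S :=
  exist (fun b => b \in (S : set K)) a (mem_set Sa).

(** [loc] and [glob] are the structure maps of R_q and of T into T_q; the elements of T_q are the
    sums of products [glob t * loc c]. *)
Definition loc c : Tq := @tens _ (overring_type T) Rq 1 c.
Definition glob t : Tq := @tens _ (overring_type T) Rq t 1.

Lemma locM c d : loc (c * d) = loc c * loc d.
Proof. by apply: etrans (esym (tensM 1 1 c d)); rewrite mulr1. Qed.

Lemma locD c d : loc (c + d) = loc c + loc d.
Proof. exact: (tensDr (M := overring_type T) (N := Rq) 1 c d). Qed.

Lemma loc1 : loc 1 = 1. Proof. exact: erefl. Qed.

Lemma globM s t : glob (s * t) = glob s * glob t.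
Proof. by apply: etrans (esym (tensM s t 1 1)); rewrite mulr1. Qed.

Lemma globD s t : glob (s + t) = glob s + glob t.
Proof. exact: (tensDl (M := overring_type T) (N := Rq) s t 1). Qed.

Lemma tens_glob t c : (tens t c : Tq) = glob t * loc c.
Proof.
apply: etrans (esym (tensM t 1 1 c)); congr tens; apply: esym; first exact: mulr1.
exact: mul1r.
Qed.

Lemma loc_constE (a : subring_type R) t :
  glob (overring_incl T a * t) = tens t (cpl_const q a).
Proof.
apply: etrans (tensZ (M := overring_type T) (N := Rq) a t 1) _; congr tens.
exact: mulr1.
Qed.

Lemma loc_const (a : subring_type R) : loc (cpl_const q a) = glob (overring_incl T a).
Proof. by rewrite -[overring_incl T a]mulr1 loc_constE. Qed.

Lemma base_units_loc c d : c * d = 1 -> base_units (loc c).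
Proof. by move=> cd; exact: (ex_intro2 _ _ c (ex_intro _ d cd) erefl). Qed.

Lemma base_unitsP (b : Tq) : base_units b -> exists c d, c * d = 1 /\ b = loc c.
Proof.
exact: (fun h => match h with
  ex_intro2 c (ex_intro d cd) e => ex_intro _ c (ex_intro _ d (conj cd (esym e))) end).
Qed.

Lemma mem_principal x c : local_principal x (x * loc c).
Proof. exact: (ex_intro2 _ _ c I erefl). Qed.

Lemma principalP x y : local_principal x y -> exists c, y = x * loc c.
Proof. by move=> [c _ e]; exists c; exact: (esym e). Qed.

Opaque loc glob.

Lemma locB c d : loc (c - d) = loc c - loc d.
Proof. by apply: (addIr (loc d)); rewrite -locD !subrK. Qed.

Lemma glob_loc t (Rt : subring_set R (\val (t : subring_type T))) :
  glob t = loc (cpl_const q (sub_elt Rt)).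
Proof. by rewrite loc_const; congr glob; apply: val_inj. Qed.

Lemma tensor_ext_ind (P : Tq -> Prop) : P 0 ->
  (forall x y, P x -> P y -> P (x + y)) -> (forall t c, P (glob t * loc c)) ->
  forall x, P x.
Proof. by move=> P0 PD Pt x; elim/tensor_ind: x => // t c; rewrite tens_glob. Qed.

Lemma base_units1 : base_units (1 : Tq).
Proof. by rewrite -loc1; apply: (@base_units_loc _ 1); rewrite mulr1. Qed.

(** The relation holds in T_q and has to be brought back to R_q. As R_q is local, r or 1 - r r' is a
    unit there. In the second case [loc] sends a unit to 0, so T_q is the zero ring and [loc r] is
    1. *)
Lemma base_unit r r' : loc r * loc r' = 1 -> base_units (loc r).
Proof.
rewrite -locM => rr'; have [[u ru]|[u ru]] := cpl_local r r'.
  exact: base_units_loc ru.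
have e : 1 = 0 :> Tq.
  by rewrite -loc1 -ru locM locB rr' loc1 subrr mul0r.
suff -> : loc r = 1 by apply: base_units1.
by rewrite -[loc r]mul1r e mul0r.
Qed.

Lemma base_units_mul (b b' : Tq) : base_units b -> base_units b' -> base_units (b * b').
Proof.
move=> /base_unitsP[u [v [uv ->]]] /base_unitsP[u' [v' [uv' ->]]].
rewrite -locM; apply: (@base_units_loc _ (v * v')).
by rewrite mulrACA uv uv' mulr1.
Qed.

Lemma base_units_inv (b : Tq) : base_units b -> exists2 b', base_units b' & b * b' = 1.
Proof.
move=> /base_unitsP[u [v [uv ->]]]; exists (loc v); last by rewrite -locM uv.
by apply: (@base_units_loc _ u); rewrite mulrC.
Qed.

Lemma unit_coset_refl x : unit_coset x x.
Proof. by exists 1; [apply: base_units1|rewrite mulr1]. Qed.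

Lemma unit_coset_mul x (b : Tq) : base_units b -> unit_coset (x * b) = unit_coset x.
Proof.
move=> bb; apply/seteqP; split=> _ [u uu <-].
  by exists (b * u); [apply: base_units_mul|rewrite mulrA].
have [b' bb' e] := base_units_inv bb; exists (b' * u); first exact: base_units_mul.
by rewrite mulrA -[x * b * b']mulrA e mulr1.
Qed.

Lemma unit_coset_prod x y :
  unit_coset (x * y) = [set u * v | u in unit_coset x & v in unit_coset y].
Proof.
apply/seteqP; split=> [_ [b bb <-]|_ [_ [b bb <-] [_ [b' bb' <-] <-]]].
  exists x; first exact: unit_coset_refl; exists (y * b); first by exists b.
  exact: mulrA.
by exists (b * b'); [apply: base_units_mul|rewrite mulrACA].
Qed.

Lemma is_unit1 : is_unit (1 : Tq).
Proof. by exists 1; rewrite mulr1. Qed.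

Lemma unit_coset_of_loc x y r : is_unit x -> y = x * loc r ->
  (exists r', x = y * loc r') -> unit_coset x = unit_coset y.
Proof.
move=> [x' xx'] yE [r' xE]; rewrite yE unit_coset_mul //.
apply: (@base_unit _ r').
by rewrite -[LHS]mul1r -xx' mulrAC (mulrA x) -yE -xE.
Qed.

Lemma unit_coset_principal x y : is_unit x ->
  local_principal x = local_principal y -> unit_coset x = unit_coset y.
Proof.
move=> ux xy.
have [r yE] : exists r, y = x * loc r.
  by apply: principalP; rewrite xy -{2}[y]mulr1 -loc1; apply: mem_principal.
have [r' xE] : exists r, x = y * loc r.
  by apply: principalP; rewrite -xy -{2}[x]mulr1 -loc1; apply: mem_principal.
by apply: (unit_coset_of_loc ux yE); exists r'.
Qed.

Lemma local_sub_sub (L : set K) (W : set Tq) : W 0 ->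
  (forall x y, W x -> W y -> W (x + y)) ->
  (forall t c, L (\val (t : subring_type T)) -> W (tens t c)) ->
  @local_sub _ _ R T q L `<=` W.
Proof.
move=> W0 WD WL x [u uL xE]; rewrite {x}xE.
elim: u uL => [|y u IH] uL; first by rewrite big_nil.
rewrite big_cons; apply: WD; last by apply: IH => z zu; apply: uL; rewrite inE zu orbT.
exact/WL/uL/mem_head.
Qed.

Lemma mem_local_sub (L : set K) t c : L (\val (t : subring_type T)) ->
  @local_sub _ _ R T q L (tens t c).
Proof.
by move=> Lt; exists [:: (t, c)]; rewrite ?big_seq1 // => y /[!inE] /eqP ->.
Qed.

End LocalRing.


(** * Local components of the members of U *)

Section UnitIdentification.
Variables (Z : idomainType) (K : comAlgType {fraction Z}).
Hypothesis hZ : dedekind_domain Z.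
Variables (R : subring K) (p : maxideal R).
Hypothesis lR : lattice R.
Local Notation T := (Tp p).
Implicit Types (q : maxideal R) (L M : submod R).

(** Unit generators of one principal R_q-module differ by a unit of R_q, so any single one computes
    the coset. *)
Lemma UidentE L q (x : local_ring T q) : is_unit x ->
  local_sub L = local_principal x -> Uident p L q = unit_coset x.
Proof.
move=> ux Lx; apply/seteqP; split=> [y [x' [ux' Lx' yx']]|y yx]; last by exists x.
by rewrite (unit_coset_principal ux (y := x')) // -Lx -Lx'.
Qed.

Section Away.
Variable q : maxideal R.
Hypothesis npq : ~ (p `<=` q).

Lemma away_ex : exists (s : subring_type R) (u : completion q),
  submod_set p (\val s) /\ cpl_const q s * u = 1.
Proof.
move/existsNP: npq => [s /not_implyP[ps nqs]].
have [u su] : exists u, cpl_const q (sub_elt (maxidealS ps)) * u = 1.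
  exact: cpl_const_unit.
by exists (sub_elt (maxidealS ps)), u.
Qed.

(** An element s of p outside q is a unit of R_q, and s T lies in p, hence in R; so t = (s t) / s
    comes from R_q. *)
Lemma away_loc (x : local_ring T q) : exists r, x = loc T r.
Proof.
have [s [u [ps su]]] := away_ex.
elim/tensor_ext_ind: x => [|x y [r ->] [r' ->]|t c].
- by exists 0; apply: (addrI (loc T (0 : completion q))); rewrite -locD !addr0.
- by exists (r + r'); rewrite locD.
have Rst : subring_set R (\val (overring_incl T s * t : subring_type T)).
  rewrite /= mulrC; apply: maxidealS; apply: TpM ps.
  exact: set_mem (valP (t : subring_type T)).
exists (cpl_const q (sub_elt Rst) * (u * c)).
rewrite locM -glob_loc globM -loc_const -mulrA mulrCA -locM mulrA su mul1r.
by [].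
Qed.

Lemma Uident_away L : Ugroup p L -> Uident p L q = unit_coset 1.
Proof.
move=> UL; apply: UidentE; first exact: is_unit1.
apply/seteqP; split=> x _.
  by have [r ->] := away_loc x; exists r; rewrite ?mul1r.
have [s [u [ps su]]] := away_ex; have [r ->] := away_loc x.
have -> : loc T r = tens (overring_incl T s) (u * r) :> local_ring T q.
  by rewrite tens_glob -loc_const -locM mulrA su mul1r.
apply: mem_local_sub.
have [x' [_ [_ _ _ ->]]] := Ugroup_gen UL.
exact: add_mod_sub.
Qed.

End Away.

Section At.
Local Notation Rp := (completion p).
Local Notation Tl := (local_ring T p).

Section Gen.
Variables x y : K.
Hypotheses (Tx : subring_set T x) (Ty : subring_set T y).
Hypothesis pxy : submod_set p (1 - x * y).
Let xT : overring_type T := sub_elt Tx.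
Let yT : overring_type T := sub_elt Ty.

Lemma glob_inv : exists v : Rp, glob p xT * (glob p yT * loc T v) = 1.
Proof.
have Rxy : subring_set R (\val (xT * yT : subring_type T)).
  rewrite /= -(subKr 1 (x * y)); apply: (subring_zmod R).2; first exact: subring1.
  exact: maxidealS pxy.
have [v vE] : exists v, cpl_const p (sub_elt Rxy) * v = 1.
  apply: cpl_const_unit => /= pxy'; apply: (@maxideal_proper _ _ p).
  by rewrite -(subrK (x * y) 1); apply: (zmod_setD (submod_zmod p)).
by exists v; rewrite mulrA -globM (glob_loc _ Rxy) -locM vE.
Qed.

(** For t in x R + p the product y t lies in R, and x y is a unit of R_p; thus t = x (y t) / (x y)
    lies in x R_p. *)
Lemma Uident_at : Uident p (add_mod p x) p = unit_coset (glob p xT).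
Proof.
have [v ve] := glob_inv; apply: UidentE; first by exists (glob p yT * loc T v).
apply/seteqP; split; last first.
  move=> _ [r _ <-]; rewrite -/(loc T r) -tens_glob; apply: mem_local_sub.
  exact: add_mod_gen.
apply: local_sub_sub => [|_ _ [r _ <-] [r' _ <-]|t c [s Rs ps]].
- exists 0 => //; apply: (addrI (glob p xT * loc T (0 : Rp))).
  by rewrite -mulrDr -locD !addr0.
- by exists (r + r') => //; rewrite tensDr mulrDr.
have Ryt : subring_set R (\val (yT * t : subring_type T)).
  rewrite /= -(subrK (y * (s * x)) (y * sval t)); apply: (zmod_setD (subring_zmod R)).
    by rewrite -mulrBr; apply: maxidealS; exact: (TpM Ty ps).
  rewrite mulrCA; apply: subringM => //; rewrite mulrC -(subKr 1 (x * y)).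
  apply: (subring_zmod R).2; first exact: subring1.
  exact: maxidealS pxy.
exists (cpl_const p (sub_elt Ryt) * (v * c)) => //.
rewrite -/(loc T _) !locM -glob_loc globM tens_glob.
rewrite -[RHS]mul1r -ve; move: (glob p xT) (glob p yT) (glob p t) (loc T v) (loc T c).
by move=> a b c' d e; rewrite -!mulrA; congr (_ * (_ * _)); rewrite mulrCA.
Qed.

End Gen.

Let Tval (t : overring_type T) : K := \val (t : subring_type T).
Let TvalD s t : Tval (s + t) = Tval s + Tval t. Proof. by []. Qed.
Let TvalZ (a : subring_type R) t : Tval (a *: t) = \val a * Tval t. Proof. by []. Qed.
Let TvalT t : subring_set T (Tval t). Proof. exact: set_mem (valP (t : subring_type T)). Qed.
Let Tq a t : submod_set (pow_mod p 1) a -> submod_set p (a * Tval t).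
Proof. by rewrite pow_mod1 => pa; rewrite mulrC; apply: TpM. Qed.

(** The reduction from T_p to T / p, with values meaningful only modulo p. *)
Definition local_res : Tl -> K := residue 1 Tval.

Lemma local_resD a b : submod_set p (local_res (a + b) - (local_res a + local_res b)).
Proof. exact: (residueD TvalD TvalZ Tq). Qed.

Lemma local_res_tens t (c : Rp) : submod_set p (local_res (tens t c) - approx c 1 * Tval t).
Proof. exact: (residue_tens TvalD TvalZ Tq). Qed.

Lemma local_res_loc (c : Rp) : submod_set p (local_res (loc T c) - approx c 1).
Proof. by have := local_res_tens 1 c; rewrite [Tval 1]/(1 : K) mulr1. Qed.

Lemma local_res_glob t : submod_set p (local_res (glob p t) - Tval t).
Proof. exact: (residue_tens1 TvalD TvalZ Tq). Qed.

(** The component at p already determines L: if the generators satisfy x' = x u with u a unit of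
    R_p, reduction modulo p puts x' in x R + p. *)
Lemma Uident_inj L M : Ugroup p L -> Ugroup p M -> Uident p L p = Uident p M p -> L = M.
Proof.
suff sub L' M' : Ugroup p L' -> Ugroup p M' -> Uident p L' p = Uident p M' p ->
    M' `<=` L'.
  by move=> UL UM e; apply: submod_inj; apply/seteqP; split; apply: sub.
move=> /(Ugroup_gen)[x [y [Tx Ty pxy ->]]].
move=> /(Ugroup_gen)[x' [y' [Tx' Ty' pxy' ->]]].
rewrite (Uident_at Tx Ty pxy) (Uident_at Tx' Ty' pxy') => e.
apply: add_mod_subset; first exact: add_mod_sub.
have [_ [u _ <-] xu] : unit_coset (glob p (sub_elt Tx)) (glob p (sub_elt Tx')).
  by rewrite e; apply: unit_coset_refl.
exists (approx u 1); first exact: approxS.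
have := local_res_glob (sub_elt Tx'); rewrite -xu -/(loc T u) -tens_glob => p1.
have p2 := local_res_tens (sub_elt Tx) u.
rewrite (_ : x' - _ = (local_res (tens (sub_elt Tx : overring_type T) u) - approx u 1 * x)
  - (local_res (tens (sub_elt Tx : overring_type T) u) - x')); last by ring.
exact: (submod_zmod p).2.
Qed.

End At.
End UnitIdentification.

(** * Every family of local unit cosets comes from U *)

Section UnitSurjectivity.
Variables (Z : idomainType) (K : comAlgType {fraction Z}).
Hypothesis hZ : dedekind_domain Z.
Variables (R : subring K) (p : maxideal R).
Hypothesis lR : lattice R.
Local Notation T := (Tp p).
Local Notation Rp := (completion p).
Local Notation Tl := (local_ring T p).
Implicit Types (q : maxideal R) (L M : submod R) (t : overring_type T) (c : Rp).

Lemma glob_loc_const (a : subring_type R) t c :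
  subring_set R (\val a * \val (t : subring_type T)) ->
  exists d, glob p t * loc T (cpl_const p a * c) = loc T d.
Proof.
move=> Rat; exists (cpl_const p (sub_elt Rat) * c).
rewrite !locM mulrA loc_const -globM; congr (_ * _).
have Rat' : subring_set R (\val (t * overring_incl T a : subring_type T)).
  by rewrite /= mulrC.
rewrite (glob_loc _ Rat'); congr (loc T (cpl_const p _)); apply: val_inj.
exact: mulrC.
Qed.

(* With e not in p and e p^N contained in d R, where d T is contained in R:   *)
(* e c is an element of p plus d times a completed element.                   *)
Lemma glob_loc_res0 t c : submod_set p (approx c 1) ->
  exists d, glob p t * loc T c = loc T d.
Proof.
move=> pc; have [d d0 [pd dT]] := Tp_bound hZ p lR.
have [e [N [Re npe eN]]] := pow_maxideal_zscale hZ lR p d0.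
have [w wd] := zin_inv K d0.
pose x := approx c; pose m := N.+1.
have eNd n y : submod_set (pow_mod p (N + n)) y ->
    submod_set (pow_mod p n) (w * e * y) /\ zin d * (w * e * y) = e * y.
  move=> /eN[z pz ez]; have -> : w * e * y = z by rewrite -mulrA ez mulrA wd mul1r.
  by split.
(* z n is e (x_(m+n) - x_m) / d. Starting at m = N + 1 leaves one power of p after the division by
   d, so z n lies in R; the sequence is coherent for the same reason. *)
pose z n := w * e * (x (m + n)%N - x m).
have Rz n : subring_set R (z n).
  apply: (pow_modS (q := p) (n := 1)); apply: (eNd 1%N _ _).1.
  by rewrite addn1; apply: approx_diff; rewrite leq_addr.
have zc n : submod_set (pow_mod p n) (z n.+1 - z n).
  have -> : z n.+1 - z n = w * e * (x (m + n).+1 - x (m + n)%N).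
    by rewrite /z addnS; ring.
  by apply: (eNd n _ _).1; apply: pow_mod_sub; apply: approx_coherent.
pose zeta : Rp := cpl_of Rz zc.
have Tt : subring_set T (\val (t : subring_type T)) by apply: set_mem (valP (t : subring_type T)).
have pxm : submod_set p (x m).
  rewrite -(subrK (x 1%N) (x m)); apply: (zmod_setD (submod_zmod p)) => //.
  by rewrite -pow_mod1; apply: approx_diff.
have Rxm := maxidealS pxm.
have Rd := maxidealS pd.
pose ce := cpl_const p (sub_elt Re).
have ec : ce * c = ce * cpl_const p (sub_elt Rxm) + cpl_const p (sub_elt Rd) * zeta.
  have zp n := submod_zmod (pow_mod p n).
  apply: cpl_ext => n; rewrite cpl_addE !cpl_mulE (cpl_val_approx c).
  rewrite -[cpl_val zeta n]/(coset (pow_mod p n) (z n)) !cpl_constE !pow_mod_mulE //;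
    last exact: approxS.
  rewrite coset_addE //; apply: eq_coset => //=.
  have [|_ ezn] := eNd 1%N (x (m + n)%N - x m).
    by rewrite addn1; apply: approx_diff; rewrite leq_addr.
  have -> : e * approx c n - (e * x m + zin d * z n) = - e * (x (m + n)%N - x n).
    by rewrite {1}/z ezn /x; ring.
  rewrite mulNr; apply: zmod_setN => //; apply: submodM => //.
  by apply: approx_diff; rewrite leq_addl.
have [v ev] := @cpl_const_unit _ _ p (sub_elt Re) npe; rewrite -/ce in ev.
(* So c is x_m plus d times a completed element, where t x_m lies in p and t d in R. *)
have -> : c = cpl_const p (sub_elt Rxm) * 1 + cpl_const p (sub_elt Rd) * (v * zeta).
  apply: (etrans (y := v * (ce * c))); first by rewrite mulrA [v * ce]mulrC ev mul1r.
  by rewrite ec mulrDr mulr1 mulrA [v * ce]mulrC ev mul1r mulrCA.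
have [d1 e1] : exists d, glob p t * loc T (cpl_const p (sub_elt Rxm) * 1) = loc T d.
  by apply: glob_loc_const; apply: maxidealS; rewrite mulrC; apply: TpM pxm.
have [d2 e2] := @glob_loc_const (sub_elt Rd) t (v * zeta) (dT _ Tt).
by exists (d1 + d2); rewrite !locD mulrDr e1 e2.
Qed.

Lemma maxideal_approxB c (a : subring_type R) :
  submod_set p (approx c 1 - \val a) -> submod_set p (approx (c - cpl_const p a) 1).
Proof.
move=> pca; have zp := submod_zmod p.
have p1 := approxD (c - cpl_const p a) (cpl_const p a) 1.
have p2 := approx_const p a 1.
rewrite subrK in p1; rewrite pow_mod1 in p1 p2.
rewrite (_ : approx _ 1 = (approx c 1 - \val a)
   - (approx (cpl_const p a) 1 - \val a)
   - (approx c 1 - (approx (c - cpl_const p a) 1 + approx (cpl_const p a) 1))).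
  by apply: zp.2 => //; apply: zp.2.
by ring.
Qed.

Lemma approx_mul0 c c' : submod_set p (approx c' 1) -> submod_set p (approx (c * c') 1).
Proof.
move=> pc; rewrite -(subrK (approx c 1 * approx c' 1) (approx (c * c') 1)).
apply: (zmod_setD (submod_zmod p)); first by rewrite -pow_mod1; apply: approxM.
by apply: submodM => //; apply: approxS.
Qed.

(** On [glob t * loc c], subtract from c a representative in R of its residue: the rest reduces to 0
    modulo p, and its product with t comes from R_p by [glob_loc_res0]. *)
Lemma local_ring_split (z : Tl) : exists t c,
  submod_set p (approx c 1) /\ z = glob p t + loc T c.
Proof.
have zp := submod_zmod p.
have p00 : submod_set p (approx (0 : Rp) 1).
  by have := approx_const p 0 1; rewrite pow_mod1 rmorph0 subr0.
elim/tensor_ext_ind: z => [|x y [t [c [pc ->]]] [t' [c' [pc' ->]]]|t c].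
- exists 0, 0; split=> //.
  have -> : glob p (0 : overring_type T) = 0.
    by apply: (addrI (glob p (0 : overring_type T))); rewrite -globD !addr0.
  by rewrite add0r; apply: (addrI (loc T (0 : Rp))); rewrite -locD !addr0.
- exists (t + t'), (c + c'); split; last by rewrite globD locD addrACA.
  rewrite -(subrK (approx c 1 + approx c' 1) (approx (c + c') 1)).
  apply: zmod_setD => //; last exact: zmod_setD.
  by rewrite -pow_mod1; apply: approxD.
have split_const (d : Rp) : exists (a : subring_type R) d', submod_set p (approx d' 1) /\
    d = cpl_const p a + d'.
  exists (sub_elt (approxS d 1)), (d - cpl_const p (sub_elt (approxS d 1))).
  split; last by rewrite addrC subrK.
  by apply: maxideal_approxB; rewrite subrr; case: zp.
have [a [c' [pc' ->]]] := split_const c.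
have [d de] := glob_loc_res0 t pc'; have [b [d' [pd' dE]]] := split_const d.
exists (t * overring_incl T a + overring_incl T b), d'; split=> //.
by rewrite locD mulrDr de dE locD !loc_const -globM addrA globD.
Qed.

(** Split x = t + c and its inverse y = s + d. Reducing x y = 1 modulo p shows that t s is 1 modulo
    p, so t is a unit of T_p and c / t comes from R_p. Hence x = t (1 + c / t), where the second
    factor is a unit of R_p. *)
Lemma local_unit_gen (x : Tl) : is_unit x -> exists a b (Ta : subring_set T a)
  (Tb : subring_set T b), submod_set p (1 - a * b) /\
  unit_coset x = unit_coset (glob p (sub_elt Ta : overring_type T)).
Proof.
move=> ux; have [y xy] := ux; have zp := submod_zmod p.
have [t [c [pc xE]]] := local_ring_split x.
have [s [d [pd yE]]] := local_ring_split y.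
have expand (A : comPzRingType) (a b k l : A) :
    (a + b) * (k + l) = a * k + a * l + (k * b + b * l).
  by rewrite mulrDl !mulrDr [b * k]mulrC.
pose Tval (t : overring_type T) : K := \val (t : subring_type T).
have TvalT u : subring_set T (Tval u) by apply: set_mem (valP (u : subring_type T)).
have resD (u v : Tl) k l : submod_set p (local_res u - k) ->
    submod_set p (local_res v - l) -> submod_set p (local_res (u + v) - (k + l)).
  move=> pu pv; have := local_resD u v => puv.
  rewrite (_ : _ - _ = (local_res (u + v) - (local_res u + local_res v))
    + ((local_res u - k) + (local_res v - l))); last by ring.
  by do 2?apply: zmod_setD => //.
have res_gl u (k : Rp) : submod_set p (approx k 1) ->
    submod_set p (local_res (glob p u * loc T k) - 0).
  move=> pk; rewrite subr0 -tens_glob.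
  rewrite -(subrK (approx k 1 * Tval u) (local_res _)); apply: zmod_setD => //.
    exact: local_res_tens.
  by rewrite mulrC; apply: TpM.
have pst : submod_set p (1 - Tval t * Tval s).
  have p1 : submod_set p (local_res (1 : Tl) - 1) by apply: local_res_glob.
  have : submod_set p (local_res (x * y) - (Tval t * Tval s + 0 + (0 + 0))).
    have -> : x * y = glob p (t * s) + glob p t * loc T d
        + (glob p s * loc T c + loc T (c * d)).
      by rewrite xE yE globM locM; apply: expand.
    have q4 : submod_set p (local_res (loc T (c * d)) - 0).
      rewrite subr0 -(subrK (approx (c * d) 1) (local_res _)).
      by apply: zmod_setD (local_res_loc _) (approx_mul0 c pd).
    exact: resD (resD _ _ _ _ (local_res_glob (t * s)) (res_gl t d pd))
                (resD _ _ _ _ (res_gl s c pc) q4).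
  rewrite xy !addr0 => p2.
  rewrite (_ : 1 - _ = (local_res (1 : Tl) - Tval t * Tval s) - (local_res (1 : Tl) - 1)).
    exact: zp.2.
  by ring.
exists (Tval t), (Tval s), (TvalT t), (TvalT s); split=> //.
have sub_val u : sub_elt (TvalT u) = u by apply: val_inj.
rewrite sub_val.
have factor a b k : submod_set p (1 - Tval a * Tval b) -> submod_set p (approx k 1) ->
    exists r, glob p a + loc T k = glob p a * loc T r.
  move=> pab pk; have [v] := glob_inv (TvalT a) (TvalT b) pab.
  rewrite !sub_val => abv.
  have [l le] := @glob_loc_res0 b (v * k) (approx_mul0 v pk).
  exists (1 + l); rewrite locD loc1 mulrDr mulr1 -le locM.
  by rewrite (mulrA (glob p b)) mulrA abv mul1r.
have [r rE] := factor t s c pst pc.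
have [r' r'E] : exists r, glob p s + loc T d = glob p s * loc T r.
  by apply: (factor s t d) => //; rewrite mulrC.
rewrite xE rE; apply: unit_coset_mul.
have Rts : subring_set R (\val (t * s : subring_type T)).
  rewrite -[\val _]/(Tval t * Tval s) -(subKr 1 (Tval t * Tval s)).
  by apply: (subring_zmod R).2; [apply: subring1|apply: maxidealS pst].
(* With x = t r and y = s r', the equation x y = 1 exhibits (t s) r' as the inverse of r. *)
apply: (@base_unit _ _ _ _ _ _ (cpl_const p (sub_elt Rts) * r')).
rewrite locM -(glob_loc _ Rts) globM -xy xE yE rE r'E.
by rewrite mulrCA mulrACA mulrA mulrAC.
Qed.

(** The component at p supplies the generator; at any other q every unit of T_q comes from a unit of
    R_q, so the coset is trivial. *)
Lemma Uident_surj (c : forall q, set (local_ring T q)) : prod_unit_cosets p c ->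
  exists2 L, Ugroup p L & Uident p L = c.
Proof.
move=> cP; have [x ux xc] := cP p.
have [a [b [Ta [Tb [pab xa]]]]] := local_unit_gen ux.
have UL := unit_gen_Ugroup hZ lR Ta Tb pab; exists (add_mod p a) => //.
apply: functional_extensionality_dep => q.
have [/maxideal_inj <-|npq] := pselect (p `<=` q).
  by rewrite (Uident_at Ta Tb pab) -xa xc.
rewrite (Uident_away npq UL); have [y [y' yy'] <-] := cP q.
have [r yr] := away_loc npq y; have [r' yr'] := away_loc npq y'.
rewrite -[RHS]/(unit_coset y) -[y]mul1r unit_coset_mul // yr.
by apply: (@base_unit _ _ _ _ _ _ r'); rewrite -yr -yr'.
Qed.

Lemma unit_gen_mul x y x' y' : subring_set T x -> subring_set T y ->
  subring_set T x' -> subring_set T y' ->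
  submod_set p (1 - x * y) -> submod_set p (1 - x' * y') ->
  [/\ subring_set T (x * x'), subring_set T (y * y'),
      submod_set p (1 - x * x' * (y * y'))
    & prod_mod (add_mod p x) (add_mod p x') = add_mod p (x * x')].
Proof.
move=> Tx Ty Tx' Ty' pxy pxy'; have zp := submod_zmod p.
split; [exact: subringM|exact: subringM| |].
  have -> : 1 - x * x' * (y * y') = (1 - x * y) + x * y * (1 - x' * y') by ring.
  by apply: zmod_setD => //; apply: TpM => //; apply: subringM.
apply: submod_inj; apply/seteqP; split.
  apply: prod_set_subZ; first exact: submod_zmod.
  move=> a b [s Rs ps] [s' Rs' ps']; exists (s * s'); first exact: subringM.
  have -> : a * b - s * s' * (x * x') = (s * x) * (b - s' * x')
    + (s' * x') * (a - s * x) + (b - s' * x') * (a - s * x) by ring.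
  have [Ts Ts'] := (overringS T Rs, overringS T Rs').
  apply: zmod_setD => //; first apply: zmod_setD => //.
  - by apply: TpM => //; apply: subringM.
  - by apply: TpM => //; apply: subringM.
  - by apply: TpM => //; apply: p_sub_Tp.
apply: add_mod_subset; last by apply: mem_prod_set; apply: add_mod_gen.
rewrite -[X in X `<=` _](Ugroup_p (unit_gen_Ugroup hZ lR Tx' Ty' pxy')).
by apply: prod_setS => //; apply: add_mod_sub.
Qed.

Lemma Uident_mul L M q : Ugroup p L -> Ugroup p M ->
  Uident p (prod_mod L M) q = [set x * y | x in Uident p L q & y in Uident p M q].
Proof.
move=> UL UM; have [/maxideal_inj <-|npq] := pselect (p `<=` q); last first.
  rewrite !(Uident_away npq) //; last exact: Ugroup_mul.
  by apply: etrans (unit_coset_prod 1 1); rewrite mulr1.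
have [x [y [Tx Ty pxy ->]]] := Ugroup_gen UL.
have [x' [y' [Tx' Ty' pxy' ->]]] := Ugroup_gen UM.
have [Txx Tyy pxxyy ->] := unit_gen_mul Tx Ty Tx' Ty' pxy pxy'.
rewrite (Uident_at Tx Ty pxy) (Uident_at Tx' Ty' pxy') (Uident_at Txx Tyy pxxyy).
rewrite -unit_coset_prod -globM; congr (unit_coset (glob p _)); exact: val_inj.
Qed.

Lemma Uident_cosets L : Ugroup p L -> prod_unit_cosets p (Uident p L).
Proof.
move=> UL q; have [/maxideal_inj <-|npq] := pselect (p `<=` q); last first.
  by rewrite (Uident_away npq UL); exists 1; first exact: is_unit1.
have [x [y [Tx Ty pxy ->]]] := Ugroup_gen UL; rewrite (Uident_at Tx Ty pxy).
have [v ve] := glob_inv Tx Ty pxy.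
by exists (glob p (sub_elt Tx)); first by exists (glob p (sub_elt Ty) * loc T v).
Qed.

End UnitSurjectivity.

(** * Weak equivalence classes *)

Section WeakClasses.
Variables (Z : idomainType) (K : comAlgType {fraction Z}) (S : subring K).
Hypotheses (hZ : dedekind_domain Z) (lS : lattice S).
Implicit Types I J L : submod S.

Lemma weak_class_eq I J : weakly_equivalent I J -> weak_class I = weak_class J.
Proof.
move=> IJ; apply/seteqP; split=> L [lL IL]; split=> //.
  exact: weakly_equivalent_trans (weakly_equivalent_sym IJ) IL.
exact: weakly_equivalent_trans IJ IL.
Qed.

Lemma weak_class_equiv I J : lattice J -> weak_class I = weak_class J ->
  weakly_equivalent I J.
Proof.
move=> lJ e; have : weak_class J J by split=> //; apply: weakly_equivalent_refl.
by rewrite -e => -[].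
Qed.

(** L = (J : I) has inverse (I : J), and J = (J : I)(I : J) J is contained in (J : I) I. *)
Lemma weakly_equivalentP I J : lattice I -> lattice J -> colon I I = S ->
  weakly_equivalent I J -> exists L L', [/\ L ** L' = S, L ** I = J & L' ** J = I].
Proof.
move=> lI lJ II IJ; have LL' := weakly_equivalent_invertible hZ lS lI lJ II IJ.
exists (colon_mod J I), (colon_mod I J); split.
- by rewrite prod_setC.
- apply/seteqP; split; first exact: prod_colon_sub (submod_zmod J).
  rewrite -[X in X `<=` _]prod_ring_submod -LL' [colon I J ** _]prod_setC -prod_setA.
  by apply: prod_setS => //; apply: prod_colon_sub (submod_zmod I).
- apply/seteqP; split; first exact: prod_colon_sub (submod_zmod I).
  rewrite -[X in X `<=` _]prod_ring_submod -LL' -prod_setA.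
  by apply: prod_setS => //; apply: prod_colon_sub (submod_zmod J).
Qed.

End WeakClasses.

(** * Representatives I with I T = J *)

Section Adapted.
Variables (Z : idomainType) (K : comAlgType {fraction Z}).
Hypothesis hZ : dedekind_domain Z.
Variables (R : subring K) (p : maxideal R).
Hypothesis lR : lattice R.
Local Notation T := (Tp p).
Implicit Types (I L : submod R) (J : submod T).

Lemma prod_Tp_ring : T ** R = T.
Proof. by rewrite prod_setC prod_ring_Tp. Qed.

Lemma ext_mod_inv L L' : L ** L' = R -> ext_mod p L ** ext_mod p L' = T.
Proof.
move=> LL'; rewrite -[LHS]/((T ** L) ** (T ** L')) [T ** L']prod_setC prod_setA -(prod_setA T) LL'.
by rewrite prod_Tp_ring prod_ringxx.
Qed.

(** Write J = M T I0 with M invertible over T and lift M to an invertible R-ideal L; then I = L I0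
    satisfies I T = J, and p J = p I is contained in I. *)
Lemma adapted_exists I0 J : lattice I0 -> colon I0 I0 = R -> lattice J ->
  weakly_equivalent (ext_mod p I0) J ->
  exists I, [/\ weakly_equivalent I0 I, intermediate J I & I ** T = J].
Proof.
move=> lI0 I0R lJ EJ; have lE := ext_lattice hZ p lR lI0.
have [M [M' [MM' ME _]]] := weakly_equivalentP hZ (lattice_Tp hZ p lR) lE lJ
  (colon_ext p I0R) EJ.
have [L [L' [LL' LT]]] := invertible_lift hZ lR MM'.
have IT : L ** I0 ** T = J.
  by rewrite -ME -[X in _ = _ ** X]/(T ** I0) prod_setAC LT prod_setA prod_submod_ring.
exists (prod_mod L I0); split=> //; first exact: (weakly_equivalent_mul LL').
split=> [|x Ix]; last by rewrite -IT; apply: sub_ext Ix.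
rewrite -IT prod_setA prod_setAC p_Tp.
apply: prod_set_subZ => [|a x /maxidealS]; first exact: submod_zmod (prod_mod L I0).
by apply: (submodM (s := prod_mod L I0)).
Qed.

Lemma adapted_colon I0 I : lattice I0 -> colon I0 I0 = R -> lattice I ->
  weakly_equivalent I0 I -> colon I I = R.
Proof.
move=> lI0 I0R lI I0I; have [L [L' [LL' <- _]]] := weakly_equivalentP hZ lR lI0 lI I0R I0I.
by rewrite (colon_mul_invertible I0 LL').
Qed.

(** If I' = L I, then J' = (L T) J with L T invertible over T. This is why the index i depends only
    on the class. *)
Lemma adapted_equivalent I I' J J' : lattice I -> lattice I' -> colon I I = R ->
  I ** T = J -> I' ** T = J' -> weakly_equivalent I I' -> weakly_equivalent J J'.
Proof.
move=> lI lI' IR IT IT' II'.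
have [L [L' [LL' LI _]]] := weakly_equivalentP hZ lR lI lI' IR II'.
apply: (weakly_equivalent_mul (ext_mod_inv LL')).
rewrite -IT -IT' -LI -[X in X ** _]/(T ** L) [T ** L]prod_setC -(prod_setA L).
by rewrite [I ** T]prod_setC (prod_setA T) prod_ringxx [T ** I]prod_setC prod_setA.
Qed.

(** If L I = I' and both extend to J, then (L T) J = J, so L T lies in (J : J) = T; the same holds
    for the inverse of L, and together they give L T = T. *)
Lemma adapted_orbit I I' J : lattice I -> lattice I' -> colon I I = R -> colon J J = T ->
  I ** T = J -> I' ** T = J -> weakly_equivalent I I' ->
  exists2 L, Ugroup p L & I' = prod_mod L I.
Proof.
move=> lI lI' IR JJ IT IT' II'.
have [L [L' [LL' LI L'I']]] := weakly_equivalentP hZ lR lI lI' IR II'.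
have sub (N N1 N2 : submod R) : N ** N1 = N2 -> N1 ** T = J -> N2 ** T = J ->
    N ** T `<=` T.
  move=> e e1 e2; rewrite -[X in _ `<=` X]JJ; apply/(colonP _ _ (submod_zmod J)).
  by rewrite prod_setAC -e1 prod_setA e -prod_setA prod_ringxx e2 e1.
have LT := sub _ _ _ LI IT IT'; have L'T := sub _ _ _ L'I' IT' IT.
exists L; last by apply: submod_inj.
apply: (Ugroup_intro hZ lR LL'); apply/seteqP; split=> //.
rewrite -[X in X `<=` _](prod_ring_Tp p) -LL' -prod_setA.
exact: prod_setS.
Qed.

Lemma Uorbit_mul J L I : Ugroup p L -> intermediate J I ->
  Uorbit J (Psi J (prod_mod L I)) = Uorbit J (Psi J I).
Proof.
move=> UL iI; have [L' UL' LL'] := Ugroup_inv hZ lR UL.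
have iLI := Ugroup_intermediate UL iI.
apply/seteqP; split=> _ [N UN <-]; rewrite Uact_Psi //.
  exists (prod_mod N L); first exact: (Ugroup_mul hZ lR).
  by rewrite Uact_Psi //; congr Psi; rewrite /= prod_setA.
exists (prod_mod N L'); first exact: (Ugroup_mul hZ lR).
rewrite Uact_Psi //; congr Psi => /=.
by rewrite -prod_setA (prod_setA L') [L' ** L]prod_setC LL' prod_ring_submod.
Qed.

End Adapted.

(** * Assembly of the bijection *)

Unset Implicit Arguments.

Theorem theorem7p2 (Z : idomainType) (K : comAlgType {fraction Z})
  (hZ : dedekind_domain Z) (hK : etale_algebra K)
  (R : subring K) (hR : lattice R) (p : maxideal R)
  (n : nat) (J : 'I_n -> submod (Tp p))
  (hJ : forall i, lattice (J i) /\ colon (J i) (J i) = Tp p :> set K)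
  (hrep : set_bij [set: 'I_n] (Wbar (Tp p)) (fun i => weak_class (J i))) :
  [/\ forall i, set_bij (between (J i)) (subspaces (J i))
                        (fun I : submod R => Psi (J i) I),
      set_bij (Ugroup p) (prod_unit_cosets p) (Uident p) /\
      (forall L M, Ugroup p L -> Ugroup p M ->
         Ugroup p (prod_mod L M) /\
         forall q, Uident p (prod_mod L M) q =
                   [set x * y | x in Uident p L q & y in Uident p M q]),
      forall i,
        [/\ forall (L I : submod R), Ugroup p L -> between (J i) I ->
              Vset (J i) (Psi (J i) I) ->
              between (J i) (prod_mod L I) /\
              Uact (J i) L (Psi (J i) I) = Psi (J i) (prod_mod L I),
            forall L V, Ugroup p L -> Vset (J i) V ->
              Vset (J i) (Uact (J i) L V),
            forall V, Vset (J i) V -> Uact (J i) (ring_mod R) V = V,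
            forall L M V, Ugroup p L -> Ugroup p M -> Vset (J i) V ->
              Uact (J i) (prod_mod L M) V = Uact (J i) L (Uact (J i) M V)
          & forall L V, Ugroup p L -> Vset (J i) V ->
              Uact (J i) L V = V -> L = ring_mod R]
    & exists Phi : set (submod R) -> 'I_n * set (set (set K)),
        set_bij (Wbar R) (Vorbits J) Phi /\
        forall I0 : submod R, lattice I0 -> colon I0 I0 = R :> set K ->
          let adapted i (I : submod R) :=
            [/\ weakly_equivalent I0 I, between (J i) I
              & prod_set I (Tp p) = J i :> set K] in
          (exists i I, adapted i I) /\
          forall i I, adapted i I ->
            Phi (weak_class I0) = (i, Uorbit (J i) (Psi (J i) I))].
Proof.
have lJ i := (hJ i).1; have JJ i := (hJ i).2.
have btw i I : between (J i) I <-> intermediate (J i) I by apply: between_intermediate.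
have [hfun hinj hsurj] := hrep.
split.
- move=> i; split=> [I /btw/Psi_subspaces //|I I' /set_mem/btw iI /set_mem/btw iI'|V sV].
    exact: Psi_inj.
  exists (Psi_inv_mod sV); last exact: Psi_invK.
  exact/btw/Psi_inv_intermediate.
- split; last first.
    move=> L M UL UM; split; first exact: (Ugroup_mul hZ hR).
    by move=> q; apply: (Uident_mul hZ hR).
  split=> [L|L L' /set_mem UL /set_mem UL' e|c /(Uident_surj hZ hR)[L UL e]].
  + exact: Uident_cosets.
  + by apply: (Uident_inj UL UL'); rewrite e.
  + by exists L.
- move=> i; split.
  + move=> L I UL /btw iI _; split; last exact: Uact_Psi.
    exact/btw/Ugroup_intermediate.
  + move=> L V UL /(Vset_ex (JJ i))[I [iI -> II IT]].
    rewrite Uact_Psi //; apply/(Vset_Psi (JJ i)) => //; first exact: Ugroup_intermediate.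
    exact: (Ugroup_Vset hZ hR).
  + move=> V /(Vset_ex (JJ i))[I [iI -> _ _]].
    by rewrite Uact_Psi // prod_mod1.
  + move=> L M V UL UM /(Vset_ex (JJ i))[I [iI -> _ _]]; have iMI := Ugroup_intermediate UM iI.
    by rewrite !Uact_Psi //; congr Psi; rewrite /= prod_setA.
  + move=> L V UL /(Vset_ex (JJ i))[I [iI -> II _]]; rewrite Uact_Psi // => e.
    have LI := Psi_inj (Ugroup_intermediate UL iI) iI e.
    by apply: (Ugroup_free hZ hR UL II); have := congr1 (@submod_set _ _) LI.
pose adapted (I0 : submod R) i (I : submod R) :=
  [/\ weakly_equivalent I0 I, between (J i) I & I ** Tp p = J i].
have adapted_ex (I0 : submod R) : lattice I0 -> colon I0 I0 = R -> exists i I, adapted I0 i I.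
  move=> lI0 I0R; have WE : Wbar (Tp p) (weak_class (ext_mod p I0)).
    by exists (ext_mod p I0) => //; split; [apply: ext_lattice|apply: colon_ext].
  have [i _ e] := hsurj _ WE.
  have EJ := weakly_equivalent_sym (weak_class_equiv (ext_lattice hZ p hR lI0) e).
  have [I [I0I iI IT]] := adapted_exists hZ hR lI0 I0R (lJ i) EJ.
  by exists i, I; split=> //; apply/btw.
pose rel (X : set (submod R)) (o : 'I_n * set (set (set K))) := exists (I0 : submod R) i I,
  [/\ lattice I0, colon I0 I0 = R, X = weak_class I0, adapted I0 i I
    & o = (i, Uorbit (J i) (Psi (J i) I))].
(* The class of T itself shows that some index i0 exists, as the default value of Phi requires. *)
have WT : Wbar (Tp p) (weak_class (ring_mod (Tp p))).
  exists (ring_mod (Tp p)) => //; split; first exact: lattice_Tp.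
  apply/seteqP; split=> [a aT|a Ta x Tx]; last exact: subringM.
  by rewrite -[a]mulr1; apply/aT/subring1.
have [i0 _ _] := hsurj _ WT.
(* Phi is chosen along [rel], which is defined on all of Wbar R by [adapted_ex]; elsewhere it takes
   the junk value (i0, set0). *)
have /choice[Phi PhiP] : forall X, exists o, (exists o', rel X o') -> rel X o.
  move=> X; have [[o Xo]|nX] := pselect (exists o, rel X o); first by exists o.
  by exists (i0, set0) => /nX.
(* Neither the representative of the class nor the adapted ideal matters: the index is fixed because
   the J_i are in distinct classes, the orbit by [adapted_orbit]. *)
have rel_uniq X o o' : rel X o -> rel X o' -> o = o'.
  move=> [I0 [i [I [lI0 I0R -> [I0I bI IT] ->]]]] [I0' [i' [I' [lI0' I0R' e [I0I' bI' IT'] ->]]]].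
  have [lI _ _] := bI; have [lI' _ _] := bI'.
  have IR := adapted_colon hZ hR lI0 I0R lI I0I.
  have II' : weakly_equivalent I I'.
    apply: weakly_equivalent_trans (weakly_equivalent_sym I0I) _.
    exact: weakly_equivalent_trans (weak_class_equiv lI0' e) I0I'.
  have ii' : i = i'.
    apply: hinj; rewrite ?inE //; apply: weak_class_eq.
    exact: (adapted_equivalent hZ hR lI lI' IR IT IT' II').
  subst i'.
  have [L UL ->] := adapted_orbit hZ hR lI lI' IR (JJ i) IT IT' II'.
  by rewrite Uorbit_mul //; apply/btw.
have Phi_adapted (I0 : submod R) i I : lattice I0 -> colon I0 I0 = R -> adapted I0 i I ->
    Phi (weak_class I0) = (i, Uorbit (J i) (Psi (J i) I)).
  move=> lI0 I0R aI; have XI : rel (weak_class I0) (i, Uorbit (J i) (Psi (J i) I)).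
    by exists I0, i, I.
  exact: (rel_uniq _ _ _ (PhiP _ (ex_intro _ _ XI)) XI).
exists Phi; split; last first.
  move=> I0 lI0 I0R adapted'; split; first exact: (adapted_ex I0 lI0 I0R).
  by move=> i I aI; exact: (Phi_adapted I0 i I lI0 I0R aI).
split.
- move=> _ [I0 [lI0 I0R] <-]; have [i [I aI]] := adapted_ex I0 lI0 I0R.
  rewrite (Phi_adapted I0 i I) //; have [I0I bI IT] := aI; have [lI _ _] := bI.
  exists (Psi (J i) I) => //; apply/(Vset_Psi (JJ i)) => //; first exact/btw.
  by split=> //; apply: adapted_colon I0I.
- move=> _ _ /set_mem[I0 [lI0 I0R] <-] /set_mem[I0' [lI0' I0R'] <-].
  have [i [I aI]] := adapted_ex I0 lI0 I0R; have [i' [I' aI']] := adapted_ex I0' lI0' I0R'.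
  rewrite (Phi_adapted _ _ _ _ _ aI) // (Phi_adapted _ _ _ _ _ aI') // => -[ii'].
  subst i' => e; have [I0I /btw iI _] := aI; have [I0I' /btw iI' _] := aI'.
  (* R belongs to U, so Psi I' lies in its own orbit; equality of the orbits then yields L in U with
     L I = I'. *)
  have : Uorbit (J i) (Psi (J i) I') (Psi (J i) I').
    exists (ring_mod R); first exact: (Ugroup1 hZ p hR).
    by rewrite Uact_Psi // prod_mod1.
  rewrite -e => -[L UL]; rewrite Uact_Psi // => /Psi_inj LI.
  have {LI} LI := LI (Ugroup_intermediate UL iI) iI'.
  have [L' _ LL'] := Ugroup_inv hZ hR UL.
  apply: weak_class_eq; apply: weakly_equivalent_trans I0I _.
  apply: weakly_equivalent_trans (weakly_equivalent_sym I0I').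
  by apply: (weakly_equivalent_mul LL'); have := congr1 (@submod_set _ _) LI.
- move=> [i orb] [V /(Vset_ex (JJ i))[I [iI -> II IT]] /= ->].
  have /btw bI := iI; have [lI _ _] := bI.
  (* The ideal I behind V is adapted to itself. *)
  exists (weak_class I); first by exists I.
  by apply: Phi_adapted => //; split=> //; apply: weakly_equivalent_refl.
Qed.
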